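(* Let $(c_n)_{n=1}^\infty$ be a regular sequence with subexponential growth, i.e. a sequence of real numbers such that $c_n\ge e$ for all $n$, $(c_n)$ is monotone increasing, and $\frac{\log c_n}{n}\downarrow 0$ as $n\to\infty$. Then there exists a sequence $\gamma=(\gamma_s)_{s=1}^\infty$ with $0<\gamma_s<1/4$ for all $s$ such that the associated Cantor set $K(\gamma)\subset[0,1]$ is non-polar and the following hold. (i) If $x_0$ lies in an unbounded gap of $K(\gamma)$ (i.e. $x_0\in\mathbb R\setminus[0,1]$), then for all $n\in\mathbb N$, $$W_{\infty,n}^{(x_0)}(K(\gamma))\ge c_n^{\tau_{x_0}}.$$ (ii) If $x_0\in(0,1)\setminus K(\gamma)$, then there exists an integer $s_0$ such that for all $s\ge s_0$, $$W_{\infty,2^s}^{(x_0)}(K(\gamma))\ge c_{2^s}^{\tau_{x_0}}.$$ Here, for $x_0\in\mathbb R\setminus K(\gamma)$, the exponent is $\tau_{x_0}:=\dfrac{1}{\tau_{\Omega_{x_0}}(x_0,\infty)}$, where $L_{x_0}$ is the connected component of $\mathbb R\setminus K(\gamma)$ containing $x_0$, $\Omega_{x_0}:=(\overline{\mathbb C}\setminus[0,1])\cup L_{x_0}$, and $\tau_{\Omega_{x_0}}$ denotes the Harnack distance on $\Omega_{x_0}$. In particular, if $(c_n)_{n=1}^\infty$ is in addition unbounded, then there exists a non-polar Cantor set $K(\gamma)$ such that $\sup_{n} W_{\infty,n}^{(x_0)}(K(\gamma))=\infty$ for all $x_0\in\mathbb R\setminus K(\gamma)$.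
   Context: $\mathbb N=\{1,2,3,\dots\}$ and $\overline{\mathbb C}=\mathbb C\cup\{\infty\}$. $\operatorname{Cap}$ denotes logarithmic capacity; a compact set $K\subset\mathbb C$ is non-polar if $\operatorname{Cap}(K)>0$, and then $\mu_K$ denotes its equilibrium measure. ''Monotone increasing'' is understood in the weak sense (nondecreasing), and $\frac{\log c_n}{n}\downarrow0$ means that this sequence is monotone decreasing (nonincreasing) with limit $0$. $\|\cdot\|_K$ is the sup-norm on $K$. Green function. For a non-polar compact set $K\subset\mathbb C$, $$g_K(z)=-\log\operatorname{Cap}(K)+\int\log|z-\zeta|\,d\mu_K(\zeta),\qquad z\in\mathbb C,$$ is the Green function with pole at infinity of the unbounded component of $\overline{\mathbb C}\setminus K$. Gaps. For a compact non-polar $K\subset\mathbb R$, the gaps of $K$ are the connected components of $\mathbb R\setminus K$; the unbounded gaps are $(-\infty,\inf K)$ and $(\sup K,\infty)$. Residual polynomials and their Widom factors. For a compact non-polar $K\subset\mathbb R$, $x_0\in\mathbb R\setminus K$ and $n\in\mathbb N$, the $n$-th residual polynomial $R_{n,K}^{(x_0)}$ is the unique polynomial of degree at most $n$ that minimizes $\|P\|_K$ among all polynomials $P$ of degree at most $n$ with $P(x_0)=1$. Define $$W_{\infty,n}^{(x_0)}(K):=\frac{\|R_{n,K}^{(x_0)}\|_K}{e^{-n g_K(x_0)}}.$$ Harnack distance. For a domain $\Omega\subset\overline{\mathbb C}$ and $z,w\in\Omega$, the Harnack distance $\tau_\Omega(z,w)$ is the smallest number $\tau$ such that $\tau^{-1}h(w)\le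 h(z)\le\tau\,h(w)$ for every strictly positive harmonic function $h:\Omega\to\mathbb R$. The sets $K(\gamma)$. Let $\gamma=(\gamma_s)_{s=1}^\infty$ with $0<\gamma_s<1/4$ for all $s\in\mathbb N$. Put $r_0:=1$ and $r_s:=\gamma_s r_{s-1}^2$ for $s\ge1$. Define polynomials recursively by $P_2(x)=x(x-1)$ and $P_{2^{s+1}}(x):=P_{2^s}(x)\,(P_{2^s}(x)+r_s)$ for $s\ge 1$. Let $E_0:=[0,1]$ and, for $s\in\mathbb N$, $$E_s:=\left(\frac{2}{r_s}P_{2^s}+1\right)^{-1}([-1,1])=\left\{z\in\mathbb C:\ \frac{2}{r_s}P_{2^s}(z)+1\in[-1,1]\right\}.$$ Each $E_s$ is a disjoint union of $2^s$ non-trivial closed intervals contained in $[0,1]$, and $E_s\subset E_{s-1}$. Define $K(\gamma):=\bigcap_{s=0}^\infty E_s$. It is a Cantor set (a totally disconnected, perfect compact set) contained in $[0,1]$ and containing $0$ and $1$. *)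

(* Defs.v *)
From HB Require Import structures.
From mathcomp Require Import all_boot all_order all_algebra.
From mathcomp Require Import complex.
From mathcomp Require Import all_classical all_reals all_analysis.

Set Implicit Arguments.
Unset Strict Implicit.
Unset Printing Implicit Defensive.

Import Order.TTheory GRing.Theory Num.Theory.
Import numFieldNormedType.Exports.

Local Open Scope classical_set_scope.
Local Open Scope ring_scope.
Local Open Scope complex_scope.

(* The complex plane is represented by R * R, on which the library provides  *)
(* the topology, the R-vector space structure and the Borel sigma-algebra;   *)
(* its field structure is obtained through [cplx].                           *)
(* The norm of the normed module R * R is the sup norm: the modulus is       *)
(* always taken with [normc].                                                *)
Notation plane R := (R * R)%type.

Definition cplx (R : realType) (z : plane R) : R[i] := z.1 +i* z.2.

Definition cdist (R : realType) (z w : plane R) : R :=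
  ComplexField.Normc.normc (cplx z - cplx w).

Definition unit_segment (R : realType) : set (plane R) :=
  [set z | 0 <= z.1 <= 1 /\ z.2 = 0].

(* [lne] is the extended logarithm, lne 0 = -oo, so that the diagonal        *)
(* contributes +oo to the energy.                                            *)
Definition energy (R : realType) (mu : probability (plane R) R) : \bar R :=
  (\int[mu]_z \int[mu]_w - lne (cdist z w)%:E)%E.

Definition carried_by (R : realType) (K : set (plane R)) :
    set (probability (plane R) R) :=
  [set mu | mu K = 1%E].

Definition Cap (R : realType) (K : set (plane R)) : R :=
  fine (expeR (- ereal_inf [set energy mu | mu in carried_by K])).

Definition is_equilibrium_measure (R : realType) (K : set (plane R))
    (mu : probability (plane R) R) : Prop :=
  carried_by K mu /\
  forall nu : probability (plane R) R,
    carried_by K nu -> (energy mu <= energy nu)%E.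

Definition equilibrium_measure (R : realType) (K : set (plane R)) :
    probability (plane R) R :=
  xget (dirac (0 : plane R) : {classic probability (plane R) R})
    (is_equilibrium_measure K).

(* For a compact non-polar K the integral is finite at every z, by           *)
(* Frostman's theorem, so that [fine] loses nothing.                         *)
Definition green (R : realType) (K : set (plane R)) (z : plane R) : R :=
  - ln (Cap K) +
  fine (\int[equilibrium_measure K]_w lne (cdist z w)%:E)%E.

Definition sup_norm (R : realType) (K : set (plane R)) (P : {poly R[i]}) : R :=
  sup [set ComplexField.Normc.normc P.[cplx z] | z in K].

Definition residual_candidate (R : realType) (x0 : R) (n : nat) :
    set {poly R[i]} :=
  [set P : {poly R[i]} | (size P <= n.+1)%N /\ P.[x0%:C] = 1].

Definition is_residual (R : realType) (K : set (plane R)) (x0 : R) (n : nat)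
    (P : {poly R[i]}) : Prop :=
  residual_candidate x0 n P /\
  forall Q, residual_candidate x0 n Q -> sup_norm K P <= sup_norm K Q.

Definition residual_poly (R : realType) (K : set (plane R)) (x0 : R)
    (n : nat) : {poly R[i]} :=
  xget 0 (is_residual K x0 n).

Definition widom_factor (R : realType) (K : set (plane R)) (x0 : R)
    (n : nat) : R :=
  sup_norm K (residual_poly K x0 n) / expR (- (n%:R * green K (x0, 0))).

Definition sphere (R : realType) : Type :=
  one_point_compactification (plane R).

(* The chart w |-> 1 / w around the point at infinity, represented by None.  *)
Definition inv_chart (R : realType) (w : plane R) : sphere R :=
  if w == 0 then None
  else let v := (cplx w)^-1 in Some (complex.Re v, complex.Im v).

Definition C1_at (R : realType) (u : plane R -> R) (z : plane R) : Prop :=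
  [/\ derivable u z ((1, 0) : plane R),
      derivable u z ((0, 1) : plane R),
      {for z, continuous ('D_((1, 0) : plane R) u)} &
      {for z, continuous ('D_((0, 1) : plane R) u)}].

Definition C2_at (R : realType) (u : plane R -> R) (z : plane R) : Prop :=
  [/\ C1_at u z,
      C1_at ('D_((1, 0) : plane R) u) z &
      C1_at ('D_((0, 1) : plane R) u) z].

Definition laplacian (R : realType) (u : plane R -> R) (z : plane R) : R :=
  'D_((1, 0) : plane R) ('D_((1, 0) : plane R) u) z +
  'D_((0, 1) : plane R) ('D_((0, 1) : plane R) u) z.

Definition harmonic_at (R : realType) (u : plane R -> R) (z : plane R) :
    Prop :=
  \forall w \near z, C2_at u w /\ laplacian u w = 0.

(* Intended for an open set Omega of the sphere; only the restriction of h   *)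
(* to Omega then matters.                                                    *)
Definition harmonic_on (R : realType) (Omega : set (sphere R))
    (h : sphere R -> R) : Prop :=
  forall p, Omega p ->
    match p with
    | Some z => harmonic_at (fun w => h (Some w)) z
    | None => harmonic_at (fun w => h (inv_chart w)) 0
    end.

Definition harnack_distance (R : realType) (Omega : set (sphere R))
    (z w : sphere R) : R :=
  inf [set tau : R | forall h : sphere R -> R,
    harmonic_on Omega h -> (forall p, Omega p -> 0 < h p) ->
    tau^-1 * h w <= h z <= tau * h w].

(* The value gam 0 is not used. *)
Fixpoint rseq (R : realType) (gam : nat -> R) (s : nat) : R :=
  if s is t.+1 then gam s * rseq gam t ^+ 2 else 1.

(* [Ppol gam s] is the polynomial P_{2^(s+1)}. *)
Fixpoint Ppol (R : realType) (gam : nat -> R) (s : nat) : {poly R} :=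
  if s is t.+1 then Ppol gam t * (Ppol gam t + (rseq gam s)%:P)
  else 'X * ('X - 1).

Definition Eset (R : realType) (gam : nat -> R) (s : nat) : set (plane R) :=
  if s is t.+1 then
    [set z | exists2 y : R, -1 <= y <= 1 &
      (2 / rseq gam s)%:C * (map_poly (real_complex R) (Ppol gam t)).[cplx z]
        + 1 = y%:C]
  else @unit_segment R.

Definition Kset (R : realType) (gam : nat -> R) : set (plane R) :=
  \bigcap_s Eset gam s.

Definition cantor_set (R : realType) (K : set (plane R)) : Prop :=
  [/\ compact K, perfect_set K & totally_disconnected K].

Definition real_trace (R : realType) (K : set (plane R)) : set R :=
  [set x | K (x, 0)].

Definition gap_of (R : realType) (K : set (plane R)) (x0 : R) : set R :=
  connected_component (~` real_trace K) x0.

Definition Omega_of (R : realType) (K : set (plane R)) (x0 : R) :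
    set (sphere R) :=
  [set p | if p is Some z then
             ~ unit_segment z \/ (z.2 = 0 /\ gap_of K x0 z.1)
           else True].

Definition tau_exponent (R : realType) (K : set (plane R)) (x0 : R) : R :=
  (harnack_distance (Omega_of K x0) (Some (x0, 0)) None)^-1.

(* Sequences are indexed from 1: the value c 0 is not constrained. *)
Definition regular_subexponential (R : realType) (c : nat -> R) : Prop :=
  [/\ forall n, (0 < n)%N -> expR 1 <= c n,
      forall m n, (0 < m)%N -> (m <= n)%N -> c m <= c n,
      forall m n, (0 < m)%N -> (m <= n)%N ->
        ln (c n) / n%:R <= ln (c m) / m%:R &
      (fun n => ln (c n) / n%:R) @ \oo --> (0 : R)].

Definition admissible (R : realType) (gam : nat -> R) : Prop :=
  forall s, (0 < s)%N -> 0 < gam s < 1 / 4.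

(* Main.v *)
From HB Require Import structures.
Require Import Defs.
From mathcomp Require Import all_boot all_order all_algebra.
From mathcomp Require Import complex.
From mathcomp Require Import all_classical all_reals all_analysis.
From mathcomp Require Import measurable_realfun.
From mathcomp Require Import ring lra.

Import Order.TTheory GRing.Theory Num.Theory.
Import numFieldNormedType.Exports.

Local Open Scope classical_set_scope.
Local Open Scope ring_scope.

Set Implicit Arguments.
Unset Strict Implicit.
Unset Printing Implicit Defensive.

(** The polynomials w_s = 2 P_(2^s) / r_s + 1 satisfy w_(s+1) = 1 + 2 lam_s (w_s^2 - 1)
    with lam_s = 1 / (4 gamma_(s+1)), and K(gamma) is the set of real x with |w_s x| <= 1
    for all s. The scales are written ln lam_s = 2^(s+1) (dl_s - dl_(s+1)) for a sequence dl
    that decreases to 0, which is the free parameter. The theorem holds because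
    2^t g(x) exceeds ln |w_t x| by about 2^t dl_t, while a polynomial of degree 2^t that is
    bounded by M on K(gamma) is bounded by M |w_t x| at x (times a constant, in a bounded gap).
    So the Widom factor of degree 2^t is at least of order exp (2^t dl_t), and dl may
    decrease as slowly as one likes.

    Green function. Tossing a fair coin for the sign of each w_t gives a measure on K(gamma)
    for which every w_t has a symmetric law ([symmetric_measure_exists]). Since
    w_(t+1) x - w_(t+1) y is a multiple of (w_t x - w_t y) (w_t x + w_t y), averaging over
    the two signs turns the potential at level t into half the potential at level t + 1
    ([potential_step]). Iterating this shows that the potential is constant on K(gamma)
    ([log_potential_on]), and off K(gamma) it bounds the Green function from below
    ([green_lower]). That this measure is the equilibrium measure, and the only one, follows
    from positive definiteness of the logarithmic kernel: - ln |x - y| is a superposition of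
    the tents (r - |x - y|)_+, and a tent is a superposition of products of indicators
    of intervals ([log_tent], [tent_window]); thus the energy of a competitor exceeds the
    minimum by at least a square that measures the distance of distribution functions
    ([energy_ge_robin], [measure_eq_of_defect]).

    Residual polynomials. The 2 * 2^t points where w_t is 1 or - 1 belong to K(gamma). Lagrange
    interpolation there, applied to the product of the polynomial with w_t' or with w_t'
    divided by one of its factors, gives the bound M |w_t x| outside [0, 1] ([outer_bound]) and
    C M |w_t x| in a bounded gap ([inner_bound]). Existence of minimisers, on which the
    definition of Widom factors rests, is a compactness argument ([residual_exists]).

    Other degrees. For x outside [0, 1] and arbitrary n, a power of the residual polynomial
    and some linear factors make up a polynomial of degree 2^T much larger than n
    ([residual_norm_power]); this gives the claim whenever w is not close to 1 at the
    level of n ([widom_far]). If it is close to 1, then x is close to [0, 1]; the Widom factor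
    may then be small, but the exponent is small too: the harmonic functions Re sqrt (1 - 1 / z)
    and Re sqrt (1 + 1 / (z - 1)) bound it by the square root of the distance to [0, 1]
    ([tau_outer]), and a large lam_0 makes the Widom factor beat it ([widom_near]).
    In bounded gaps only the trivial bound 1 for the exponent is used.

    Choice of dl. Besides a geometric term, dl is the square root of the growth rate
    ln c_n / n at a delayed degree n ([dlseq]). The square root provides the slack that absorbs
    all constants ([dlseq_dyadic], [dlseq_delayed]). *)

(** * The tower of defining polynomials *)

Section Tower.
Context {R : realType} (lam : nat -> R).

(** With lam s = 1 / (4 gam (s+1)), this is the polynomial 2 P / r + 1, of
    degree 2^s, whose preimage of [-1, 1] is the s-th approximation of
    K(gamma). In this normalisation the recursion is a quadratic map that
    depends only on lam s. *)
Fixpoint wpol (s : nat) : {poly R} :=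
  if s is t.+1 then 1 + (2 * lam t) *: (wpol t ^+ 2 - 1) else 2 *: 'X - 1.

Definition w (s : nat) (x : R) : R := (wpol s).[x].

Definition Kreal : set R := [set x | forall s, `|w s x| <= 1].

Lemma w0 x : w 0 x = 2 * x - 1.
Proof. by rewrite /w /= !hornerE. Qed.

Lemma wS s x : w s.+1 x = 1 + 2 * lam s * (w s x ^+ 2 - 1).
Proof. by rewrite /w /= !hornerE. Qed.

Hypothesis lam2 : forall s, 2 <= lam s.

Lemma lam_gt0 s : 0 < lam s.
Proof. by apply: lt_le_trans (lam2 s). Qed.

Lemma w_square_inside s x : `|w s.+1 x| <= 1 -> 1 / 2 <= w s x ^+ 2 <= 1.
Proof.
rewrite ler_norml wS => /andP[h1 h2]; have l2 := lam2 s.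
have h3 : lam s * (w s x ^+ 2 - 1) <= 0 by nra.
have h4 : -1 <= lam s * (w s x ^+ 2 - 1) by nra.
apply/andP; split; nra.
Qed.

Lemma w_inside_pred s x : `|w s.+1 x| <= 1 -> `|w s x| <= 1.
Proof.
move=> /w_square_inside/andP[_]; rewrite -[_ ^+ 2]real_normK ?num_real//.
by have := normr_ge0 (w s x); set a := `|_|; nra.
Qed.

Lemma w_inside_le s t x : (s <= t)%N -> `|w t x| <= 1 -> `|w s x| <= 1.
Proof.
move=> /subnK <-; elim: (t - s)%N => [//|k IH]; rewrite addSn => /w_inside_pred.
exact: IH.
Qed.

(** For lam s = 1 the recursion is the Chebyshev map 2 y^2 - 1; outside [-1,
    1] it only grows with lam s. So points off K(gamma) escape at least as
    fast as under Chebyshev iteration. *)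
Lemma w_outside_step s x : 1 < `|w s x| -> 2 * w s x ^+ 2 - 1 <= w s.+1 x.
Proof.
move=> h; have h2 : 1 < w s x ^+ 2.
  by rewrite -[w s x ^+ 2]real_normK ?num_real// expr_gt1.
rewrite wS; have := lam2 s; nra.
Qed.

Lemma w_outside_grow s x : 1 < `|w s x| -> `|w s x| <= w s.+1 x.
Proof.
move=> h; apply: le_trans (w_outside_step h).
rewrite -[w s x ^+ 2]real_normK ?num_real//.
set a := `|w s x| in h *; nra.
Qed.

Lemma w_outside_le s t x : 1 < `|w s x| -> (s <= t)%N -> `|w s x| <= `|w t x|.
Proof.
move=> h /subnK <-; elim: (t - s)%N => [//|k IH]; rewrite addSn.
apply: (le_trans IH); apply: le_trans (ler_norm _).
by apply: w_outside_grow; apply: lt_le_trans IH.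
Qed.

Lemma Kreal_ge_half s x : Kreal x -> 1 / 2 <= w s x ^+ 2.
Proof. by move=> Kx; have /andP[] := @w_square_inside s x (Kx s.+1). Qed.

(** The gap that opens at each step keeps w_s away from 0 on the limit set:
    the bound is sqrt (1 / 2), rounded down. *)
Lemma Kreal_abs_ge s x : Kreal x -> 7 / 10 <= `|w s x|.
Proof.
move=> /(Kreal_ge_half s); rewrite -[w s x ^+ 2]real_normK ?num_real//.
have := normr_ge0 (w s x); set a := `|_|; nra.
Qed.

Lemma w_diff s x y : w s.+1 x - w s.+1 y =
  2 * lam s * (w s x + w s y) * (w s x - w s y).
Proof. rewrite !wS; ring. Qed.

(** On the limit set the quadratic map expands by |w_s x + w_s y| 2 lam s >= 2
    when the two arguments have the same sign. *)
Lemma Kreal_same_sign s x y : Kreal x -> Kreal y -> 0 < w s x * w s y ->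
  2 * `|w s x - w s y| <= `|w s.+1 x - w s.+1 y|.
Proof.
move=> Kx Ky ss; have l0 := lam_gt0 s; have l2 := lam2 s.
rewrite w_diff !normrM normr_nat (gtr0_norm l0).
have hx := Kreal_abs_ge s Kx; have hy := Kreal_abs_ge s Ky.
have : `|w s x + w s y| = `|w s x| + `|w s y|.
  have [xp|xn] := leP 0 (w s x).
    have yp : 0 <= w s y by nra.
    by rewrite ger0_norm ?addr_ge0// (ger0_norm xp) (ger0_norm yp).
  have yn : w s y <= 0 by nra.
  rewrite ler0_norm ?(ltr0_norm xn) ?(ler0_norm yn); nra.
move=> ->; apply: ler_wpM2r => //; nra.
Qed.

Lemma Kreal_expand t x y : Kreal x -> Kreal y ->
  (forall s, (s < t)%N -> 0 < w s x * w s y) ->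
  2 ^+ t * (2 * `|x - y|) <= `|w t x - w t y|.
Proof.
move=> Kx Ky; elim: t => [|t IH] h.
  rewrite !w0 expr0 mul1r (_ : _ - (_ - _) = 2 * (x - y)); last by ring.
  by rewrite normrM normr_nat.
apply: le_trans (Kreal_same_sign Kx Ky (h t (ltnSn t))).
rewrite exprS -mulrA ler_pM2l//; apply: IH => s st.
by apply: h; apply: ltnW.
Qed.

(** Otherwise the expansion would push the distance between w_s x and w_s y,
    which never exceeds 2, to infinity. *)
Lemma Kreal_separate x y : Kreal x -> Kreal y -> x != y ->
  exists s, w s x * w s y < 0.
Proof.
move=> Kx Ky xy; apply: contrapT => /forallNP h.
have h' s : 0 < w s x * w s y.
  rewrite lt_neqAle leNgt (introN idP (h s)) andbT eq_sym mulf_neq0//.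
    by rewrite -normr_gt0; apply: lt_le_trans (Kreal_abs_ge s Kx); lra.
  by rewrite -normr_gt0; apply: lt_le_trans (Kreal_abs_ge s Ky); lra.
have grow s := Kreal_expand Kx Ky (fun t _ => h' t) (t := s).
have d0 : 0 < `|x - y| by rewrite normr_gt0 subr_eq0.
have bnd s : s%:R * `|x - y| <= 1.
  have : `|w s x - w s y| <= 2.
    by apply: le_trans (ler_normB _ _) _; rewrite [2]/(1 + 1) lerD.
  move/(le_trans (grow s)).
  have : s%:R <= 2 ^+ s :> R by rewrite -natrX ler_nat ltnW// ltn_expl.
  nra.
have := bnd (Num.bound (`|x - y|^-1)).
rewrite leNgt => /negP; apply.
rewrite -ltr_pdivrMr// mul1r.
have := archi_boundP (_ : 0 <= `|x - y|^-1); apply.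
by rewrite invr_ge0.
Qed.

End Tower.

(** * Fibres of the tower *)

Section Preimages.
Context {R : realType} (lam : nat -> R).
Hypothesis lam2 : forall s, 2 <= lam s.
Local Notation w := (w lam).
Local Notation wpol := (wpol lam).
Local Notation Kreal := (Kreal lam).
Let lam_gt0 := lam_gt0 lam2.

(** The positive inverse branch of the s-th quadratic map. *)
Definition psi (s : nat) (v : R) : R := Num.sqrt (1 - (1 - v) / (2 * lam s)).

Lemma psi_arg_ge s v : `|v| <= 1 -> 1 / 2 <= 1 - (1 - v) / (2 * lam s).
Proof.
rewrite ler_norml => /andP[h1 h2]; have l2 := lam2 s.
have : (1 - v) / (2 * lam s) <= 1 / 2 by rewrite ler_pdivrMr; nra.
lra.
Qed.

Lemma sqr_psi s v : `|v| <= 1 -> psi s v ^+ 2 = 1 - (1 - v) / (2 * lam s).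
Proof. by move=> h; rewrite sqr_sqrtr//; have := psi_arg_ge s h; lra. Qed.

Lemma psi_gt0 s v : `|v| <= 1 -> 0 < psi s v.
Proof. by move=> h; rewrite sqrtr_gt0; have := psi_arg_ge s h; lra. Qed.

Lemma psi_step s v : `|v| <= 1 -> 1 + 2 * lam s * (psi s v ^+ 2 - 1) = v.
Proof. by move=> h; rewrite sqr_psi//; field; rewrite gt_eqF. Qed.

Lemma psi_le1 s v : `|v| <= 1 -> `|psi s v| <= 1.
Proof.
move=> h; rewrite ger0_norm ?sqrtr_ge0//; have p0 := psi_gt0 s h.
have := sqr_psi s h; have : 0 <= (1 - v) / (2 * lam s).
  by rewrite divr_ge0// ?mulr_ge0// ?(ltW (lam_gt0 _))// subr_ge0 (le_trans (ler_norm _)).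
nra.
Qed.

(** All roots of w_t = y, listed by descending through the two inverse
    branches. *)
Fixpoint fib (t : nat) (y : R) : seq R :=
  if t is s.+1 then fib s (psi s y) ++ fib s (- psi s y) else [:: (y + 1) / 2].

Fixpoint wlead (t : nat) : R :=
  if t is s.+1 then 2 * lam s * wlead s ^+ 2 else 2.

Lemma wlead_gt0 t : 0 < wlead t.
Proof. by elim: t => //= t IH; rewrite !mulr_gt0// exprn_gt0. Qed.

Lemma size_fib t y : size (fib t y) = (2 ^ t)%N.
Proof. by elim: t y => //= t IH y; rewrite size_cat !IH addnn -muln2 expnSr. Qed.

Lemma wpol_fib t y : `|y| <= 1 ->
  wpol t - y%:P = wlead t *: \prod_(x <- fib t y) ('X - x%:P).
Proof.
elim: t y => [|t IH] y hy /=.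
  have -> : y%:P = 2%:P * ((y + 1) / 2)%:P - 1 :> {poly R}.
    rewrite -[X in _ = X - 1]polyCM (_ : 2 * _ = y + 1) ?polyCD ?addrK//.
    by field.
  by rewrite big_seq1 -!mul_polyC; ring.
rewrite big_cat /=.
transitivity ((2 * lam t) *: ((wpol t - (psi t y)%:P) * (wpol t - (- psi t y)%:P))).
  rewrite -{1}(psi_step t hy) -!mul_polyC !(polyCD, polyCN, polyCM, polyCB, polyC1).
  by ring.
rewrite IH ?psi_le1// IH ?normrN ?psi_le1//.
by rewrite -!mul_polyC !polyCM; ring.
Qed.

Lemma wE_fib t y x : `|y| <= 1 -> w t x = y <-> x \in fib t y.
Proof.
move=> hy; have := wpol_fib t hy => /(congr1 (fun p : {poly R} => p.[x])).
rewrite !hornerE -/(w t x) horner_prod => e.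
rewrite -root_prod_XsubC /root horner_prod; split=> [h|/eqP h].
  move: e; rewrite h subrr => /esym/eqP; rewrite mulf_eq0 => /orP[|//].
  by rewrite gt_eqF// wlead_gt0.
by apply/eqP; rewrite -subr_eq0 e h mulr0.
Qed.

Lemma fib_uniq t y : `|y| <= 1 -> uniq (fib t y).
Proof.
elim: t y => [//|t IH] y hy /=; have h1 := psi_le1 t hy.
have h2 : `|- psi t y| <= 1 by rewrite normrN.
rewrite cat_uniq !IH// andbT /=; apply/hasPn => x /(wE_fib _ _ h2) e.
apply/negP => /(wE_fib _ _ h1); rewrite e; have := psi_gt0 t hy; lra.
Qed.

Lemma w_one_next t x : `|w t x| = 1 -> w t.+1 x = 1.
Proof. by move=> h; rewrite wS -[w t x ^+ 2]real_normK ?num_real// h; ring. Qed.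

(** The points 1 and -1 are sent to the fixed point 1 of every quadratic map,
    so the endpoints of the intervals at level t are never removed. They are
    the interpolation nodes used later. *)
Lemma w_one_Kreal t x : `|w t x| = 1 -> Kreal x.
Proof.
move=> h s; have [st|/ltnW ts] := leqP s t.
  by apply: (w_inside_le lam2 st); rewrite h.
move: ts => /subnK <-; elim: (s - t)%N => [|k IH]; first by rewrite h.
suff -> : w (k.+1 + t)%N x = 1 by rewrite normr1.
elim: k {IH} => [|k IH]; first exact: w_one_next.
by rewrite addSn w_one_next// IH normr1.
Qed.

(** Choosing the inverse branches that x itself follows gives a preimage of v
    that is close to x. *)
Lemma Kreal_lift t v x : Kreal x -> `|v| <= 1 ->
  exists x', w t x' = v /\ forall s, (s < t)%N -> 0 < w s x * w s x'.
Proof.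
move=> Kx; elim: t v => [|t IH] v hv.
  by exists ((v + 1) / 2); rewrite w0; split=> //; field.
have [x0|x0] : 0 < w t x \/ w t x < 0.
- have := Kreal_abs_ge lam2 t Kx.
  by case: (ltgtP (w t x) 0) => [|| ->]; rewrite ?normr0; [right|left|lra].
- have [x' [e h]] := IH _ (psi_le1 t hv).
  exists x'; rewrite wS e psi_step//; split=> // s.
  rewrite ltnS leq_eqVlt => /predU1P[->|]; last exact: h.
  by rewrite e mulr_gt0// psi_gt0.
- have hN : `|- psi t v| <= 1 by rewrite normrN psi_le1.
  have [x' [e h]] := IH _ hN.
  exists x'; rewrite wS e sqrrN psi_step//; split=> // s.
  rewrite ltnS leq_eqVlt => /predU1P[->|]; last exact: h.
  by rewrite e; have := psi_gt0 t hv; nra.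
Qed.

(** The point with the itinerary of x up to level t and the opposite value of
    w_t lies in the limit set, because the next iterate does not see the sign,
    and is within 2^-t of x. *)
Lemma Kreal_perfect x (e : R) : Kreal x -> 0 < e ->
  exists y, [/\ Kreal y, y != x & `|x - y| < e].
Proof.
move=> Kx e0; pose t := Num.bound e^-1.
have hv : `|- w t x| <= 1 by rewrite normrN; exact: Kx.
have [y [ey hy]] := Kreal_lift t Kx hv.
have Ky : Kreal y.
  move=> s; have [st|/subnK <-] := leqP s t.
    by have := w_inside_le lam2 st (x := y); rewrite ey; apply.
  suff -> : w (s - t.+1 + t.+1)%N y = w (s - t.+1 + t.+1)%N x by exact: Kx.
  elim: (s - t.+1)%N => [|k IH]; first by rewrite add0n (wS lam t y) (wS lam t x) ey sqrrN.
  by rewrite !addSn wS IH -wS.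
have wn0 : w t x != 0.
  by rewrite -normr_gt0; apply: lt_le_trans (Kreal_abs_ge lam2 t Kx); lra.
exists y; split=> //.
  apply/negP => /eqP yx; move: ey; rewrite yx => /eqP; rewrite -subr_eq0 opprK.
  by rewrite -mulr2n mulrn_eq0/= (negbTE wn0).
have := Kreal_expand lam2 Kx Ky hy; rewrite ey (_ : w t x - - w t x = 2 * w t x) ?normrM ?normr_nat; last by ring.
have := Kx t => h1 h2.
have h3 : 2 ^+ t * `|x - y| <= 1 by lra.
have h4 : e^-1 < 2 ^+ t.
  apply: (lt_trans (archi_boundP (_ : 0 <= e^-1))); first by rewrite invr_ge0 ltW.
  by rewrite -natrX ltr_nat ltn_expl.
have h5 : 1 < 2 ^+ t * e by rewrite -ltr_pdivrMr// mul1r.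
by have : 0 < 2 ^+ t :> R by []; nra.
Qed.

End Preimages.

(** * The intersection of the tower is a Cantor set *)

Section KsetIsCantor.
Context {R : realType} (lam : nat -> R).
Hypothesis lam2 : forall s, 2 <= lam s.
Local Notation w := (w lam).
Local Notation wpol := (wpol lam).
Local Notation Kreal := (Kreal lam).
Let lam_gt0 := lam_gt0 lam2.

Definition gamma_of (s : nat) : R := (4 * lam s.-1)^-1.
Local Notation gam := gamma_of.

Lemma gamma_of_admissible : admissible gam.
Proof.
move=> s _; rewrite /gam invr_gt0 mulr_gt0//= div1r ltf_pV2 ?posrE ?mulr_gt0//.
by have := lam2 s.-1; lra.
Qed.

Lemma rseq_gt0 s : 0 < rseq gam s.
Proof. by elim: s => //= s IH; rewrite mulr_gt0 ?exprn_gt0// invr_gt0 mulr_gt0. Qed.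

Lemma Ppol_wpol s : (2 / rseq gam s.+1) *: Ppol gam s + 1 = wpol s.+1.
Proof.
elim: s => [|s IH].
  rewrite /= /gamma_of expr1n mulr1 invrK /= -!mul_polyC.
  rewrite (_ : 2 * (4 * lam 0%N) = 4 * (2 * lam 0%N)); last by ring.
  rewrite polyCM (_ : 4%:P = 2%:P * 2%:P :> {poly R}); last first.
    by rewrite -[RHS]polyCM -natrM.
  rewrite (_ : 2%:P = 2%:R :> {poly R}) ?polyCMn ?polyC1//; ring.
have r0 := rseq_gt0 s.+1; have l0 := lam_gt0 s.+1.
have e : Ppol gam s = (rseq gam s.+1 / 2) *: (wpol s.+1 - 1).
  rewrite -IH addrK scalerA (_ : _ * _ = 1) ?scale1r//.
  by field; rewrite gt_eqF.
have -> : wpol s.+2 = 1 + (2 * lam s.+1) *: (wpol s.+1 ^+ 2 - 1) by [].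
have -> : Ppol gam s.+1 = Ppol gam s * (Ppol gam s + (rseq gam s.+1)%:P) by [].
have -> : rseq gam s.+2 = (4 * lam s.+1)^-1 * rseq gam s.+1 ^+ 2 by [].
rewrite e; move: (rseq gam s.+1) r0 (wpol s.+1) {IH e} => r r0 W.
have -> : r%:P = (r / 2) *: 1 + (r / 2) *: 1 :> {poly R}.
  by rewrite -scalerDl -splitr alg_polyC.
rewrite -!scalerDr.
have aux (k a : R) (A B : {poly R}) : k *: ((a *: A) * (a *: B)) = (k * a * a) *: (A * B).
  by rewrite -!mul_polyC !polyCM; ring.
rewrite aux [LHS]addrC; congr (_ + _).
have -> : 2 / ((4 * lam s.+1)^-1 * r ^+ 2) * (r / 2) * (r / 2) = 2 * lam s.+1.
  by field; rewrite !gt_eqF.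
by congr (_ *: _); ring.
Qed.

Definition wC (s : nat) (z : R[i]) : R[i] := (map_poly (real_complex R) (wpol s)).[z].

Lemma wC0 z : wC 0 z = 2%:C%C * z - 1.
Proof. by rewrite /wC /= rmorphB /= linearZ /= map_polyX rmorph1 !hornerE. Qed.

Lemma wCS s z : wC s.+1 z = 1 + (2 * lam s)%:C%C * (wC s z ^+ 2 - 1).
Proof.
by rewrite /wC /= rmorphD /= linearZ /= rmorphB /= rmorphXn /= !rmorph1 !hornerE.
Qed.

Lemma wC_real s (x : R) : wC s x%:C%C = (w s x)%:C%C.
Proof. by rewrite /wC /w horner_map. Qed.

(** A complex root of w_s = y with |y| <= 1 is real: at each step the square
    that has to be inverted is at least 1 / 2, so both square roots are real
    and again in [-1, 1]. *)
Lemma wC_inside s z y : `|y| <= 1 -> wC s z = y%:C%C ->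
  exists2 x : R, z = x%:C%C & w s x = y.
Proof.
elim: s z y => [|s IH] z y hy.
  rewrite wC0 => h; exists ((y + 1) / 2); last by rewrite w0; field.
  have n2 : 2%:C%C != 0 :> R[i] by rewrite (_ : 0 = 0%:C%C)// (inj_eq (@complexI _)).
  apply: (mulfI n2); rewrite -rmorphM /= (_ : 2 * _ = y + 1); last by field.
  have -> : (y + 1)%:C%C = y%:C%C + 1 by rewrite rmorphD rmorph1.
  by rewrite -h subrK.
move=> h; have e : wC s z ^+ 2 = ((psi lam s y)%:C%C) ^+ 2.
  have n2 : (2 * lam s)%:C%C != 0 :> R[i].
    by rewrite (_ : 0 = 0%:C%C)// (inj_eq (@complexI _)) gt_eqF// mulr_gt0.
  have e : y%:C%C = 1 + (2 * lam s)%:C%C * ((psi lam s y)%:C%C ^+ 2 - 1).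
    rewrite -[in LHS](psi_step lam2 s hy) rmorphD rmorph1.
    by rewrite (rmorphM _ (2 * lam s)) rmorphB rmorph1 rmorphXn.
  by move: h; rewrite wCS e => /addrI/(mulfI n2)/addIr.
move/eqP: e; rewrite eqf_sqr => /orP[] /eqP e.
  have [x -> ex] := IH _ _ (psi_le1 lam2 s hy) e; exists x => //.
  by rewrite wS ex psi_step.
have h2 : `|- psi lam s y| <= 1 by rewrite normrN psi_le1.
move: e; rewrite -rmorphN => /(IH _ _ h2)[x -> ex]; exists x => //.
by rewrite wS ex sqrrN psi_step.
Qed.

Lemma EsetE s (z : R * R) : Eset gam s z <-> z.2 = 0 /\ `|w s z.1| <= 1.
Proof.
case: s => [|s] /=.
  rewrite /unit_segment /= w0 ler_norml; split=> [[/andP[h1 h2] ->]|[-> /andP[h1 h2]]].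
    by split=> //; apply/andP; split; lra.
  by split=> //; apply/andP; split; lra.
have e u : (2 / rseq gam s.+1)%:C%C * (map_poly (real_complex R) (Ppol gam s)).[u] + 1
    = wC s.+1 u.
  by rewrite /wC -Ppol_wpol rmorphD /= linearZ /= rmorph1 !hornerE.
split=> [[y hy]|[z2 h]].
  rewrite e => /wC_inside[|x]; first by rewrite ler_norml.
  by rewrite /cplx => -[-> ->] ->; split=> //; rewrite ler_norml.
exists (w s.+1 z.1); first by rewrite -ler_norml.
by rewrite e -wC_real /cplx z2.
Qed.

Lemma KsetE : Kset gam = [set z : R * R | Kreal z.1 /\ z.2 = 0].
Proof.
apply/seteqP; split=> z /=.
  by move=> h; split=> [s|]; [case: ((EsetE s z).1 (h s I))|case: ((EsetE 0 z).1 (h 0%N I))].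
by move=> [h1 h2] s _; apply/EsetE.
Qed.

Lemma Kreal01 x : Kreal x -> 0 <= x <= 1.
Proof. by move=> /(_ 0%N); rewrite w0 ler_norml => /andP[h1 h2]; apply/andP; split; lra. Qed.

Lemma Kset_unit_segment : Kset gam `<=` unit_segment (R := R).
Proof. by rewrite KsetE => z [/Kreal01 h1 h2]; split. Qed.

Lemma real_trace_Kset : real_trace (Kset gam) = Kreal.
Proof. by rewrite KsetE; apply/seteqP; split=> x //= [//]. Qed.

Lemma Kreal0 : Kreal 0.
Proof. by apply: (@w_one_Kreal R lam lam2 0%N); rewrite w0 mulr0 sub0r normrN1. Qed.

Lemma Kreal1 : Kreal 1.
Proof. by apply: (@w_one_Kreal R lam lam2 0%N); rewrite w0 (_ : _ - _ = 1) ?normr1//; ring. Qed.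

Lemma continuous_w s : continuous (w s).
Proof. exact: continuous_horner. Qed.

Lemma continuous_w_fst s : continuous (fun z : R * R => w s z.1).
Proof. by move=> z; apply: continuous_comp; [exact: cvg_fst|exact: continuous_w]. Qed.

Lemma closed_Kreal : closed Kreal.
Proof.
rewrite (_ : Kreal = \bigcap_s (w s @^-1` [set y | `|y| <= 1])); last first.
  by apply/seteqP; split=> [x h s _|x h s]; [exact: h|exact: (h s I)].
apply: closed_bigI => s _; apply: closed_comp => [x _|].
  exact: continuous_w.
apply: (@closed_comp _ _ (fun y : R => `|y|) [set y : R | y <= 1]) => [x _|].
  exact: norm_continuous.
exact: closed_le.
Qed.

Lemma closed_Kset : closed (Kset gam).
Proof.
rewrite KsetE (_ : mkset _ = fst @^-1` Kreal `&` snd @^-1` [set 0])//.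
apply: closedI; apply: closed_comp; [|exact: closed_Kreal| |exact: closed_eq].
  by move=> x _; exact: cvg_fst.
by move=> x _; exact: cvg_snd.
Qed.

Lemma compact_Kset : compact (Kset gam).
Proof.
apply: (subclosed_compact closed_Kset
  (compact_setX (@segment_compact R 0 1) (@compact_set1 R^o 0))).
by rewrite KsetE => z [/Kreal01 h1 h2]; split=> //=; rewrite in_itv.
Qed.

Lemma perfect_Kset : perfect_set (Kset gam).
Proof.
split; first exact: closed_Kset.
apply/seteqP; split.
  move=> z /subset_limit_point; rewrite -(closure_id _).1//; exact: closed_Kset.
rewrite KsetE => -[x y] [/= Kx y0] U /= [[A B] /= [xA yB] ABU].
have [e /= e0 eA] := xA.
have [x' [Kx' xx' xe]] := Kreal_perfect lam2 Kx e0.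
exists (x', y); split=> //=.
  by apply: contra xx' => /eqP[->].
by apply: ABU; split=> /=; [exact: eA|exact: nbhs_singleton].
Qed.

(** Two points are separated by some w_s of opposite signs, and w_s does not
    vanish on the set, so no connected subset contains both. *)
Lemma disconnected_Kset : totally_disconnected (Kset gam).
Proof.
move=> z Kz; apply/seteqP; split=> [z' [C [Cz CK Cc Cz']]|_ ->]; last first.
  exact: connected_component_refl.
have [Kz1 z2] : Kreal z.1 /\ z.2 = 0 by move: Kz; rewrite KsetE.
have [Kz1' z2'] : Kreal z'.1 /\ z'.2 = 0 by move: (CK _ Cz'); rewrite KsetE.
have [e|zz'] := eqVneq z.1 z'.1.
  by rewrite /= [z']surjective_pairing [z]surjective_pairing e z2 z2'.
have [s hs] := Kreal_separate lam2 Kz1 Kz1' zz'; exfalso.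
have : connected ((fun z : R * R => w s z.1) @` C).
  apply: connected_continuous_connected => //.
  by apply: continuous_subspaceT; exact: continuous_w_fst.
move=> /connected_intervalP ci.
have [u Cu] : ((fun z : R * R => w s z.1) @` C) 0.
  have [h|h] := leP (w s z.1) 0.
    by apply: (ci (w s z.1) (w s z'.1)); [exists z|exists z'|apply/andP; split; nra].
  by apply: (ci (w s z'.1) (w s z.1)); [exists z'|exists z|apply/andP; split; nra].
have [Ku _] : Kreal u.1 /\ u.2 = 0 by move: (CK _ Cu); rewrite KsetE.
move=> h; have := Kreal_abs_ge lam2 s Ku; rewrite h normr0; lra.
Qed.

Lemma Kset_cantor : cantor_set (Kset gam).
Proof. by split; [exact: compact_Kset|exact: perfect_Kset|exact: disconnected_Kset]. Qed.

End KsetIsCantor.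

(** * A measure for which every level of the tower is symmetric *)

Section Halving.
Context {R : realType}.
Local Open Scope ereal_scope.
Local Notation mu := (@lebesgue_measure R).

Lemma lebesgue_measure_half (c : R) (A : set (measurableTypeR R)) : measurable A ->
  mu ((fun u : R => u / 2 + c)%R @^-1` A) = 2%:E * mu A.
Proof.
move=> mA.
have mh : measurable_fun setT (fun u : measurableTypeR R => (u / 2 + c)%R : measurableTypeR R).
  apply: measurable_funD; last exact: measurable_cst.
  by apply: measurable_funM; [exact: measurable_id|exact: measurable_cst].
have k0 : (0 <= 2^-1 :> R)%R by [].
pose h := (fun u : measurableTypeR R => (u / 2 + c)%R : measurableTypeR R).
pose nu0 := mscale (NngNum k0) (pushforward mu h).
pose nu : {measure set (measurableTypeR R) -> \bar R} := nu0 mh.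
have e : mu A = nu A.
  apply: (lebesgue_measure_unique (mu := nu)) => //= _ [[a b]] _ <-.
  rewrite /nu /nu0 /= /mscale /= /pushforward.
  have -> : h @^-1` `]a, b]%classic = `](2 * (a - c))%R, (2 * (b - c))%R]%classic.
    by apply/seteqP; split=> x /=; rewrite !in_itv /= /h => /andP[h1 h2]; apply/andP; split; lra.
  rewrite !lebesgue_measure_itv /= !lte_fin ltr_pM2l// ltrD2r.
  case: ifPn => _; last by rewrite mule0.
  by rewrite -!EFinD -EFinM; congr EFin; field.
rewrite e /nu /nu0 /mscale /= muleA -EFinM divff ?mul1e//.
Qed.

(** Self-similarity of the uniform law on [0, 1): the two halves, rescaled,
    are each uniform. This is the only fact about coin tossing that the
    construction of the measure uses. *)
Lemma halving (f : R -> \bar R) :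
  measurable_fun setT f -> (forall x, 0 <= f x) ->
  \int[mu]_(u in `[0%R, 1%R[) f u =
  2^-1%:E * (\int[mu]_(u in `[0%R, 1%R[) f (u / 2)%R +
             \int[mu]_(u in `[0%R, 1%R[) f (u / 2 + 2^-1)%R).
Proof.
move=> mf f0.
have key (c : R) : \int[mu]_(u in `[0%R, 1%R[) f (u / 2 + c)%R =
    2%:E * \int[mu]_(u in `[c, (c + 2^-1)%R[) f u.
  have mh : measurable_fun setT (fun u : measurableTypeR R => (u / 2 + c)%R : measurableTypeR R).
    apply: measurable_funD; last exact: measurable_cst.
    by apply: measurable_funM; [exact: measurable_id|exact: measurable_cst].
  pose h := (fun u : measurableTypeR R => (u / 2 + c)%R : measurableTypeR R).
  have H := @ge0_integral_pushforward _ _ _ _ _ _ mh mu `[c, (c + 2^-1)%R[%classic f.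
  transitivity (\int[pushforward mu h]_(y in `[c, (c + 2^-1)%R[) f y).
    rewrite H//; last exact: measurable_funTS.
    congr (integral _ _ _); apply/seteqP; split=> x /=; rewrite !in_itv /= => /andP[h1 h2]; apply/andP; split; lra.
  transitivity (\int[mscale (NngNum (ler0n R 2)) mu]_(y in `[c, (c + 2^-1)%R[) f y).
    by apply: eq_measure_integral => A mA _; rewrite /mscale /= /pushforward lebesgue_measure_half.
  by rewrite ge0_integral_mscale//; exact: measurable_funTS.
have -> : \int[mu]_(u in `[0%R, 1%R[) f (u / 2)%R = 2%:E * \int[mu]_(u in `[0%R, (2^-1)%R[) f u.
  have := key 0%R; rewrite add0r => <-.
  by apply: eq_integral => x _; rewrite addr0.
rewrite key -ge0_muleDr; last 2 first.
- by apply: integral_ge0.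
- by apply: integral_ge0.
rewrite muleA -EFinM mulVf// mul1e -ge0_integral_setU//=.
- congr (integral _ _ _); apply/seteqP; split=> x /=.
    rewrite !in_itv /= => /andP[h1 h2]; have [h3|h3] := ltP x (2^-1)%R.
      by left; apply/andP; split; lra.
    by right; apply/andP; split; lra.
  by rewrite !in_itv /= => -[] /andP[h1 h2]; apply/andP; split; lra.
- exact: measurable_funTS.
- apply/disj_setPS => x /= [] /[!in_itv] /= /andP[h1 h2] /andP[h3 h4]; lra.
Qed.

End Halving.

Section Coding.
Context {R : realType} (lam : nat -> R).
Hypothesis lam2 : forall s, 2 <= lam s.
Local Notation w := (w lam).
Local Notation psi := (psi lam).
Local Notation Kreal := (Kreal lam).
Local Notation gam := (gamma_of lam).
Let lam_gt0 := lam_gt0 lam2.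

(** The leading binary digit, read as a sign; with [shift], the binary
    expansion of u is read as a sequence of independent fair coins. *)
Definition digit (u : R) : R := if u < 2^-1 then 1 else -1.
Definition shift (u : R) : R := if u < 2^-1 then 2 * u else 2 * u - 1.

(** The sign of w_t is the first coin and its size is the inverse branch of
    w_(t+1), which is computed from the remaining coins; n is the number of
    coins that are read. *)
Fixpoint code_approx (n t : nat) (u : R) : R :=
  if n is m.+1 then digit u * psi t (code_approx m t.+1 (shift u)) else 1.

Lemma code_approxS n t u :
  code_approx n.+1 t u = digit u * psi t (code_approx n t.+1 (shift u)).
Proof. by []. Qed.

Lemma norm_digit u : `|digit u| = 1.
Proof. by rewrite /digit; case: ifP; rewrite ?normrN normr1. Qed.

Lemma code_approx_le1 n t u : `|code_approx n t u| <= 1.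
Proof.
elim: n t u => [|n IH] t u /=; first by rewrite normr1.
by rewrite normrM norm_digit mul1r psi_le1.
Qed.

Lemma psi_lipschitz s a b : `|a| <= 1 -> `|b| <= 1 ->
  `|psi s a - psi s b| <= `|a - b| / 2.
Proof.
move=> ha hb; have l2 := lam2 s; have l0 := lam_gt0 s.
have pa := psi_gt0 lam2 s ha; have pb := psi_gt0 lam2 s hb.
have sa := sqr_psi lam2 s ha; have sb := sqr_psi lam2 s hb.
have ga := psi_arg_ge lam2 s ha; have gb := psi_arg_ge lam2 s hb.
have e : (a - b) / (2 * lam s) = (psi s a - psi s b) * (psi s a + psi s b).
  by rewrite -subr_sqr sa sb; field; rewrite gt_eqF.
have e2 : `|a - b| = 2 * lam s * (`|psi s a - psi s b| * (psi s a + psi s b)).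
  rewrite -[X in _ * (_ * X)]ger0_norm ?addr_ge0 ?ltW// -normrM -e.
  rewrite normrM normfV (ger0_norm (_ : 0 <= 2 * lam s)) ?mulr_ge0 ?ltW//.
  by field; rewrite gt_eqF.
rewrite e2 ler_pdivlMr// -subr_ge0.
have := normr_ge0 (psi s a - psi s b); set d := `|_|.
have ha2 : 1 / 2 <= psi s a by nra.
have hb2 : 1 / 2 <= psi s b by nra.
set p := psi s a in ha2 *; set q := psi s b in hb2 *.
move=> d0; have : 1 <= p + q by lra.
move=> h; have : 2 <= lam s * (p + q) by nra.
nra.
Qed.

(** The inverse branches contract by 1 / 2, so the coins that are read last
    matter geometrically little. *)
Lemma code_approx_step n t u :
  `|code_approx n.+1 t u - code_approx n t u| <= 2 * (2^-1) ^+ n.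
Proof.
elim: n t u => [|n IH] t u.
  rewrite expr0 mulr1; apply: le_trans (ler_normB _ _) _.
  by rewrite [2]/(1 + 1) lerD ?code_approx_le1.
rewrite (code_approxS n.+1 t u) (code_approxS n t u) -mulrBr normrM norm_digit mul1r.
apply: (le_trans (psi_lipschitz t (code_approx_le1 _ _ _) (code_approx_le1 _ _ _))).
by rewrite [2^-1 ^+ _]exprS; have := IH t.+1 (shift u); lra.
Qed.

Definition code (t : nat) (u : R) : R := limn (fun n => code_approx n t u).

Lemma code_cvg t u : code_approx n t u @[n --> \oo] --> code t u.
Proof.
suff : cvgn (fun n => code_approx n t u) by [].
pose v := (fun n => code_approx n t u : R^o).
have : cvgn (series (telescope v)).
  apply: normed_cvg; apply: (@series_le_cvg _ _ (geometric 2 (2^-1))).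
  - by move=> n; exact: normr_ge0.
  - by move=> n; rewrite /geometric /= mulr_ge0// exprn_ge0.
  - by move=> n; exact: code_approx_step.
  - by apply: is_cvg_geometric_series; rewrite ger0_norm// invf_lt1// ltr1n.
rewrite telescopeK => h.
rewrite (_ : (fun n => _) = (fun n => (v n - v 0%N) + v 0%N)); last first.
  by apply/funext => n; rewrite subrK.
by apply: is_cvgD; [exact: h|exact: is_cvg_cst].
Qed.

Lemma code_le1 t u : `|code t u| <= 1.
Proof.
have h : `|code_approx n t u| @[n --> \oo] --> `|code t u|.
  by apply: cvg_norm; exact: code_cvg.
rewrite -(cvg_lim _ h)//; apply: limr_le; first exact: (cvgP _ h).
by near=> n; exact: code_approx_le1.
Unshelve. all: by end_near.
Qed.


Lemma continuous_psi s : continuous (psi s).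
Proof.
move=> x; apply: continuous_comp; last exact: sqrt_continuous.
apply: cvgB; first exact: cvg_cst.
by apply: cvgMl; apply: cvgB; [exact: cvg_cst|exact: cvg_id].
Qed.

Lemma codeE t u : code t u = digit u * psi t (code t.+1 (shift u)).
Proof.
have h1 : code_approx n.+1 t u @[n --> \oo] --> code t u.
  by have := @cvg_shiftS _ (fun n => code_approx n t u) (nbhs (code t u)) => ->; exact: code_cvg.
have h2 : code_approx n.+1 t u @[n --> \oo] --> digit u * psi t (code t.+1 (shift u)).
  apply: cvgMr; apply: continuous_cvg; first exact: continuous_psi.
  exact: code_cvg.
by rewrite -(cvg_lim _ h1)// -(cvg_lim _ h2).
Qed.

Lemma code_next t u : 1 + 2 * lam t * (code t u ^+ 2 - 1) = code t.+1 (shift u).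
Proof.
rewrite codeE exprMn -[digit u ^+ 2]real_normK ?num_real// norm_digit expr1n mul1r.
by rewrite psi_step// code_le1.
Qed.

Definition code_point (u : R) : R := (code 0 u + 1) / 2.

Lemma w_code_point t u : w t (code_point u) = code t (iter t shift u).
Proof.
elim: t => [|t IH]; first by rewrite w0 /code_point /=; field.
by rewrite wS IH code_next.
Qed.

Lemma code_point_Kreal u : Kreal (code_point u).
Proof. by move=> s; rewrite w_code_point code_le1. Qed.

Lemma measurable_digit : measurable_fun setT (digit : R -> R).
Proof.
apply: measurable_fun_ifT; [|exact: measurable_cst|exact: measurable_cst].
by apply: measurable_fun_ltr; [exact: measurable_id|exact: measurable_cst].
Qed.

Lemma measurable_shift : measurable_fun setT (shift : R -> R).
Proof.
have h : measurable_fun setT (fun u : R => 2 * u).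
  by apply: measurable_funM; [exact: measurable_cst|exact: measurable_id].
apply: measurable_fun_ifT; [|exact: h|].
  by apply: measurable_fun_ltr; [exact: measurable_id|exact: measurable_cst].
by apply: measurable_funB; [exact: h|exact: measurable_cst].
Qed.

Lemma measurable_code_approx n t : measurable_fun setT (code_approx n t).
Proof.
elim: n t => [|n IH] t; first exact: measurable_cst.
apply: measurable_funM; first exact: measurable_digit.
apply: measurableT_comp; first exact: continuous_measurable_fun (@continuous_psi t).
by apply: measurableT_comp; [exact: IH|exact: measurable_shift].
Qed.

Lemma measurable_code t : measurable_fun setT (code t).
Proof.
apply: (measurable_fun_cvg (h := fun n => code_approx n t)).
  by move=> n; exact: measurable_code_approx.
by move=> u _; exact: code_cvg.
Qed.

Local Open Scope ereal_scope.
Local Notation mu := (@lebesgue_measure R).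

Lemma mean_split (g : R -> R -> \bar R) : (forall a u, 0 <= g a u) ->
  measurable_fun setT (fun u : R => g (digit u) (shift u)) ->
  \int[mu]_(u in `[0%R, 1%R[) g (digit u) (shift u) =
  2^-1%:E * (\int[mu]_(u in `[0%R, 1%R[) g 1%R u + \int[mu]_(u in `[0%R, 1%R[) g (-1)%R u).
Proof.
move=> g0 mg; rewrite (halving mg)//; congr (_ * (_ + _)); apply: eq_integral => u;
  rewrite inE /= in_itv /= /digit /shift => /andP[h1 h2].
  rewrite (_ : (u / 2 < 2^-1)%R = true); last by apply/idP; lra.
  by congr (g _ _); field.
rewrite (_ : (u / 2 + 2^-1 < 2^-1)%R = false); last by apply/negbTE; rewrite -leNgt; lra.
by congr (g _ _); field.
Qed.

Lemma half_double (a : \bar R) : 2^-1%:E * (a + a) = a.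
Proof. by rewrite -mule2n -mule_natl muleA -EFinM mulVf// mul1e. Qed.

Lemma mean_shift (f : R -> \bar R) : measurable_fun setT f -> (forall x, 0 <= f x) ->
  \int[mu]_(u in `[0%R, 1%R[) f (shift u) = \int[mu]_(u in `[0%R, 1%R[) f u.
Proof.
move=> mf f0; rewrite (@mean_split (fun _ u => f u))//; first exact: half_double.
by apply: measurableT_comp => //; exact: measurable_shift.
Qed.

Lemma mean_iter_shift t (f : R -> \bar R) : measurable_fun setT f -> (forall x, 0 <= f x) ->
  \int[mu]_(u in `[0%R, 1%R[) f (iter t shift u) = \int[mu]_(u in `[0%R, 1%R[) f u.
Proof.
elim: t f => [//|t IH] f mf f0.
under eq_integral do rewrite iterS.
rewrite (IH (f \o shift)); [exact: mean_shift| |by move=> x; exact: f0].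
by apply: measurableT_comp => //; exact: measurable_shift.
Qed.

(** The first coin is fair and independent of the others, and w_t depends on
    it only through its sign. *)
Lemma mean_code_opp t (f : R -> \bar R) : measurable_fun setT f -> (forall x, 0 <= f x) ->
  \int[mu]_(u in `[0%R, 1%R[) f (- code t u)%R = \int[mu]_(u in `[0%R, 1%R[) f (code t u).
Proof.
move=> mf f0.
have E (e : R) : \int[mu]_(u in `[0%R, 1%R[) f (e * code t u)%R =
    2^-1%:E * (\int[mu]_(u in `[0%R, 1%R[) f (e * psi t (code t.+1 u))%R +
               \int[mu]_(u in `[0%R, 1%R[) f (- (e * psi t (code t.+1 u)))%R).
  pose g a u := f (e * (a * psi t (code t.+1 u)))%R.
  under eq_integral do rewrite codeE.
  rewrite (@mean_split g)//.
    congr (_ * (_ + _)); apply: eq_integral => u _; rewrite /g ?mul1r//.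
    by rewrite mulN1r mulrN.
    by move=> a u; exact: f0.
  have -> : (fun u => g (digit u) (shift u)) = f \o (fun u => e * code t u)%R.
    by apply/funext => u; rewrite /= codeE.
  apply: measurableT_comp => //.
  by apply: measurable_funM; [exact: measurable_cst|exact: measurable_code].
transitivity (\int[mu]_(u in `[0%R, 1%R[) f ((-1) * code t u)%R).
  by apply: eq_integral => u _; rewrite mulN1r.
transitivity (\int[mu]_(u in `[0%R, 1%R[) f (1 * code t u)%R); last first.
  by apply: eq_integral => u _; rewrite mul1r.
rewrite !E [X in _ * X]addeC; congr (_ * (_ + _)); apply: eq_integral => u _.
  by rewrite mulN1r opprK mul1r.
by rewrite mul1r mulN1r.
Qed.

Lemma measurable_code_point : measurable_fun setT (fun u : R => (code_point u, 0%R) : R * R).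
Proof.
apply: measurable_fun_pair; last exact: measurable_cst.
apply: measurable_funM; last exact: measurable_cst.
by apply: measurable_funD; [exact: measurable_code|exact: measurable_cst].
Qed.

Lemma measurable_w t : measurable_fun setT (w t).
Proof. by apply: continuous_measurable_fun; exact: continuous_w. Qed.

(** The image of the uniform law by the coding. At level t the coding is the
    same construction started at w_t and applied to the shifted coins, whence
    the symmetry at every level at once. This symmetry is what makes
    potentials computable. *)
Lemma symmetric_measure_exists : exists mu : probability (R * R)%type R,
  mu (Kset gam) = 1 /\
  forall t (f : R -> \bar R), measurable_fun setT f -> (forall x, 0 <= f x) ->
    \int[mu]_z f (- w t z.1)%R = \int[mu]_z f (w t z.1).
Proof.
pose U := uniform_prob (@ltr01 R).
have mY : measurable_fun setT (fun u : measurableTypeR R => (code_point u, 0%R) : R * R).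
  exact: measurable_code_point.
pose Ym := isMeasurableFun.Build _ _ _ _ _ mY.
pose Y : {mfun measurableTypeR R >-> (R * R)%type} := HB.pack (fun u : R => (code_point u, 0%R) : R * R) Ym.
have EU (f : R -> \bar R) : measurable_fun setT f -> (forall x, 0 <= f x) ->
    \int[U]_u f u = \int[mu]_(u in `[0%R, 1%R[) f u.
  move=> mf f0; rewrite integral_uniform// subr0 invr1 mul1e.
  by rewrite -integral_itv_bndo_bndc//; exact: measurable_funTS.
exists (distribution U Y); split.
  rewrite /distribution /= /pushforward (_ : _ @^-1` _ = setT) ?probability_setT//.
  apply/seteqP; split=> // u _ /=; rewrite (KsetE lam2); split=> //=.
  exact: code_point_Kreal.
move=> t f mf f0.
have key (g : R -> \bar R) : measurable_fun setT g -> (forall x, 0 <= g x) ->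
    \int[distribution U Y]_z g (w t z.1) = \int[mu]_(u in `[0%R, 1%R[) g (code t u).
  move=> mg g0.
  have mgw : measurable_fun setT (fun z : R * R => g (w t z.1)).
    by apply: measurableT_comp => //; apply: measurableT_comp => //; exact: measurable_w.
  rewrite ge0_integral_distribution//.
  rewrite [LHS](_ : _ = \int[U]_u ((g \o code t) (iter t shift u))); last first.
    by apply: eq_integral => u _ /=; rewrite w_code_point.
  have mi : measurable_fun setT (iter t (shift : R -> R)).
    elim: t {mgw} => [|t IH]; first exact: measurable_id.
    by apply: (@measurableT_comp _ _ _ _ _ _ shift); [exact: measurable_shift|exact: IH].
  have mgc : measurable_fun setT (g \o code t).
    by apply: measurableT_comp => //; exact: measurable_code.
  rewrite (EU (fun u => (g \o code t) (iter t shift u))) => [|x|x]; last 2 first.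
  - exact: (measurableT_comp mgc mi).
  - exact: g0.
  by rewrite (mean_iter_shift t mgc)// => x; exact: g0.
rewrite (key (f \o -%R)); last 2 first.
  by apply: measurableT_comp.
  by move=> x; exact: f0.
by rewrite key// mean_code_opp.
Qed.

End Coding.

(** * Logarithmic energy as a superposition of window masses *)

Section Tents.
Context {R : realType}.
Local Open Scope ereal_scope.
Local Notation lambda := (@lebesgue_measure R).
Implicit Types (mu nu : probability (R * R)%type R) (r u x y : R).

(** The indicator that u <= x <= u + r, arranged so that overlapping windows
    measure distances. *)
Definition window r x u : R := if (u <= x)%R && (x <= u + r)%R then 1%R else 0%R.
Definition tent r x y : R := Num.max (r - `|x - y|)%R 0%R.

Lemma window_ge0 r x u : (0 <= window r x u)%R.
Proof. by rewrite /window; case: ifP. Qed.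

Lemma window_le1 r x u : (window r x u <= 1)%R.
Proof. by rewrite /window; case: ifP. Qed.

Lemma tent_ge0 r x y : (0 <= tent r x y)%R.
Proof. by rewrite /tent le_max lexx orbT. Qed.

(** The set of u whose window of length r contains both points is an interval
    of length r - |x - y|. *)
Lemma tent_window r x y :
  \int[lambda]_u (window r x u * window r y u)%:E = (tent r x y)%:E.
Proof.
pose D := `[(Num.max x y - r)%R, Num.min x y]%classic : set R.
transitivity (\int[lambda]_(u in D) cst 1 u).
  rewrite [RHS]integral_mkcond; apply: eq_integral => u _; rewrite patchE /window.
  have DE : D u <-> (((u <= x) && (x <= u + r)) && ((u <= y) && (y <= u + r)))%R.
    rewrite /D /= in_itv /= lerBlDr ge_max le_min.
    by split=> [/andP[/andP[-> ->] /andP[-> ->]]|/andP[/andP[-> ->] /andP[-> ->]]].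
  case: (boolP (u \in D)) => h.
    by have /andP[-> ->] := DE.1 (set_mem h); rewrite mulr1.
  case: ifPn => [h1|_]; last by rewrite mul0r.
  case: ifPn => [h2|_]; last by rewrite mulr0.
  by case/negP: h; apply: mem_set; apply: DE.2; rewrite h1 h2.
rewrite integral_cst//; last exact: measurable_itv.
rewrite mul1e /= /D lebesgue_measure_itv /= lte_fin /tent.
have e : (Num.min x y - (Num.max x y - r) = r - `|x - y|)%R.
  by have [h|h] := leP x y; [rewrite ler0_norm|rewrite gtr0_norm]; lra.
case: ifPn => h.
  by rewrite -EFinB e max_l// -e; lra.
by rewrite max_r// -e; move: h; rewrite -leNgt; lra.
Qed.

Lemma measurable_window r :
  measurable_fun setT (fun p : (R * R) * R => window r p.1.1 p.2).
Proof.
have m1 : measurable_fun setT (fun p : (R * R) * R => p.1.1).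
  by apply: measurableT_comp => //; exact: measurable_fst.
have m2 : measurable_fun setT (fun p : (R * R) * R => p.2) by exact: measurable_snd.
apply: measurable_fun_ifT; [|exact: measurable_cst|exact: measurable_cst].
apply: measurable_and; apply: measurable_fun_ler => //.
by apply: measurable_funD.
Qed.

Definition window_mass mu r u : R := fine (\int[mu]_z (window r z.1 u)%:E).

Lemma measurable_window1 r u : measurable_fun setT (fun z : R * R => (window r z.1 u)%:E).
Proof.
apply/measurable_EFinP.
exact: (measurable_fun_pair1 u (measurable_window r)).
Qed.

Lemma measurable_window2 r x : measurable_fun setT (fun u : R => (window r x u)%:E).
Proof.
apply/measurable_EFinP.
exact: (@measurable_fun_pair2 _ _ _ (R * R)%type R R (fun p => window r p.1.1 p.2) (x, 0%R) (measurable_window r)).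
Qed.

Lemma window_massE mu r u : \int[mu]_z (window r z.1 u)%:E = (window_mass mu r u)%:E.
Proof.
rewrite fineK// ge0_fin_numE; last first.
  by apply: integral_ge0 => z _; rewrite lee_fin window_ge0.
apply: (@le_lt_trans _ _ (\int[mu]_z (cst 1 z))).
  apply: ge0_le_integral => //.
  - by move=> z _; rewrite lee_fin window_ge0.
  - exact: measurable_window1.
  - by move=> z _; rewrite lee_fin window_le1.
rewrite integral_cst// mul1e; apply: (le_lt_trans (probability_le1 mu measurableT)); exact: ltry.
Qed.

Lemma window_mass_ge0 mu r u : (0 <= window_mass mu r u)%R.
Proof. by apply: fine_ge0; apply: integral_ge0 => z _; rewrite lee_fin window_ge0. Qed.

Lemma measurable_window_mass mu r : measurable_fun setT (window_mass mu r).
Proof.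
apply/measurable_EFinP.
have h := @measurable_fun_fubini_tonelli_G _ _ (R * R)%type R R mu
  (fun p => (window r p.1.1 p.2)%:E).
apply: (eq_measurable_fun _ _ (h _ _)).
- by move=> u _; rewrite /= -window_massE.
- by apply/measurable_EFinP; exact: measurable_window.
- by move=> p; rewrite lee_fin window_ge0.
Qed.

Definition tent_energy mu nu r : \bar R :=
  \int[mu]_z \int[nu]_w (tent r z.1 w.1)%:E.

Lemma tent_energyE mu nu r : tent_energy mu nu r =
  \int[lambda]_u (window_mass mu r u * window_mass nu r u)%:E.
Proof.
rewrite /tent_energy.
transitivity (\int[mu]_z \int[lambda]_u (window r z.1 u * window_mass nu r u)%:E).
  apply: eq_integral => z _.
  under eq_integral do rewrite -tent_window.
  rewrite (@fubini_tonelli _ _ _ _ _ nu lambda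
    (fun p : (R * R) * R => (window r z.1 p.2 * window r p.1.1 p.2)%:E)) /=.
  - apply: eq_integral => u _; under eq_integral do rewrite EFinM.
    rewrite ge0_integralZl//; first by rewrite window_massE.
    + exact: measurable_window1.
    + by move=> ? _; rewrite lee_fin window_ge0.
    + by rewrite lee_fin window_ge0.
  - apply/measurable_EFinP; apply: measurable_funM; last exact: measurable_window.
    apply: (@measurableT_comp _ _ _ _ _ _ (window r z.1) _ snd); last exact: measurable_snd.
    by have /measurable_EFinP := @measurable_window2 r z.1.
  - by move=> p; rewrite lee_fin mulr_ge0// window_ge0.
rewrite (@fubini_tonelli _ _ _ _ _ mu lambda
  (fun p : (R * R) * R => (window r p.1.1 p.2 * window_mass nu r p.2)%:E)) /=.
- apply: eq_integral => u _; under eq_integral do rewrite mulrC EFinM.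
  rewrite ge0_integralZl//; first by rewrite window_massE mulrC -EFinM.
  + exact: measurable_window1.
  + by move=> ? _; rewrite lee_fin window_ge0.
  + by rewrite lee_fin window_mass_ge0.
- apply/measurable_EFinP; apply: measurable_funM; first exact: measurable_window.
  by apply: measurableT_comp; [exact: measurable_window_mass|exact: measurable_snd].
- by move=> p; rewrite lee_fin mulr_ge0// ?window_ge0// window_mass_ge0.
Qed.

Lemma tent_energy_ge0 mu nu r : 0 <= tent_energy mu nu r.
Proof.
by apply: integral_ge0 => z _; apply: integral_ge0 => x _; rewrite lee_fin tent_ge0.
Qed.

(** The tent kernel is a superposition of products of windows, hence positive
    definite: polarisation leaves a square. *)
Lemma tent_energy_polarization mu nu r :
  tent_energy mu mu r + tent_energy nu nu r = tent_energy mu nu r + tent_energy mu nu r +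
    \int[lambda]_u ((window_mass mu r u - window_mass nu r u) ^+ 2)%:E.
Proof.
rewrite !tent_energyE.
have m (mu1 mu2 : probability (R * R)%type R) : measurable_fun setT
    (fun u => (window_mass mu1 r u * window_mass mu2 r u)%:E).
  by apply/measurable_EFinP; apply: measurable_funM; exact: measurable_window_mass.
have p (mu1 mu2 : probability (R * R)%type R) u :
    0 <= (window_mass mu1 r u * window_mass mu2 r u)%:E.
  by rewrite lee_fin mulr_ge0// window_mass_ge0.
rewrite -!ge0_integralD//.
- by apply: eq_integral => u _; rewrite -!EFinD; congr EFin; ring.
- by move=> u _; rewrite adde_ge0.
- by apply: emeasurable_funD; exact: m.
- by move=> u _; rewrite lee_fin sqr_ge0.
- apply/measurable_EFinP; apply: (@measurable_funX _ _ _ _ _ 2).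
  by apply: measurable_funB; exact: measurable_window_mass.
all: exact: m.
Qed.

End Tents.

Section LogTent.
Context {R : realType}.
Local Open Scope ereal_scope.
Local Notation lambda := (@lebesgue_measure R).
Implicit Types (r d x y : R).

(** The weight r^-2 on (0, 1], written with exp and ln so that it is visibly
    measurable. *)
Definition scale_density r : R :=
  if (0 < r)%R && (r <= 1)%R then expR (- 2 * ln r) else 0%R.

Lemma scale_density_ge0 r : (0 <= scale_density r)%R.
Proof. by rewrite /scale_density; case: ifP => // _; exact: expR_ge0. Qed.

Lemma scale_densityE r : (0 < r <= 1)%R -> scale_density r = (r ^- 2)%R.
Proof.
move=> h; rewrite /scale_density h; case/andP: h => r0 _.
have -> : (- 2 * ln r = - (ln r + ln r))%R by ring.
by rewrite expRN expRD lnK ?posrE// expr2.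
Qed.

Lemma measurable_scale_density : measurable_fun setT scale_density.
Proof.
apply: measurable_fun_ifT; [|apply: measurableT_comp|exact: measurable_cst].
- apply: measurable_and; apply: measurable_fun_ler || apply: measurable_fun_ltr;
    by [exact: measurable_id|exact: measurable_cst].
- exact: measurable_expR.
- by apply: measurable_funM; [exact: measurable_cst|exact: measurable_ln].
Qed.

Lemma is_derive_primitive d x : (0 < x)%R ->
  is_derive x 1%R (fun r : R => ln r + d * r^-1)%R (x^-1 - d * x ^- 2)%R.
Proof.
move=> x0.
have h1 : is_derive x 1%R (@ln R) x^-1%R by exact: is_derive1_ln.
have h2 : is_derive x 1%R (fun r : R => r^-1)%R (- x ^- 2 *: (1 : R))%R.
  by apply: is_deriveV; rewrite gt_eqF.
have h3 : is_derive x 1%R (fun r : R => d *: r^-1)%R (d *: (- x ^- 2 *: (1 : R)))%R.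
  exact: is_deriveZ.
have := is_deriveD h1 h3; rewrite (_ : (_ + d *: _)%R = (x^-1 - d * x ^- 2)%R)//.
by rewrite /GRing.scale /= mulr1 mulrN.
Qed.

(** The primitive of r^-1 - d r^-2 is ln r + d r^-1. *)
Lemma log_integral_pos d : (0 < d <= 1)%R ->
  \int[lambda]_r (scale_density r * Num.max (r - d) 0)%:E = (- ln d - 1 + d)%:E.
Proof.
move=> /andP[d0 d1]; pose f r := (r^-1 - d * r ^- 2)%R.
transitivity (\int[lambda]_(r in `[d, 1%R]) (f r)%:E).
  rewrite [RHS]integral_mkcond; apply: eq_integral => r _; rewrite patchE.
  case: (boolP (r \in _)) => [/set_mem|/negP h].
    rewrite /= in_itv /= => /andP[h1 h2].
    have r0 : (0 < r)%R by apply: lt_le_trans h1.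
    rewrite scale_densityE ?r0// max_l ?subr_ge0// /f; congr EFin.
    by field; rewrite gt_eqF.
  congr EFin; have [r1|r1] := leP r d; first by rewrite max_r ?mulr0// subr_le0.
  rewrite /scale_density; case: ifP; rewrite ?mul0r// => /andP[_ r2].
  by exfalso; apply: h; apply/mem_set; rewrite /= in_itv /= r2 ltW.
have [->|dn1] := eqVneq d 1%R.
  rewrite set_itv1 integral_set1 ln1; congr EFin; lra.
have dlt1 : (d < 1)%R by rewrite lt_neqAle dn1.
have der x : (d <= x)%R -> is_derive x 1%R (fun r : R => ln r + d * r^-1)%R (f x).
  by move=> dx; apply: is_derive_primitive; apply: lt_le_trans dx.
have cF x : (d <= x)%R -> {for x, continuous (fun r : R => ln r + d * r^-1)%R}.
  by move=> /der dx; apply/differentiable_continuous/derivable1_diffP; exact: ex_derive.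
rewrite (@continuous_FTC2 _ f (fun r : R => ln r + d * r^-1)%R _ _ dlt1).
- by rewrite ln1 invr1 divff ?gt_eqF// -EFinB; congr EFin; ring.
- apply/continuous_in_subspaceT => x /set_mem; rewrite /= in_itv /= => /andP[dx _].
  have x0 : (x != 0)%R by rewrite gt_eqF// (lt_le_trans d0).
  have cv : {for x, continuous (fun r : R => r^-1)%R} by exact: inv_continuous.
  apply: cvgB => //; apply: cvgMr; rewrite -exprVn.
  rewrite (_ : (fun r => r ^- 2) = (fun r => r^-1 * r^-1))%R; first exact: cvgM.
  by apply/funext => r; rewrite -exprVn expr2.
- split=> [x||].
  + by rewrite in_itv /= => /andP[/ltW/der dx _]; exact: ex_derive.
  + by apply: cvg_at_right_filter; exact: cF.
  + by apply: cvg_at_left_filter; apply: cF; exact: ltW.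
- by move=> x; rewrite in_itv /= => /andP[/ltW/der dx _]; rewrite derive1E derive_val.
Qed.

(** On an interval of length 1 the logarithmic kernel is a superposition of
    tents of all scales, with the tent of scale 1 as a separate summand. The
    latter carries the strictness of positive definiteness. *)
Lemma log_tent x y : (`|x - y| <= 1)%R ->
  \int[lambda]_r (scale_density r * tent r x y)%:E + (tent 1 x y)%:E = - lne (`|x - y|)%:E.
Proof.
rewrite /tent; set d := `|x - y|%R => d1; rewrite (max_l (_ : 0 <= 1 - d)%R) ?subr_ge0//.
have m e : measurable_fun setT (fun r : R => (scale_density r * Num.max (r - e) 0)%:E).
  apply/measurable_EFinP; apply: measurable_funM; first exact: measurable_scale_density.
  apply: measurable_maxr; last exact: measurable_cst.
  by apply: measurable_funB; [exact: measurable_id|exact: measurable_cst].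
have [d0|] := ltP 0%R d.
  by rewrite log_integral_pos ?d0// lne_EFin// -EFinD -EFinN; congr EFin; ring.
move=> h; have -> : d = 0%R by apply/eqP; rewrite eq_le h normr_ge0.
rewrite le0_lneNy//=.
suff -> : \int[lambda]_r (scale_density r * Num.max (r - 0) 0)%:E = +oo by rewrite addye.
apply: eq_infty => A; pose e := expR (- (`|A| + 1))%R.
have e0 : (0 < e)%R by exact: expR_gt0.
have e1 : (e <= 1)%R by rewrite -expR0 ler_expR oppr_le0 addr_ge0.
apply: (@le_trans _ _ (- ln e - 1 + e)%:E).
  by rewrite lee_fin /e expRK; have := ler_norm A; have := expR_ge0 (- (`|A| + 1))%R; lra.
have p0 (b r : R) : (0 <= scale_density r * Num.max (r - b) 0)%R.
  by rewrite mulr_ge0 ?scale_density_ge0// le_max lexx orbT.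
rewrite -log_integral_pos ?e0//; apply: ge0_le_integral => //.
- by move=> r _; rewrite lee_fin.
- exact: (m e).
- exact: (m 0%R).
- move=> r _; rewrite lee_fin; apply: ler_wpM2l; first exact: scale_density_ge0.
  by rewrite ge_max !le_max lexx orbT andbT subr0 gerBl ltW.
Qed.

End LogTent.

Section LogEnergy.
Context {R : realType}.
Local Open Scope ereal_scope.
Local Notation lambda := (@lebesgue_measure R).
Local Notation plane := (R * R)%type.
Implicit Types (mu nu : probability plane R) (r d x y : R).
Local Notation S := (@unit_segment R).

Lemma measurable_unit_segment : measurable S.
Proof.
rewrite (_ : S = (fst @^-1` `[0%R, 1%R]%classic) `&` (snd @^-1` [set 0%R])); last first.
  by apply/seteqP; split=> z /=; rewrite in_itv.
apply: measurableI; rewrite -[X in measurable X]setTI.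
  by apply: measurable_fst => //; exact: measurable_itv.
by apply: measurable_snd => //; exact: measurable_set1.
Qed.

Lemma cdistE (z v : plane) : cdist z v = Num.sqrt ((z.1 - v.1) ^+ 2 + (z.2 - v.2) ^+ 2)%R.
Proof. by []. Qed.

Lemma cdist_real (z v : plane) : z.2 = 0%R -> v.2 = 0%R -> cdist z v = `|z.1 - v.1|%R.
Proof. by move=> h1 h2; rewrite cdistE h1 h2 subrr expr0n /= addr0 sqrtr_sqr. Qed.

Lemma measurable_neg_lne : measurable_fun setT (fun x : R => - lne x%:E).
Proof.
apply: measurableT_comp => //.
apply: measurable_fun_ifT; [|exact: measurable_cst|].
- by apply: measurable_fun_ler; [exact: measurable_id|exact: measurable_cst].
- by apply/measurable_EFinP; exact: measurable_ln.
Qed.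

Lemma measurable_log_kernel :
  measurable_fun setT (fun p : plane * plane => - lne (cdist p.1 p.2)%:E).
Proof.
apply: (@measurableT_comp _ _ _ _ _ _ (fun x : R => - lne x%:E) _ (fun p : plane * plane => cdist p.1 p.2)).
  exact: measurable_neg_lne.
apply: (@measurableT_comp _ _ _ _ _ _ (@Num.sqrt R)).
  exact: continuous_measurable_fun (@sqrt_continuous R).
have m (f : plane -> R) : measurable_fun setT f ->
    measurable_fun setT (fun p : plane * plane => (f p.1 - f p.2) ^+ 2)%R.
  move=> mf; apply: (@measurable_funX _ _ _ _ _ 2); apply: measurable_funB.
    by apply: measurableT_comp => //; exact: measurable_fst.
  by apply: measurableT_comp => //; exact: measurable_snd.
by apply: measurable_funD; [apply: (m fst)|apply: (m snd)].
Qed.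

Lemma measurable_integral_param (disp : measure_display) (T1 : measurableType disp) (f : T1 * plane -> \bar R) nu :
  measurable_fun setT f -> measurable_fun setT (fun z => \int[nu]_v f (z, v)).
Proof.
move=> mf; under eq_fun do rewrite integralE.
apply: emeasurable_funB.
- have h : measurable_fun setT (fubini_F nu f^\+).
    by apply: measurable_fun_fubini_tonelli_F => //; exact: measurable_funepos.
  by move: h; rewrite !unlock.
- have h : measurable_fun setT (fubini_F nu f^\-).
    by apply: measurable_fun_fubini_tonelli_F => //; exact: measurable_funeneg.
  by move: h; rewrite !unlock.
Qed.

Lemma eq_integral_carried mu (K : set plane) (f g : plane -> \bar R) :
  measurable K -> mu K = 1 -> measurable_fun setT f -> measurable_fun setT g ->
  (forall z, K z -> f z = g z) -> \int[mu]_z f z = \int[mu]_z g z.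
Proof.
move=> mK K1 mf mg fg; apply: ae_eq_integral => //.
exists (~` K); split; first exact: measurableC.
  by have := probability_setC mu mK; rewrite K1 subee// => h; exact: h.
by move=> z /=; apply: contra_not => Kz _; exact: fg.
Qed.

Definition mutual_energy mu nu : \bar R :=
  \int[mu]_z \int[nu]_v - lne (cdist z v)%:E.

Lemma measurable_tent3 : measurable_fun setT
  (fun p : (plane * plane) * R => tent p.2 p.1.1.1 p.1.2.1).
Proof.
apply: measurable_maxr; last exact: measurable_cst.
apply: measurable_funB; first exact: measurable_snd.
apply: measurableT_comp => //; apply: measurable_funB.
  do 2 (apply: (measurableT_comp measurable_fst)).
  exact: measurable_fst.
apply: (measurableT_comp measurable_fst); apply: (measurableT_comp measurable_snd).
exact: measurable_fst.
Qed.

Lemma measurable_tent r : measurable_fun setT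
  (fun p : plane * plane => (tent r p.1.1 p.2.1)%:E).
Proof.
apply/measurable_EFinP.
exact: (@measurable_fun_pair1 _ _ _ _ _ _ _ r measurable_tent3).
Qed.

Lemma measurable_scaled_tent : measurable_fun setT
  (fun p : (plane * plane) * R => (scale_density p.2 * tent p.2 p.1.1.1 p.1.2.1)%:E).
Proof.
apply/measurable_EFinP; apply: measurable_funM; last exact: measurable_tent3.
by apply: measurableT_comp; [exact: measurable_scale_density|exact: measurable_snd].
Qed.

Lemma scaled_tent_ge0 r x y : 0 <= (scale_density r * tent r x y)%:E.
Proof. by rewrite lee_fin mulr_ge0 ?scale_density_ge0 ?tent_ge0. Qed.

Lemma measurable_tent_part : measurable_fun setT (fun p : plane * plane =>
  \int[lambda]_r (scale_density r * tent r p.1.1 p.2.1)%:E).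
Proof.
apply: (@measurable_fun_fubini_tonelli_F _ _ _ _ _ lambda
  (fun p : (plane * plane) * R => (scale_density p.2 * tent p.2 p.1.1.1 p.1.2.1)%:E)).
  exact: measurable_scaled_tent.
by move=> p; exact: scaled_tent_ge0.
Qed.

Lemma tent_part_ge0 x y : 0 <= \int[lambda]_r (scale_density r * tent r x y)%:E.
Proof. by apply: integral_ge0 => r _; exact: scaled_tent_ge0. Qed.

Lemma tent_partE mu nu :
  \int[mu]_z \int[nu]_v \int[lambda]_r (scale_density r * tent r z.1 v.1)%:E =
  \int[lambda]_r ((scale_density r)%:E * tent_energy mu nu r).
Proof.
have mz (z : plane) : measurable_fun setT
    (fun p : plane * R => (scale_density p.2 * tent p.2 z.1 p.1.1)%:E).
  have h : measurable_fun setT (fun p : plane * R => ((z, p.1), p.2) : (plane * plane) * R).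
    apply: measurable_fun_pair; last exact: measurable_snd.
    by apply: measurable_fun_pair; [exact: measurable_cst|exact: measurable_fst].
  exact: (measurableT_comp measurable_scaled_tent h).
have mr r (z : plane) : measurable_fun setT (fun v : plane => (tent r z.1 v.1)%:E).
  exact: (@measurable_fun_pair2 _ _ _ plane plane _ _ z (measurable_tent r)).
have pull r (z : plane) : \int[nu]_v (scale_density r * tent r z.1 v.1)%:E =
    (scale_density r)%:E * \int[nu]_v (tent r z.1 v.1)%:E.
  under eq_integral do rewrite EFinM.
  rewrite ge0_integralZl//.
  - by move=> v _; rewrite lee_fin tent_ge0.
  - by rewrite lee_fin scale_density_ge0.
transitivity (\int[mu]_z \int[lambda]_r \int[nu]_v (scale_density r * tent r z.1 v.1)%:E).
  apply: eq_integral => z _.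
  rewrite (@fubini_tonelli _ _ _ _ _ nu lambda
    (fun p : plane * R => (scale_density p.2 * tent p.2 z.1 p.1.1)%:E))//.
    exact: mz.
  by move=> p; exact: scaled_tent_ge0.
rewrite (@fubini_tonelli _ _ _ _ _ mu lambda
  (fun p : plane * R => \int[nu]_v (scale_density p.2 * tent p.2 p.1.1 v.1)%:E)) /=.
- apply: eq_integral => r _; under eq_integral do rewrite pull.
  rewrite ge0_integralZl//.
  + exact: (measurable_integral_param nu (measurable_tent r)).
  + by move=> z _; apply: integral_ge0 => v _; rewrite lee_fin tent_ge0.
  + by rewrite lee_fin scale_density_ge0.
- apply: (measurable_integral_param (f := fun q : (plane * R) * plane =>
    (scale_density q.1.2 * tent q.1.2 q.1.1.1 q.2.1)%:E)).
  have h : measurable_fun setT (fun q : (plane * R) * plane =>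
      ((q.1.1, q.2), q.1.2) : (plane * plane) * R).
    have h1 : measurable_fun setT (fun q : (plane * R) * plane => q.1.1).
      by apply: (measurableT_comp measurable_fst); exact: measurable_fst.
    have h2 : measurable_fun setT (fun q : (plane * R) * plane => q.1.2).
      by apply: (measurableT_comp measurable_snd); exact: measurable_fst.
    apply: measurable_fun_pair => //; apply: measurable_fun_pair => //.
  exact: (measurableT_comp measurable_scaled_tent h).
- by move=> p; apply: integral_ge0 => v _; exact: scaled_tent_ge0.
Qed.

(** Integration of the decomposition of the kernel into tents, by Tonelli. *)
Lemma mutual_energyE mu nu : mu S = 1 -> nu S = 1 ->
  mutual_energy mu nu =
  \int[lambda]_r ((scale_density r)%:E * tent_energy mu nu r) + tent_energy mu nu 1.
Proof.
move=> mu1 nu1; have mS := measurable_unit_segment.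
pose k (p : plane * plane) :=
  \int[lambda]_r (scale_density r * tent r p.1.1 p.2.1)%:E + (tent 1 p.1.1 p.2.1)%:E.
have mk : measurable_fun setT k.
  by apply: emeasurable_funD; [exact: measurable_tent_part|exact: measurable_tent].
transitivity (\int[mu]_z \int[nu]_v k (z, v)).
  apply: (eq_integral_carried mS mu1).
  - exact: (measurable_integral_param nu measurable_log_kernel).
  - exact: (measurable_integral_param nu mk).
  move=> z [z1 z2]; apply: (eq_integral_carried mS nu1).
  - exact: (@measurable_fun_pair2 _ _ _ plane plane _ _ z measurable_log_kernel).
  - exact: (@measurable_fun_pair2 _ _ _ plane plane _ _ z mk).
  move=> v [v1 v2]; rewrite /k /= log_tent ?cdist_real//.
  by rewrite ler_norml; move: z1 v1 => /andP[? ?] /andP[? ?]; apply/andP; split; lra.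
rewrite -tent_partE /tent_energy.
have m1 (z : plane) : measurable_fun setT (fun v : plane => \int[lambda]_r (scale_density r * tent r z.1 v.1)%:E).
  exact: (@measurable_fun_pair2 _ _ _ plane plane _ _ z measurable_tent_part).
have m2 (z : plane) : measurable_fun setT (fun v : plane => (tent 1 z.1 v.1)%:E).
  exact: (@measurable_fun_pair2 _ _ _ plane plane _ _ z (measurable_tent 1)).
rewrite -ge0_integralD//.
- apply: eq_integral => z _; rewrite -ge0_integralD//.
  + by move=> v _; exact: tent_part_ge0.
  + by move=> v _; rewrite lee_fin tent_ge0.
- by move=> z _; apply: integral_ge0 => v _; exact: tent_part_ge0.
- exact: (measurable_integral_param nu measurable_tent_part).
- by move=> z _; apply: integral_ge0 => v _; rewrite lee_fin tent_ge0.
- exact: (measurable_integral_param nu (measurable_tent 1)).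
Qed.

End LogEnergy.

Section Uniqueness.
Context {R : realType}.
Local Open Scope ereal_scope.
Local Notation lambda := (@lebesgue_measure R).
Local Notation plane := (R * R)%type.
Implicit Types (mu nu : probability plane R) (r d x y t : R).
Local Notation S := (@unit_segment R).

Definition window_defect mu nu : \bar R :=
  \int[lambda]_u ((window_mass mu 1 u - window_mass nu 1 u) ^+ 2)%:E.

Lemma measurable_tent_energy mu nu : measurable_fun setT (tent_energy mu nu).
Proof.
have h : measurable_fun setT (fun q : (R * plane) * plane =>
    ((q.1.2, q.2), q.1.1) : (plane * plane) * R).
  have h1 : measurable_fun setT (fun q : (R * plane) * plane => q.1.1).
    by apply: (measurableT_comp measurable_fst); exact: measurable_fst.
  have h2 : measurable_fun setT (fun q : (R * plane) * plane => q.1.2).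
    by apply: (measurableT_comp measurable_snd); exact: measurable_fst.
  by apply: measurable_fun_pair => //; apply: measurable_fun_pair.
have m := measurableT_comp measurable_tent3 h.
have m1 : measurable_fun setT (fun q : R * plane => \int[nu]_v (tent q.1 q.2.1 v.1)%:E).
  apply: (measurable_integral_param nu
    (f := fun q : (R * plane) * plane => (tent q.1.1 q.1.2.1 q.2.1)%:E)).
  exact/measurable_EFinP.
exact: (measurable_integral_param mu m1).
Qed.

(** Each scale contributes a nonnegative square; keeping only that of the
    separate tent of scale 1 gives a defect which already determines the
    measures. The inequality is stated with sums because the energies may be
    infinite. *)
Lemma mutual_energy_polarization mu nu : mu S = 1 -> nu S = 1 ->
  mutual_energy mu nu + mutual_energy mu nu + window_defect mu nu <=
  mutual_energy mu mu + mutual_energy nu nu.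
Proof.
move=> mu1 nu1.
have [I IE] : exists I : probability plane R -> probability plane R -> \bar R,
    forall m1 m2, I m1 m2 = \int[lambda]_r ((scale_density r)%:E * tent_energy m1 m2 r).
  by eexists.
have E (m1 m2 : probability plane R) : m1 S = 1 -> m2 S = 1 ->
    mutual_energy m1 m2 = I m1 m2 + tent_energy m1 m2 1.
  by rewrite IE; exact: mutual_energyE.
have aux (x1 x2 x y1 y2 y d : \bar R) : y1 + y2 = y + y + d -> x + x <= x1 + x2 ->
    (x + y) + (x + y) + d <= (x1 + y1) + (x2 + y2).
  move=> e h; rewrite (addeACA x1) e (addeACA x) -[leLHS]addeA.
  exact: leeD2r.
rewrite (E _ _ mu1 nu1) (E _ _ mu1 mu1) (E _ _ nu1 nu1).
apply: aux; first exact: tent_energy_polarization.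
have I0 (m1 m2 : probability plane R) r : 0 <= (scale_density r)%:E * tent_energy m1 m2 r.
  by rewrite mule_ge0 ?lee_fin ?scale_density_ge0 ?tent_energy_ge0.
have mI (m1 m2 : probability plane R) : measurable_fun setT (fun r => (scale_density r)%:E * tent_energy m1 m2 r).
  apply: emeasurable_funM; last exact: measurable_tent_energy.
  by apply/measurable_EFinP; exact: measurable_scale_density.
have sI (m1 m2 m3 m4 : probability plane R) : I m1 m2 + I m3 m4 =
    \int[lambda]_r ((scale_density r)%:E * tent_energy m1 m2 r +
                    (scale_density r)%:E * tent_energy m3 m4 r).
  rewrite !IE; symmetry.
  exact: (ge0_integralD lambda measurableT (fun r _ => I0 m1 m2 r) (mI m1 m2)
    (fun r _ => I0 m3 m4 r) (mI m3 m4)).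
have mII (m1 m2 m3 m4 : probability plane R) : measurable_fun setT (fun r =>
    (scale_density r)%:E * tent_energy m1 m2 r + (scale_density r)%:E * tent_energy m3 m4 r).
  by apply: emeasurable_funD; exact: mI.
rewrite (sI mu nu mu nu) (sI mu mu nu nu).
apply: ge0_le_integral => //.
- by move=> r _; rewrite adde_ge0.
- exact: mII.
- exact: mII.
- move=> r _; rewrite -(ge0_muleDr _ (tent_energy_ge0 mu nu r) (tent_energy_ge0 mu nu r)).
  rewrite -(ge0_muleDr _ (tent_energy_ge0 mu mu r) (tent_energy_ge0 nu nu r)).
  apply: lee_wpmul2l; first by rewrite lee_fin scale_density_ge0.
  rewrite tent_energy_polarization leeDl//.
  by apply: integral_ge0 => u _; rewrite lee_fin sqr_ge0.
Qed.

Lemma measurable_fst_plane : measurable_fun setT (fst : plane -> measurableTypeR R).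
Proof. exact: measurable_fst. Qed.

Lemma ray_half_open (P : probability (measurableTypeR R) R) (a b : R) : (a <= b)%R ->
  P `]a, b]%classic = P `]-oo, b]%classic - P `]-oo, a]%classic.
Proof.
move=> ab; have -> : `]a, b]%classic = `]-oo, b]%classic `\` `]-oo, a]%classic :> set R.
  apply/seteqP; split=> x /=; rewrite !in_itv /=.
    by move=> /andP[ax xb]; split=> //; apply/negP; rewrite -ltNge.
  by move=> [xb /negP]; rewrite -ltNge => ax; rewrite ax xb.
rewrite measureD ?setIidr//.
- by move=> x /=; rewrite !in_itv /= => /le_trans; apply.
- by apply: le_lt_trans (probability_le1 _ _) _ => //; exact: ltry.
Qed.

Lemma probability_eq_of_rays (P Q : probability (measurableTypeR R) R) :
  (forall t, P `]-oo, t]%classic = Q `]-oo, t]%classic) ->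
  forall A, measurable A -> P A = Q A.
Proof.
move=> PQ; apply: (@measure_unique _ R (measurableTypeR R) (@ocitv R)
  (fun n : nat => `](- n%:R)%R, n%:R]%classic) erefl (@ocitvI R)) => //.
- by move=> n; exact: is_ocitv.
- apply/seteqP; split=> // x _; exists (Num.bound `|x|%R) => //=; rewrite in_itv /=.
  by have := archi_boundP (normr_ge0 x); rewrite ltr_norml => /andP[-> /ltW].
- move=> _ [[a b] _ <-] /=; have [ab|ba] := leP a b.
    by rewrite !ray_half_open// !PQ.
  by rewrite set_itv_ge ?measure0// bnd_simp -leNgt ltW.
- by move=> k; apply: le_lt_trans (probability_le1 _ _) _ => //; exact: ltry.
Qed.

Lemma carried_setC mu (K : set plane) : measurable K -> mu K = 1 -> mu (~` K) = 0.
Proof. by move=> mK K1; have := probability_setC mu mK; rewrite K1 subee. Qed.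

Definition ray mu t : \bar R := mu [set z | (z.1 <= t)%R].

Lemma measurable_ray t : measurable [set z : plane | (z.1 <= t)%R].
Proof.
rewrite (_ : mkset _ = fst @^-1` `]-oo, t]%classic); last first.
  by apply/seteqP; split=> z /=; rewrite in_itv.
by rewrite -[X in measurable X]setTI; apply: measurable_fst => //; exact: measurable_itv.
Qed.

(** For -1 < u <= 0 the window [u, u + 1] meets [0, 1] in [0, u + 1], so that
    window masses are values of the distribution function. *)
Lemma window_mass_ray mu u : mu S = 1 -> (-1 < u <= 0)%R ->
  (window_mass mu 1 u)%:E = ray mu (u + 1).
Proof.
move=> mu1 /andP[u1 u0]; rewrite -window_massE.
have mA := measurable_ray (u + 1).
transitivity (\int[mu]_z (\1_[set z : plane | (z.1 <= u + 1)%R] z)%:E).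
  apply: (eq_integral_carried measurable_unit_segment mu1).
  - exact: measurable_window1.
  - by apply/measurable_EFinP; apply: measurable_indic.
  - move=> z [/andP[z0 z1] _]; rewrite /window indicE (le_trans u0 z0)/=.
    by case: ifPn => h; [rewrite mem_set|rewrite memNset//=; exact/negP].
by rewrite integral_indic// setIT.
Qed.

(** A vanishing defect makes the distribution functions agree almost
    everywhere; right continuity upgrades a strict inequality at one point to
    an interval. *)
Lemma ray_le_of_defect mu nu t : mu S = 1 -> nu S = 1 -> window_defect mu nu = 0 ->
  (0 <= t < 1)%R -> ray nu t <= ray mu t.
Proof.
move=> mu1 nu1 D0 /andP[t0 t1]; rewrite leNgt; apply/negP => tlt.
have mX : measurable_fun setT (fst : plane -> R) by exact: measurable_fst.
pose Xm := isMeasurableFun.Build _ _ _ _ _ mX.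
pose X : {RV mu >-> R} := HB.pack (fst : plane -> R) Xm.
have cE r : cdf X r = ray mu r.
  by rewrite /cdf /distribution /= /pushforward /ray; congr (mu _); apply/seteqP; split=> z /=; rewrite in_itv.
have nb : nbhs (cdf X t) [set y | y < ray nu t].
  by apply: open_nbhs_nbhs; split; [exact: open_ereal_lt_ereal|rewrite /= cE].
have [e /= e0 he] := cdf_right_continuous nb.
have h (t' : R) : (t < t')%R -> (t' < t + e)%R -> ray mu t' < ray nu t'.
  move=> tt' te; apply: (@lt_le_trans _ _ (ray nu t)).
    rewrite -cE; apply: he => //=.
    by rewrite ltr0_norm; lra.
  apply: le_measure; rewrite ?inE; [exact: measurable_ray|exact: measurable_ray|].
  by move=> z /= /le_trans; apply; exact: ltW.
have mf : measurable_fun setT (fun u => ((window_mass mu 1 u - window_mass nu 1 u) ^+ 2)%:E).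
  apply/measurable_EFinP; apply: (@measurable_funX _ _ _ _ _ 2).
  by apply: measurable_funB; exact: measurable_window_mass.
have [N [mN N0 hN]] : ae_eq lambda setT (fun u => ((window_mass mu 1 u - window_mass nu 1 u) ^+ 2)%:E) (cst 0).
  apply/ae_eq_integral_abs => //.
  rewrite -[RHS]D0; apply: eq_integral => u _.
  by rewrite gee0_abs// lee_fin sqr_ge0.
pose e' := Num.min e (1 - t)%R.
have e'0 : (0 < e')%R by rewrite lt_min e0 subr_gt0.
(* On this interval of positive length the window masses would have to
   agree. *)
have sub : `](t - 1)%R, (t - 1 + e')%R[%classic `<=` N.
  move=> u /=; rewrite in_itv /= => /andP[u1 u2]; apply: hN => /= /(_ I).
  have e'e : (e' <= e)%R by rewrite ge_min lexx.
  have e't : (e' <= 1 - t)%R by rewrite ge_min lexx orbT.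
  move=> /eqP; rewrite eqe sqrf_eq0 subr_eq0 => /eqP wm.
  have := h (u + 1)%R; rewrite -!window_mass_ray ?wm//; try (apply/andP; split; lra).
  rewrite ltxx => H; suff : false by []. apply: H; lra.
have : lambda `](t - 1)%R, (t - 1 + e')%R[%classic = 0.
  by apply: (subset_measure0 _ mN sub N0); exact: measurable_itv.
rewrite lebesgue_measure_itv /= lte_fin ltrDl e'0 -EFinB => /eqP.
by rewrite eqe addrAC subrr add0r gt_eqF.
Qed.

Lemma window_defectC mu nu : window_defect mu nu = window_defect nu mu.
Proof. by apply: eq_integral => u _; rewrite -sqrrN opprB. Qed.

Lemma measure_eq_of_defect mu nu : mu S = 1 -> nu S = 1 -> window_defect mu nu = 0 ->
  forall A, measurable A -> mu A = nu A.
Proof.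
move=> mu1 nu1 D0.
have rayE t : ray mu t = ray nu t.
  have [t0|t0] := ltP t 0%R.
    have z (m : probability plane R) : m S = 1 -> ray m t = 0.
      move=> m1; apply: (subset_measure0 (B := ~` S)) => //.
      - exact: measurable_ray.
      - by apply: measurableC; exact: measurable_unit_segment.
      - by move=> p /= pt [/andP[p0 _] _]; move: (le_trans p0 pt); rewrite leNgt t0.
      - by apply: carried_setC => //; exact: measurable_unit_segment.
    by rewrite !z.
  have [t1|t1] := ltP t 1%R.
    by apply/eqP; rewrite eq_le !ray_le_of_defect ?t0// window_defectC.
  have z (m : probability plane R) : m S = 1 -> ray m t = 1.
    move=> m1; apply/eqP; rewrite eq_le probability_le1; last exact: measurable_ray.
    rewrite -m1; apply: le_measure; rewrite ?inE.
    - exact: measurable_unit_segment.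
    - exact: measurable_ray.
    - by move=> p /= [/andP[_ p1] _]; exact: le_trans t1.
  by rewrite !z.
move=> A mA.
pose Xm := isMeasurableFun.Build _ _ _ _ _ (@measurable_fst_plane).
pose X : {mfun plane >-> measurableTypeR R} := HB.pack (fst : plane -> measurableTypeR R) Xm.
pose B := [set x : measurableTypeR R | A (x, 0%R)].
have mB : measurable B.
  have h : measurable_fun setT (fun x : measurableTypeR R => (x, 0%R) : plane).
    by apply: measurable_fun_pair; [exact: measurable_id|exact: measurable_cst].
  by rewrite -[X in measurable X]setTI; exact: h.
have mX : measurable (fst @^-1` B : set plane).
  by rewrite -[X in measurable X]setTI; apply: measurable_fst_plane.
have toB (m : probability plane R) : m S = 1 -> m A = distribution m X B.
  move=> m1; rewrite /distribution /= /pushforward.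
  have mC0 : m (~` S) = 0.
    by apply: carried_setC => //; exact: measurable_unit_segment.
  have mS := measurable_unit_segment.
  have red (C : set plane) : measurable C -> m C = m (C `&` S).
    move=> mC; rewrite -[in LHS](setIT C) -(setUv S) setIUr measureU//.
    - rewrite [X in _ + X](_ : _ = 0) ?adde0//.
      apply: (subset_measure0 (B := ~` S)) => //.
      + by apply: measurableI; [exact: mC|apply: measurableC; exact: mS].
      + by apply: measurableC; exact: mS.
    - by apply: measurableI; [exact: mC|exact: mS].
    - by apply: measurableI; [exact: mC|apply: measurableC; exact: mS].
    - by rewrite setIACA setICr setI0.
  rewrite red// [RHS]red//; congr (m _); apply/seteqP; split=> -[x y] /= [Az [zx zy]]; split=> //.
    by rewrite /B /=; move: zy => /= <-.
  by move: zy Az => /= ->.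
by rewrite !toB//; apply: probability_eq_of_rays.
Qed.

End Uniqueness.

(** * The potential of the symmetric measure *)

Section LogKernel.
Context {R : realType}.
Local Open Scope ereal_scope.
Implicit Types (a v A l : R).

(** The logarithmic kernel at distance scale A, truncated at 0. The scale is
    chosen so large that the truncation never acts; positivity is what the
    integration lemmas need. *)
Definition logk A a v : \bar R := maxe (- lne (`|a - v| / A)%:E) 0.

Lemma logk_ge0 A a v : 0 <= logk A a v.
Proof. by rewrite /logk le_max lexx orbT. Qed.

Lemma logkE A a v : (0 < A)%R -> (`|a - v| <= A)%R -> logk A a v = - lne (`|a - v| / A)%:E.
Proof.
move=> A0 avA; rewrite /logk max_l// oppe_ge0 lne_le0 lee_fin ler_pdivrMr// mul1r//.
Qed.

Lemma measurable_logk A a : measurable_fun setT (logk A a).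
Proof.
apply: measurable_maxe; last exact: measurable_cst.
apply: (@measurableT_comp _ _ _ _ _ _ (fun x : R => - lne x%:E) _ (fun v => `|a - v| / A)%R).
  exact: measurable_neg_lne.
apply: measurable_funM; last exact: measurable_cst.
apply: measurableT_comp => //.
by apply: measurable_funB; [exact: measurable_cst|exact: measurable_id].
Qed.

Lemma neg_lneM (p q : R) : (0 <= p <= 1)%R -> (0 <= q <= 1)%R ->
  - lne (p * q)%:E = - lne p%:E - lne q%:E.
Proof.
move=> /andP[p0 p1] /andP[q0 q1].
have [p0'|p0'] := eqVneq p 0%R.
  rewrite p0' mul0r (le0_lneNy (x := 0%:E))//= addye//.
  by case: ifPn.
have [q0'|q0'] := eqVneq q 0%R.
  rewrite q0' mulr0 (le0_lneNy (x := 0%:E))//= addey//.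
  by case: ifPn.
have pp : (0 < p)%R by rewrite lt_neqAle eq_sym p0'.
have qp : (0 < q)%R by rewrite lt_neqAle eq_sym q0'.
rewrite !lne_EFin ?mulr_gt0// lnM ?posrE// -!EFinN -EFinD; congr EFin; ring.
Qed.

(** Since w_(t+1) x - w_(t+1) y = 2 lam (w_t x - w_t y) (w_t x + w_t y), the
    kernel at level t + 1 is the sum of the kernels at level t for y and for
    its mirror image. *)
Lemma logk_add A a v l : (0 < l)%R -> (`|v| <= 1)%R -> (`|a| + 1 <= A)%R ->
  (`|(1 + 2 * l * (a ^+ 2 - 1)) - (1 + 2 * l * (v ^+ 2 - 1))| <= 2 * l * A ^+ 2)%R ->
  logk A a v + logk A a (- v)%R =
  logk (2 * l * A ^+ 2) (1 + 2 * l * (a ^+ 2 - 1)) (1 + 2 * l * (v ^+ 2 - 1)).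
Proof.
move=> l0 v1 aA h.
have A0 : (0 < A)%R by have := normr_ge0 a; lra.
have b1 : (`|a - v| <= A)%R by apply: le_trans (ler_normB _ _) _; lra.
have b2 : (`|a - - v| <= A)%R by rewrite opprK; apply: le_trans (ler_normD _ _) _; lra.
rewrite !logkE//; last by rewrite !mulr_gt0// exprn_gt0.
rewrite -neg_lneM; last 2 first.
- by rewrite divr_ge0 ?(ltW A0)//= ler_pdivrMr// mul1r.
- by rewrite divr_ge0 ?(ltW A0)//= ler_pdivrMr// mul1r.
congr (- lne _%:E).
have -> : (1 + 2 * l * (a ^+ 2 - 1) - (1 + 2 * l * (v ^+ 2 - 1)) =
  2 * l * ((a - v) * (a - - v)))%R by ring.
rewrite !normrM normr_nat (gtr0_norm l0); field.
by rewrite !gt_eqF.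
Qed.

End LogKernel.

Section Potential.
Context {R : realType} (lam dl : nat -> R).
Hypothesis lam2 : forall s, (2 <= lam s)%R.
Hypothesis ln_lam : forall s, ln (lam s) = 2 ^+ s.+1 * (dl s - dl s.+1).
Hypothesis dl_cvg0 : dl @ \oo --> (0 : R).
Hypothesis dl_ge0 : forall s, 0 <= dl s.
Local Notation w := (w lam).
Local Notation Kreal := (Kreal lam).
Local Notation gam := (gamma_of lam).
Let lam_gt0 := lam_gt0 lam2.
Local Notation plane := (R * R)%type.
Local Open Scope ereal_scope.

Variable mu : probability plane R.
Hypothesis muK : mu (Kset gam) = 1.
Hypothesis musym : forall t (f : R -> \bar R), measurable_fun setT f ->
  (forall x, 0 <= f x) -> \int[mu]_z f (- w t z.1)%R = \int[mu]_z f (w t z.1).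

Lemma measurable_Kset : measurable (Kset gam).
Proof.
rewrite (KsetE lam2) (_ : mkset _ = (fst @^-1` Kreal) `&` (snd @^-1` [set 0%R]))//.
apply: measurableI; rewrite -[X in measurable X]setTI.
  by apply: measurable_fst => //; apply: closed_measurable; exact: closed_Kreal.
by apply: measurable_snd => //; exact: measurable_set1.
Qed.

Lemma measurable_w_fst t : measurable_fun setT (fun z : plane => w t z.1).
Proof. by apply: measurableT_comp; [exact: measurable_w|exact: measurable_fst]. Qed.

Lemma measurable_comp_w t (f : R -> \bar R) : measurable_fun setT f ->
  measurable_fun setT (fun z : plane => f (w t z.1)).
Proof. by move=> mf; apply: measurableT_comp => //; exact: measurable_w_fst. Qed.

Lemma le_integral_carried (f g : plane -> \bar R) :
  (forall z, 0 <= f z) -> (forall z, 0 <= g z) ->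
  measurable_fun setT f -> measurable_fun setT g ->
  (forall z, Kreal z.1 -> f z <= g z) -> \int[mu]_z f z <= \int[mu]_z g z.
Proof.
move=> f0 g0 mf mg fg; apply: ae_ge0_le_integral => //.
exists (~` Kset gam); split; first exact: measurableC measurable_Kset.
  by have := probability_setC mu measurable_Kset; rewrite muK subee// => h; exact: h.
move=> z /=; apply: contra_not; rewrite (KsetE lam2) => -[Kz _] _; exact: fg.
Qed.

(** Averaging over the two signs of w_t, by the symmetry of the measure. *)
Lemma integral_symmetrize t (f : R -> \bar R) : measurable_fun setT f ->
  (forall x, 0 <= f x) ->
  \int[mu]_z f (w t z.1) = 2^-1%:E * \int[mu]_z (f (w t z.1) + f (- w t z.1)%R).
Proof.
move=> mf f0; rewrite ge0_integralD//.
- by rewrite musym// half_double.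
- exact: measurable_comp_w.
- by apply: (@measurable_comp_w t (f \o -%R)); apply: measurableT_comp.
Qed.

(** Pairing each point with its mirror image halves the potential and moves it
    one level up. *)
Lemma potential_step A t x : (`|w t x| + 1 <= A)%R ->
  (`|w t.+1 x| + 1 <= 2 * lam t * A ^+ 2)%R ->
  \int[mu]_z logk A (w t x) (w t z.1) =
  2^-1%:E * \int[mu]_z logk (2 * lam t * A ^+ 2) (w t.+1 x) (w t.+1 z.1).
Proof.
move=> hA hA'; rewrite integral_symmetrize; [|exact: measurable_logk|move=> ?; exact: logk_ge0].
congr (_ * _); apply: (eq_integral_carried measurable_Kset muK).
- apply: emeasurable_funD; first exact: measurable_comp_w (measurable_logk _ _).
  by apply: (@measurable_comp_w t (logk A (w t x) \o -%R)); apply: measurableT_comp => //; exact: measurable_logk.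
- exact: measurable_comp_w (measurable_logk _ _).
rewrite (KsetE lam2) => z [Kz _]; rewrite (wS _ t x) (wS _ t z.1) (@logk_add _ A _ _ (lam t))//.
rewrite -!wS; apply: le_trans (ler_normB _ _) _; apply: le_trans hA'.
by rewrite lerD2l.
Qed.

Definition scale_at (A0 : R) (t : nat) : R := iteri t (fun s A => 2 * lam s * A ^+ 2)%R A0.

Lemma potential_iter A0 x T : (forall t, `|w t x| + 1 <= scale_at A0 t)%R ->
  \int[mu]_z logk A0 (w 0 x) (w 0 z.1) =
  (2^-1 ^+ T)%:E * \int[mu]_z logk (scale_at A0 T) (w T x) (w T z.1).
Proof.
move=> h; elim: T => [|T ->]; first by rewrite expr0 mul1e.
rewrite potential_step; [|exact: h|exact: h T.+1].
by rewrite muleA -EFinM -exprSr.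
Qed.

Lemma scale_at_gt0 A0 t : (0 < A0)%R -> (0 < scale_at A0 t)%R.
Proof. by move=> A00; elim: t => //= t IH; rewrite !mulr_gt0// exprn_gt0. Qed.

(** The product of the factors 2 lam s, each to the power 2^-(s+1), telescopes
    because lam was parametrised by differences of dl. *)
Lemma ln_scale_at A0 t : (0 < A0)%R ->
  (2^-1 ^+ t * ln (scale_at A0 t) = ln A0 + ln 2 * (1 - 2^-1 ^+ t) + dl 0%N - dl t)%R.
Proof.
move=> A00; elim: t => [|t IH]; first by rewrite /= expr0; ring.
have s0 := scale_at_gt0 t A00.
rewrite /= lnM ?posrE ?mulr_gt0 ?exprn_gt0// lnM ?posrE// ln_lam lnXn//.
have p : (2^-1 ^+ t.+1 * 2 ^+ t.+1 = 1 :> R)%R by rewrite -exprMn mulVf// expr1n.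
rewrite -/(scale_at A0 t) mulr2n; move: p IH; rewrite [(2^-1 ^+ t.+1)%R]exprS.
set u := (2^-1 ^+ t)%R; set P := (2 ^+ t.+1)%R; set X := ln (scale_at A0 t) => p IH.
transitivity (2^-1 * u * ln 2 + (2^-1 * u * P) * (dl t - dl t.+1) + u * X)%R; first by field.
by rewrite p IH; field.
Qed.

End Potential.

Section LogKernelBounds.
Context {R : realType}.
Local Open Scope ereal_scope.
Implicit Types (a v A B l : R).

Lemma logk_scale A B a v : (0 < A)%R -> (1 <= B)%R -> (`|a - v| <= A)%R ->
  logk (A * B) a v = logk A a v + (ln B)%:E.
Proof.
move=> A0 B1 h; have B0 : (0 < B)%R by apply: lt_le_trans B1.
rewrite !logkE ?mulr_gt0//; last by apply: le_trans h _; rewrite ler_peMr// ltW.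
have -> : (`|a - v| / (A * B) = (`|a - v| / A) * B^-1)%R by field; rewrite !gt_eqF.
rewrite neg_lneM.
- by rewrite lneV// oppeK; congr (_ + _); rewrite lne_EFin.
- by rewrite divr_ge0 ?(ltW A0)//= ler_pdivrMr// mul1r.
- by rewrite invr_ge0 (ltW B0)/= invf_le1.
Qed.

Lemma logk_ge A a v : (0 < A)%R -> (2 <= A)%R -> (`|a - v| <= 2)%R ->
  (ln A - ln 2)%:E <= logk A a v.
Proof.
move=> A0 A2 h; have -> : A = (2 * (A / 2))%R by field.
rewrite logk_scale//; last by lra.
rewrite lnM ?posrE ?divr_gt0// addrAC subrr add0r.
by rewrite -[leLHS]add0e leeD2r// logk_ge0.
Qed.

Lemma logk_le A a v e : (0 < e)%R -> (e <= `|a - v| <= A)%R ->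
  logk A a v <= (ln A - ln e)%:E.
Proof.
move=> e0 /andP[h1 h2]; have d0 : (0 < `|a - v|)%R by apply: lt_le_trans h1.
have A0 : (0 < A)%R by apply: lt_le_trans h2.
rewrite logkE// lne_EFin ?divr_gt0// ln_div ?posrE// -EFinN lee_fin.
have : (ln e <= ln `|a - v|)%R by rewrite ler_ln// posrE.
lra.
Qed.

Lemma min_addr_le (x : \bar R) (c M : R) : (0 <= c)%R ->
  mine (x + c%:E) M%:E <= mine x M%:E + c%:E.
Proof.
move=> c0; have [h|h] := leP x M%:E.
  by rewrite ge_min lexx.
by rewrite ge_min; apply/orP; right; rewrite leeDl.
Qed.

(** One of the two points v and - v is at distance at least 7 / 5 from a,
    where the kernel is bounded, and for the other the kernel exceeds its
    value one level up by at most ln (4 l). So truncation is compatible with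
    the pairing up to a constant. *)
Lemma truncated_logk_pair l a v (M : R) : (2 <= l)%R -> (0 <= M)%R ->
  (7 / 10 <= `|a| <= 1)%R -> (7 / 10 <= `|v| <= 1)%R ->
  (`|1 + 2 * l * (a ^+ 2 - 1)| <= 1)%R -> (`|1 + 2 * l * (v ^+ 2 - 1)| <= 1)%R ->
  mine (logk 2 a v) M%:E + mine (logk 2 a (- v)%R) M%:E <=
  mine (logk 2 (1 + 2 * l * (a ^+ 2 - 1)) (1 + 2 * l * (v ^+ 2 - 1))) M%:E +
  (2 * ln (4 * l))%:E.
Proof.
move=> l2 M0; wlog av : v / (0 < a * v)%R.
  move=> wl ha hv ha' hv'; have [av|av] := ltP 0%R (a * v)%R; first exact: wl.
  have := wl (- v)%R; rewrite opprK sqrrN normrN addeC; apply => //.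
  rewrite mulrN oppr_gt0 lt_neqAle av andbT mulf_eq0.
  by apply/negP => /orP[] /eqP h; move: ha hv; rewrite h normr0; lra.
move=> /andP[ha a1] /andP[hv v1] ha' hv'.
set a' := (1 + _)%R in ha' *; set v' := (1 + _)%R in hv' *.
have l0 : (0 < l)%R by lra.
have c1 : (1 <= 4 * l)%R by lra.
have c0 : (0 <= ln (4 * l))%R by apply: ln_ge0.
have d' : (`|a' - v'| <= 2)%R by apply: le_trans (ler_normB _ _) _; lra.
have sum : logk 2 a v + logk 2 a (- v)%R = logk 2 a' v' + (ln (4 * l))%:E.
  rewrite (logk_add (l := l))//; first last.
  - by apply: le_trans d' _; lra.
  - by lra.
  by rewrite -/a' -/v' (_ : 2 * l * 2 ^+ 2 = 2 * (4 * l))%R ?logk_scale//; ring.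
have far : logk 2 a (- v)%R <= (ln (4 * l))%:E.
  have h : (14 / 10 <= `|a - - v| <= 2)%R.
    apply/andP; split; last by rewrite opprK; apply: le_trans (ler_normD _ _) _; lra.
    rewrite opprK; have [a0|a0] := leP 0%R a.
      have v0 : (0 <= v)%R by nra.
      by move: ha hv; rewrite !ger0_norm ?addr_ge0//; lra.
    have v0 : (v <= 0)%R by nra.
    move: ha hv; rewrite (ltr0_norm a0) (ler0_norm v0) ler0_norm; lra.
  apply: (le_trans (logk_le (_ : 0 < 14 / 10)%R h)); first by lra.
  have h1 : (0 <= ln (14 / 10 : R))%R by apply: ln_ge0; lra.
  have h2 : (ln 2 <= ln (4 * l))%R by rewrite ler_ln ?posrE ?mulr_gt0//; lra.
  by rewrite lee_fin; lra.
have near : logk 2 a v <= logk 2 a' v' + (ln (4 * l))%:E.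
  by rewrite -sum leeDl// logk_ge0.
apply: (@le_trans _ _ (mine (logk 2 a' v' + (ln (4 * l))%:E) M%:E + (ln (4 * l))%:E)).
  apply: leeD; first by rewrite le_min !ge_min near lexx orbT.
  by rewrite ge_min far.
have -> : (2 * ln (4 * l) = ln (4 * l) + ln (4 * l))%R by ring.
rewrite EFinD addeA leeD2r//.
exact: min_addr_le.
Qed.

End LogKernelBounds.

Section PotentialValue.
Context {R : realType} (lam dl : nat -> R).
Hypothesis lam2 : forall s, (2 <= lam s)%R.
Hypothesis ln_lam : forall s, ln (lam s) = 2 ^+ s.+1 * (dl s - dl s.+1).
Hypothesis dl_cvg0 : dl @ \oo --> (0 : R).
Hypothesis dl_ge0 : forall s, 0 <= dl s.
Local Notation w := (w lam).
Local Notation Kreal := (Kreal lam).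
Local Notation gam := (gamma_of lam).
Let lam_gt0 := lam_gt0 lam2.
Local Notation plane := (R * R)%type.
Local Open Scope ereal_scope.

Variable mu : probability plane R.
Hypothesis muK : mu (Kset gam) = 1.
Hypothesis musym : forall t (f : R -> \bar R), measurable_fun setT f ->
  (forall x, 0 <= f x) -> \int[mu]_z f (- w t z.1)%R = \int[mu]_z f (w t z.1).

(** The value of the potential on K(gamma), that is, minus the logarithm of
    its capacity. *)
Definition robin : R := (ln 4 + dl 0%N)%R.

Lemma scale_at2_ge2 t : (2 <= scale_at lam 2 t)%R.
Proof.
elim: t => //= t IH; rewrite -/(scale_at lam 2 t); have := lam2 t.
set A := scale_at lam 2 t in IH *; nra.
Qed.

Lemma scales_negligible e : (0 < e)%R -> exists T, (4 * (2^-1 ^+ T * ln 4 + dl T) <= e)%R.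
Proof.
move=> e0.
have h : (4 * (2^-1 ^+ T * ln 4 + dl T))%R @[T --> \oo] --> (4 * (0 * ln 4 + 0) : R)%R.
  apply: cvgMr; apply: cvgD; last exact: dl_cvg0.
  by apply: cvgMl; apply: cvg_expr; rewrite ger0_norm// invf_lt1// ltr1n.
move: h; rewrite mul0r addr0 mulr0 => /cvgr_le/(_ _ e0)[T _ hT].
by exists T; exact: hT T (leqnn T).
Qed.

Lemma Kreal_diff_le2 t x y : Kreal x -> Kreal y -> (`|w t x - w t y| <= 2)%R.
Proof.
by move=> Kx Ky; apply: le_trans (ler_normB _ _) _; have := Kx t; have := Ky t; lra.
Qed.

Definition pot t x : \bar R := \int[mu]_z logk 2 (w t x) (w t z.1).

Lemma measurable_logk_w A t x : measurable_fun setT (fun z : plane => logk A (w t x) (w t z.1)).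
Proof. by apply: measurable_comp_w; exact: measurable_logk. Qed.

Lemma pot_scale x T : Kreal x -> pot 0 x =
  (2^-1 ^+ T)%:E * \int[mu]_z logk (scale_at lam 2 T) (w T x) (w T z.1).
Proof.
move=> Kx; apply: (potential_iter lam2 muK musym) => t.
by have := scale_at2_ge2 t; have := Kx t; lra.
Qed.

(** At a high level T the distances of points of the set are at most 2, which
    bounds the kernel from below by the logarithm of the scale. *)
Lemma pot_lower x : Kreal x -> robin%:E <= pot 0 x.
Proof.
move=> Kx; apply/lee_addgt0Pr => e e0; have [T hT] := scales_negligible e0.
rewrite (pot_scale T Kx).
have A0 : (0 < scale_at lam 2 T)%R by apply: scale_at_gt0.
have hl : (ln (scale_at lam 2 T) - ln 2)%:E <=
    \int[mu]_z logk (scale_at lam 2 T) (w T x) (w T z.1).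
  rewrite -[leLHS]mule1 -(probability_setT mu) -integral_cst//.
  apply: (le_integral_carried lam2 muK).
  - by move=> z; rewrite lee_fin subr_ge0 ler_ln ?posrE// scale_at2_ge2.
  - by move=> z; exact: logk_ge0.
  - exact: measurable_cst.
  - exact: measurable_logk_w.
  - by move=> z Kz; apply: logk_ge; rewrite ?scale_at2_ge2 ?Kreal_diff_le2.
apply: (@le_trans _ _ ((2^-1 ^+ T * (ln (scale_at lam 2 T) - ln 2)) + e)%:E); last first.
  by rewrite EFinD leeD2r// EFinM lee_pmul2l// lte_fin exprn_gt0.
rewrite lee_fin mulrBr (ln_scale_at lam2 ln_lam T)// /robin.
have l4 : (ln 4 = ln 2 + ln 2 :> R)%R by rewrite -lnM ?posrE// -natrM.
move: hT; rewrite l4; have := dl_ge0 T; have : (0 < ln 2 :> R)%R by rewrite ln_gt0// ltr1n.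
have : (0 <= 2^-1 ^+ T :> R)%R by rewrite exprn_ge0.
set u := (2^-1 ^+ T)%R; nra.
Qed.

Lemma measurable_trunc (M : R) t x : measurable_fun setT (fun z : plane => mine (logk 2 (w t x) (w t z.1)) M%:E).
Proof. by apply: measurable_mine; [exact: measurable_logk_w|exact: measurable_cst]. Qed.

(** Induction on the number k of levels: each step halves the influence of the
    truncation height M, and the additive constants sum up, by telescoping, to
    the last summand. *)
Lemma truncated_pot_le k t x M : Kreal x -> (0 <= M)%R ->
  \int[mu]_z mine (logk 2 (w t x) (w t z.1)) M%:E <=
  (2^-1 ^+ k * M + 2 * (ln 4 + 2 ^+ t * dl t))%:E.
Proof.
move=> Kx M0; have l40 : (0 <= ln 4 :> R)%R by apply: ln_ge0; rewrite ler1n.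
have nneg s (z : plane) : 0 <= mine (logk 2 (w s x) (w s z.1)) M%:E.
  by rewrite le_min logk_ge0 lee_fin.
elim: k t => [|k IH] t.
  apply: (@le_trans _ _ (\int[mu]_z cst M%:E z)).
    apply: ge0_le_integral => //; first exact: measurable_trunc.
    by move=> z _; rewrite ge_min lexx orbT.
  rewrite integral_cst// (_ : _ setT = 1) ?mule1; last exact: probability_setT.
  by rewrite lee_fin expr0 mul1r lerDl mulr_ge0// addr_ge0// mulr_ge0// exprn_ge0.
have m2 : measurable_fun setT (fun v : R => mine (logk 2 (w t x) v) M%:E).
  by apply: measurable_mine; [exact: measurable_logk|exact: measurable_cst].
rewrite (@integral_symmetrize _ lam mu musym t (fun v => mine (logk 2 (w t x) v) M%:E))//; last first.
  by move=> v; rewrite le_min logk_ge0 lee_fin.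
have lb : (0 <= 2 * ln (4 * lam t))%R.
  by rewrite mulr_ge0// ln_ge0//; have := lam2 t; lra.
apply: (@le_trans _ _ (2^-1%:E * (\int[mu]_z mine (logk 2 (w t.+1 x) (w t.+1 z.1)) M%:E
    + (2 * ln (4 * lam t))%:E))).
  apply: lee_wpmul2l => //.
  have -> : (2 * ln (4 * lam t))%:E = \int[mu]_z (cst (2 * ln (4 * lam t))%:E z).
    by rewrite integral_cst// (_ : _ setT = 1) ?mule1//; exact: probability_setT.
  rewrite -ge0_integralD//; last exact: measurable_trunc.
  apply: (le_integral_carried lam2 muK).
  - by move=> z; rewrite adde_ge0// le_min logk_ge0 lee_fin.
  - by move=> z; rewrite adde_ge0// lee_fin.
  - apply: emeasurable_funD; first exact: measurable_trunc.
    by apply: (@measurable_comp_w _ _ t ((fun v => mine (logk 2 (w t x) v) M%:E) \o -%R)); apply: measurableT_comp.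
  - by apply: emeasurable_funD; [exact: measurable_trunc|exact: measurable_cst].
  - move=> z Kz; have := truncated_logk_pair (lam2 t) M0 (a := w t x) (v := w t z.1).
    rewrite -!wS; apply; rewrite ?(Kx t.+1) ?(Kz t.+1)//.
      by rewrite (Kreal_abs_ge lam2 t Kx) (Kx t).
    by rewrite (Kreal_abs_ge lam2 t Kz) (Kz t).
apply: (@le_trans _ _ (2^-1%:E * ((2^-1 ^+ k * M + 2 * (ln 4 + 2 ^+ t.+1 * dl t.+1))%:E
    + (2 * ln (4 * lam t))%:E))).
  by apply: lee_wpmul2l => //; rewrite leeD2r// IH.
rewrite -EFinD -EFinM lee_fin lnM ?posrE// ln_lam [(2^-1 ^+ k.+1)%R]exprS [(2 ^+ t.+1)%R]exprS.
by rewrite le_eqVlt; apply/orP; left; apply/eqP; field.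
Qed.

(** Let k and then M go to infinity in the truncated bound. *)
Lemma pot_upper_tail t x : Kreal x -> pot t x <= (2 * (ln 4 + 2 ^+ t * dl t))%:E.
Proof.
move=> Kx; set B := (2 * _)%R.
have b M : (0 <= M)%R -> \int[mu]_z mine (logk 2 (w t x) (w t z.1)) M%:E <= B%:E.
  move=> M0; apply/lee_addgt0Pr => e e0.
  have : (2^-1 ^+ k * M)%R @[k --> \oo] --> (0 * M : R)%R.
    by apply: cvgMl; apply: cvg_expr; rewrite ger0_norm// invf_lt1// ltr1n.
  rewrite mul0r => /cvgr_le/(_ _ e0)[k _ /(_ k (leqnn k)) hk].
  apply: le_trans (truncated_pot_le k t Kx M0) _; rewrite -EFinD lee_fin addrC.
  by rewrite lerD2l.
pose g n (z : plane) := mine (logk 2 (w t x) (w t z.1)) n%:R%:E.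
have lim (z : plane) : g n z @[n --> \oo] --> logk 2 (w t x) (w t z.1).
  rewrite /g; have := logk_ge0 2 (w t x) (w t z.1).
  case: (logk _ _ _) => [r| |//] r0.
    apply: cvg_near_cst; exists (Num.bound r) => // n /= hn.
    rewrite min_l// lee_fin; apply: le_trans (ltW (archi_boundP r0)) _.
    by rewrite ler_nat.
  rewrite (_ : (fun n => _) = (fun n => (n%:R : R)%:E)); last first.
    by apply/funext => n; rewrite min_r// leey.
  by apply/cvgenyP; exact: cvg_id.
have -> : pot t x = limn (fun n => \int[mu]_z g n z).
  rewrite -monotone_convergence//.
  - by apply: eq_integral => z _; apply/esym/cvg_lim => //; exact: lim.
  - by move=> n; exact: measurable_trunc.
  - by move=> n z _; rewrite /g le_min logk_ge0 lee_fin ler0n.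
  - move=> z _ n m nm; rewrite /g le_min !ge_min lexx/= lee_fin ler_nat nm.
    by rewrite orbT.
apply: lime_le; last by near=> n; exact: b.
apply: ereal_nondecreasing_is_cvgn => n m nm; apply: ge0_le_integral => //.
- by move=> z _; rewrite /g le_min logk_ge0 lee_fin ler0n.
- exact: measurable_trunc.
- exact: measurable_trunc.
- move=> z _; rewrite /g le_min !ge_min lexx/= lee_fin ler_nat nm.
  by rewrite orbT.
Unshelve. all: by end_near. Qed.

Lemma pot_upper x : Kreal x -> pot 0 x <= robin%:E.
Proof.
move=> Kx; apply/lee_addgt0Pr => e e0; have [T hT] := scales_negligible e0.
rewrite (pot_scale T Kx).
have A0 : (0 < scale_at lam 2 T)%R by apply: scale_at_gt0.
have lA : (0 <= ln (scale_at lam 2 T) - ln 2)%R.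
  by rewrite subr_ge0 ler_ln ?posrE// scale_at2_ge2.
have hl : \int[mu]_z logk (scale_at lam 2 T) (w T x) (w T z.1) <=
    pot T x + (ln (scale_at lam 2 T) - ln 2)%:E.
  have -> : (ln (scale_at lam 2 T) - ln 2)%:E = \int[mu]_z (cst (ln (scale_at lam 2 T) - ln 2)%:E z).
    by rewrite integral_cst// (_ : _ setT = 1) ?mule1//; exact: probability_setT.
  rewrite /pot -ge0_integralD//; [|by move=> z _; exact: logk_ge0|exact: measurable_logk_w].
  apply: (le_integral_carried lam2 muK).
  - by move=> z; exact: logk_ge0.
  - by move=> z; rewrite adde_ge0 ?logk_ge0.
  - exact: measurable_logk_w.
  - by apply: emeasurable_funD; [exact: measurable_logk_w|exact: measurable_cst].
  - move=> z Kz; rewrite -[X in logk X _ _ <= _](_ : 2 * (scale_at lam 2 T / 2) = _)%R; last by field.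
    rewrite logk_scale// ?Kreal_diff_le2//; last by have := scale_at2_ge2 T; lra.
    by rewrite ln_div ?posrE//.
have u0 : (0 < 2^-1 ^+ T :> R)%R by rewrite exprn_gt0.
apply: (@le_trans _ _ ((2^-1 ^+ T)%:E * ((2 * (ln 4 + 2 ^+ T * dl T))%:E +
    (ln (scale_at lam 2 T) - ln 2)%:E))).
  rewrite lee_pmul2l ?lte_fin//.
  by apply: le_trans hl _; rewrite leeD2r// pot_upper_tail.
rewrite -!EFinD -EFinM lee_fin !mulrDr mulrN (ln_scale_at lam2 ln_lam T)// /robin.
have l4 : (ln 4 = ln 2 + ln 2 :> R)%R by rewrite -lnM ?posrE// -natrM.
have p : (2^-1 ^+ T * 2 ^+ T = 1 :> R)%R by rewrite -exprMn mulVf// expr1n.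
have : (0 < ln 2 :> R)%R by rewrite ln_gt0// ltr1n.
move: hT; rewrite l4 [(2^-1 ^+ T * (2 * (2 ^+ T * dl T)))%R](_ : _ = 2 * (2^-1 ^+ T * 2 ^+ T) * dl T)%R; last by ring.
rewrite p; have := dl_ge0 T.
set u := (2^-1 ^+ T)%R in u0 *; nra.
Qed.

(** The potential is constant on the whole set, not only quasi-everywhere,
    because the bounds from above and below hold at each point. *)
Lemma log_potential_on x : Kreal x ->
  \int[mu]_v - lne (cdist (x, 0%R) v)%:E = robin%:E.
Proof.
move=> Kx; transitivity (pot 0 x); last by apply/eqP; rewrite eq_le pot_upper ?pot_lower.
apply: (eq_integral_carried (measurable_Kset lam2) muK).
- exact: (@measurable_fun_pair2 _ _ _ plane plane _ _ (x, 0%R) measurable_log_kernel).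
- exact: measurable_logk_w.
rewrite (KsetE lam2) => z [Kz z2]; rewrite logkE ?Kreal_diff_le2//.
rewrite cdist_real//= !w0 (_ : 2 * x - 1 - (2 * z.1 - 1) = 2 * (x - z.1))%R; last by ring.
by rewrite normrM normr_nat mulrC mulKf.
Qed.

End PotentialValue.

(** * Capacity, equilibrium measure and Green function *)

Section Equilibrium.
Context {R : realType} (lam dl : nat -> R).
Hypothesis lam2 : forall s, (2 <= lam s)%R.
Hypothesis ln_lam : forall s, ln (lam s) = 2 ^+ s.+1 * (dl s - dl s.+1).
Hypothesis dl_cvg0 : dl @ \oo --> (0 : R).
Hypothesis dl_ge0 : forall s, 0 <= dl s.
Local Notation w := (w lam).
Local Notation Kreal := (Kreal lam).
Local Notation gam := (gamma_of lam).
Local Notation K := (Kset gam).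
Let lam_gt0 := lam_gt0 lam2.
Local Notation plane := (R * R)%type.
Local Open Scope ereal_scope.

Lemma carried_unit_segment (nu : probability plane R) : nu K = 1 -> nu (@unit_segment R) = 1.
Proof.
move=> h; apply/eqP; rewrite eq_le probability_le1; last exact: measurable_unit_segment.
rewrite -h; apply: le_measure; rewrite ?inE.
- exact: measurable_Kset lam2.
- exact: measurable_unit_segment.
- exact: Kset_unit_segment lam2.
Qed.

Section WithMeasure.
Variable mu : probability plane R.
Hypothesis muK : mu K = 1.
Hypothesis musym : forall t (f : R -> \bar R), measurable_fun setT f ->
  (forall x, 0 <= f x) -> \int[mu]_z f (- w t z.1)%R = \int[mu]_z f (w t z.1).

Lemma mutual_energy_robin (nu : probability plane R) : nu K = 1 ->
  mutual_energy nu mu = (robin dl)%:E.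
Proof.
move=> nuK; transitivity (\int[nu]_z (cst (robin dl)%:E z)); last first.
  by rewrite integral_cst// (_ : _ setT = 1) ?mule1//; exact: probability_setT.
apply: (eq_integral_carried (measurable_Kset lam2) nuK).
- exact: (measurable_integral_param mu measurable_log_kernel).
- exact: measurable_cst.
rewrite (KsetE lam2) => -[x y] [/= Kx ->].
exact: (log_potential_on lam2 ln_lam dl_cvg0 dl_ge0 muK musym Kx).
Qed.

Lemma window_defect_ge0 (m1 m2 : probability plane R) : 0 <= window_defect m1 m2.
Proof. by apply: integral_ge0 => u _; rewrite lee_fin sqr_ge0. Qed.

(** The mutual energy of nu and mu is the constant potential integrated
    against nu; then polarisation compares the energy of nu with that of mu.
    *)
Lemma energy_ge_robin (nu : probability plane R) : nu K = 1 ->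
  (robin dl)%:E + window_defect nu mu <= energy nu.
Proof.
move=> nuK; have := mutual_energy_polarization (carried_unit_segment nuK) (carried_unit_segment muK).
rewrite !mutual_energy_robin// -/(energy nu) addeAC.
by rewrite leeD2rE.
Qed.

Lemma energy_robin : energy mu = (robin dl)%:E.
Proof. exact: mutual_energy_robin. Qed.

(** A second minimiser has zero window defect. Uniqueness matters because the
    Green function is defined from some equilibrium measure that is picked by
    choice. *)
Lemma equilibrium_unique (nu : probability plane R) :
  is_equilibrium_measure K nu -> forall A, measurable A -> nu A = mu A.
Proof.
move=> [nuK numin]; apply: measure_eq_of_defect; try exact: carried_unit_segment.
have h := energy_ge_robin nuK.
have d0 : window_defect nu mu <= 0.
  rewrite -(@leeD2lE _ (robin dl)%:E)// adde0; apply: (le_trans h).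
  by rewrite -energy_robin; exact: numin.
by apply/eqP; rewrite eq_le d0 window_defect_ge0.
Qed.

Lemma equilibrium_exists : is_equilibrium_measure K mu.
Proof.
split=> // nu nuK; rewrite energy_robin; apply: le_trans (energy_ge_robin nuK).
by rewrite leeDl// window_defect_ge0.
Qed.

Lemma CapE : Cap K = expR (- robin dl).
Proof.
rewrite /Cap (_ : ereal_inf _ = (robin dl)%:E) -?EFinN//.
apply/eqP; rewrite eq_le; apply/andP; split.
  by apply: ereal_inf_lbound; exists mu => //; exact: energy_robin.
apply: le_ereal_inf_tmp => _ [nu nuK <-]; apply: le_trans (energy_ge_robin nuK).
by rewrite leeDl// window_defect_ge0.
Qed.

Lemma green_measure x : green K (x, 0%R) =
  (robin dl + fine (\int[mu]_v lne (cdist (x, 0%R) v)%:E))%R.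
Proof.
rewrite /green CapE expRK opprK; congr (_ + fine _)%R.
apply: eq_measure_integral => A mA _; apply: equilibrium_unique => //.
rewrite /equilibrium_measure; case: xgetP => [nu _ //|/(_ mu)].
by case; exact: equilibrium_exists.
Qed.

Lemma scale_at_ge x t : (`|w t x| + 2 <= scale_at lam (`|w 0 x| + 2) t)%R.
Proof.
elim: t => [|t IH] //=; rewrite -/(scale_at lam _ t) wS.
set A := scale_at _ _ t in IH *; have l2 := lam2 t.
have h1 : (`|1 + 2 * lam t * (w t x ^+ 2 - 1)| <= 1 + 2 * lam t * (w t x ^+ 2 + 1))%R.
  have := sqr_ge0 (w t x); rewrite ler_norml => a2; apply/andP; split; nra.
have h2 : (w t x ^+ 2 + 4 <= A ^+ 2)%R.
  rewrite -[(w t x ^+ 2)%R]real_normK ?num_real//.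
  by have := normr_ge0 (w t x); nra.
apply: (@le_trans _ _ (2 * lam t * (w t x ^+ 2 + 4))%R); last first.
  by rewrite ler_pM2l// mulr_gt0.
by have := sqr_ge0 (w t x); nra.
Qed.

(** The two distances multiply to |a^2 - v^2|, which is at least a^2 - 1. *)
Lemma logk_pair_le (A a v : R) : (1 < `|a|)%R -> (`|v| <= 1)%R -> (`|a| + 1 <= A)%R ->
  logk A a v + logk A a (- v)%R <= (2 * ln A - ln (a ^+ 2 - 1))%:E.
Proof.
move=> a1 v1 aA.
have h (v' : R) : (`|v'| <= 1)%R -> (0 < `|a - v'| <= A)%R.
  move=> v'1; apply/andP; split; last by apply: le_trans (ler_normB _ _) _; lra.
  by have := lerB_dist a v'; lra.
have hN : (`|- v| <= 1)%R by rewrite normrN.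
have /andP[p1 q1] := h _ v1; have /andP[p2 q2] := h _ hN.
have A0 : (0 < A)%R by lra.
have a21 : (1 < a ^+ 2)%R by rewrite -[(a ^+ 2)%R]real_normK ?num_real// expr_gt1.
have v21 : (v ^+ 2 <= 1)%R by rewrite -[(v ^+ 2)%R]real_normK ?num_real// expr_le1.
apply: (@le_trans _ _ ((ln A - ln `|a - v|) + (ln A - ln `|a - - v|))%:E).
  rewrite EFinD; apply: leeD; apply: logk_le => //; by rewrite lexx.
have e : (ln `|a - v| + ln `|a - - v| = ln (a ^+ 2 - v ^+ 2))%R.
  rewrite -lnM ?posrE// -normrM (_ : (a - v) * (a - - v) = a ^+ 2 - v ^+ 2)%R; last by ring.
  by rewrite ger0_norm//; lra.
have : (ln (a ^+ 2 - 1) <= ln (a ^+ 2 - v ^+ 2))%R by rewrite ler_ln ?posrE; lra.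
by rewrite lee_fin; lra.
Qed.

(** Move the potential of x up to level t, where |w_t x| > 1, and pair the
    mirror images. In the limit of large w_t the bound reads 2^t g >= ln |2
    w_t x| + 2^t dl t: the summand 2^t dl t is the excess over the growth of
    the polynomial w_t, and it is the source of large Widom factors. *)
Lemma green_lower t (x : R) : (1 < `|w t x|)%R ->
  ((2^-1 ^+ t * (ln (w t x ^+ 2 - 1) / 2 + ln 2) + dl t) <= green K (x, 0))%R.
Proof.
move=> w1; pose A0 := (`|w 0 x| + 2)%R.
have A00 : (0 < A0)%R by rewrite /A0; have := normr_ge0 (w 0 x); lra.
have sc s : (`|w s x| + 1 <= scale_at lam A0 s)%R by have := scale_at_ge x s; rewrite -/A0; lra.
set At := scale_at lam A0 t.
have F0 : \int[mu]_z logk A0 (w 0 x) (w 0 z.1) <=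
    (2^-1 ^+ t * (ln At - ln (w t x ^+ 2 - 1) / 2))%:E.
  rewrite (potential_iter lam2 muK musym t sc) EFinM lee_pmul2l ?lte_fin ?exprn_gt0//.
  rewrite (@integral_symmetrize _ lam mu musym t (logk At (w t x)) (measurable_logk _ _) (logk_ge0 _ _)).
  have c0 : (0 <= 2 * ln At - ln (w t x ^+ 2 - 1))%R.
    have a0 := sc t; rewrite -/At in a0; have n0 := normr_ge0 (w t x).
    have a2 : (1 < w t x ^+ 2)%R by rewrite -[(w t x ^+ 2)%R]real_normK ?num_real// expr_gt1.
    have h : (w t x ^+ 2 - 1 <= At * At)%R.
      by rewrite -[(w t x ^+ 2)%R]real_normK ?num_real//; nra.
    have At0 : (0 < At)%R by lra.
    rewrite subr_ge0 (_ : 2 * ln At = ln (At * At))%R; last by rewrite lnM ?posrE//; ring.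
    by rewrite ler_ln ?posrE ?mulr_gt0//; lra.
  apply: (@le_trans _ _ (2^-1%:E * \int[mu]_z (cst (2 * ln At - ln (w t x ^+ 2 - 1))%:E z))); last first.
    rewrite integral_cst// (_ : _ setT = 1) ?mule1; last exact: probability_setT.
    by rewrite -EFinM lee_fin; lra.
  apply: lee_wpmul2l => //; apply: (le_integral_carried lam2 muK).
  - by move=> z; rewrite adde_ge0 ?logk_ge0.
  - by move=> z; rewrite lee_fin.
  - apply: emeasurable_funD; first exact: measurable_logk_w.
    by apply: (@measurable_comp_w _ _ t (logk At (w t x) \o -%R)); apply: measurableT_comp => //; exact: measurable_logk.
  - exact: measurable_cst.
  - by move=> z Kz; apply: logk_pair_le.
have mk := @measurable_logk_w _ lam A0 0 x.
have kge z : 0 <= logk A0 (w 0 x) (w 0 z.1) by exact: logk_ge0.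
have F0fin : \int[mu]_z logk A0 (w 0 x) (w 0 z.1) \is a fin_num.
  rewrite ge0_fin_numE; last by apply: integral_ge0 => z _; exact: kge.
  by apply: le_lt_trans F0 _; exact: ltry.
have int_k : mu.-integrable setT (fun z => logk A0 (w 0 x) (w 0 z.1)).
  apply/integrableP; split=> //; under eq_integral do rewrite gee0_abs//.
  by rewrite -ge0_fin_numE// integral_ge0.
have int_c : mu.-integrable setT (EFin \o cst (ln (A0 / 2))%R).
  exact: finite_measure_integrable_cst.
have mcd : measurable_fun setT (fun v : plane => lne (cdist (x, 0%R) v)%:E).
  have h := @measurable_fun_pair2 _ _ _ plane plane _ _ (x, 0%R) measurable_log_kernel.
  have hN : measurable_fun setT (fun v : plane => - - lne (cdist (x, 0%R) v)%:E).
    by apply: measurableT_comp => //; exact: h.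
  by apply: eq_measurable_fun hN => v _; rewrite oppeK.
rewrite green_measure.
have -> : \int[mu]_v lne (cdist (x, 0%R) v)%:E =
    (ln (A0 / 2))%:E - \int[mu]_z logk A0 (w 0 x) (w 0 z.1).
  transitivity (\int[mu]_z ((EFin \o cst (ln (A0 / 2))%R) z - logk A0 (w 0 x) (w 0 z.1))).
    apply: (eq_integral_carried (measurable_Kset lam2) muK) => //.
      apply: emeasurable_funB; last exact: mk.
      exact: (@measurable_cst _ _ _ _ setT (ln (A0 / 2))%:E).
    rewrite (KsetE lam2) => z [Kz z2].
    rewrite [(EFin \o cst _) z]/=.
    have d0 : (0 < `|x - z.1|)%R.
      rewrite normr_gt0 subr_eq0; apply/negP => /eqP xz.
      by have := Kz t; rewrite -xz leNgt w1.
    have dE : (`|w 0 x - w 0 z.1| = 2 * `|x - z.1|)%R.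
      rewrite !w0 (_ : 2 * x - 1 - (2 * z.1 - 1) = 2 * (x - z.1))%R; last by ring.
      by rewrite normrM normr_nat.
    rewrite cdist_real// logkE ?dE//; last first.
      by rewrite -dE; apply: le_trans (ler_normB _ _) _; have := Kz 0%N; rewrite /A0; lra.
    rewrite !lne_EFin ?divr_gt0 ?mulr_gt0// -EFinN -EFinB. congr EFin.
    by rewrite !ln_div ?posrE ?mulr_gt0// lnM ?posrE//; ring.
  rewrite integralB//; congr (_ - _).
  transitivity (\int[mu]_z (cst (ln (A0 / 2))%:E z)) => //.
  by rewrite integral_cst// (_ : _ setT = 1) ?mule1//; exact: probability_setT.
rewrite fineB//=; move: F0; rewrite -{1}(fineK F0fin) lee_fin /robin.
set F := fine _; rewrite !mulrDr !mulrN (ln_scale_at lam2 ln_lam t A00) ln_div ?posrE//.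
have -> : (ln 4 = ln 2 + ln 2 :> R)%R by rewrite -lnM ?posrE// -natrM.
by set u := (2^-1 ^+ t)%R; lra.
Qed.

End WithMeasure.
End Equilibrium.

(** * Interpolation at the endpoints of the intervals *)

Section Interpolation.
Context {F : fieldType}.
Implicit Types (xs : seq F) (a b x : F) (Q : {poly F}).

Definition nodal xs a : {poly F} := \prod_(b <- xs | b != a) ('X - b%:P).

Lemma nodal_self xs a : (nodal xs a).[a] != 0.
Proof.
rewrite horner_prod prodf_seq_neq0; apply/allP => b _; apply/implyP => ba.
by rewrite hornerXsubC subr_eq0 eq_sym.
Qed.

Lemma nodal_other xs a b : b \in xs -> b != a -> (nodal xs a).[b] = 0.
Proof.
move=> bxs ba; apply/eqP; rewrite horner_prod prodf_seq_eq0; apply/hasP.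
by exists b => //; rewrite ba hornerXsubC subrr eqxx.
Qed.

Lemma prod_nodal xs a : uniq xs -> a \in xs ->
  \prod_(b <- xs) ('X - b%:P) = ('X - a%:P) * nodal xs a.
Proof. by move=> us axs; rewrite (bigD1_seq a). Qed.

Lemma size_nodal xs a : uniq xs -> a \in xs -> size (nodal xs a) = size xs.
Proof.
move=> us axs; have := size_prod_XsubC xs id; rewrite (prod_nodal us axs).
have n0 : nodal xs a != 0.
  by apply/negP => /eqP h; have := nodal_self xs a; rewrite h horner0 eqxx.
by rewrite size_monicM ?monicXsubC// size_XsubC /= => -[].
Qed.

Lemma interpolation xs Q : uniq xs -> (size Q <= size xs)%N ->
  Q = \sum_(a <- xs) (Q.[a] / (nodal xs a).[a]) *: nodal xs a.
Proof.
move=> us sQ; apply/eqP; rewrite -subr_eq0; set L := \sum_(_ <- _) _.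
apply/negPn/negP => h.
have : (size (Q - L)%R <= size xs)%N.
  apply: (leq_trans (size_polyD _ _)); rewrite size_polyN geq_max sQ /=.
  rewrite /L big_seq; elim/big_ind: _ => [|p q hp hq|a axs].
  - by rewrite size_poly0.
  - by apply: (leq_trans (size_polyD _ _)); rewrite geq_max hp.
  - by apply: (leq_trans (size_scale_leq _ _)); rewrite size_nodal.
rewrite leqNgt => /negP; apply; apply: max_poly_roots => //.
apply/allP => a axs; rewrite /root hornerD hornerN /L horner_sum.
rewrite (bigD1_seq a)//= hornerZ divfK ?nodal_self// big_seq_cond big1 ?addr0 ?subrr//.
move=> b /andP[bxs ba]; rewrite hornerZ [X in _ * X]nodal_other ?mulr0// eq_sym//.
Qed.

Lemma interpolation_at xs Q x : uniq xs -> (size Q <= size xs)%N ->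
  Q.[x] = \sum_(a <- xs) Q.[a] * ((nodal xs a).[x] / (nodal xs a).[a]).
Proof.
move=> us sQ; rewrite {1}(interpolation us sQ) horner_sum; apply: eq_bigr => a _.
by rewrite hornerZ mulrAC -mulrA.
Qed.

End Interpolation.

Section Endpoints.
Context {R : realType} (lam : nat -> R).
Hypothesis lam2 : forall s, 2 <= lam s.
Local Notation w := (w lam).
Local Notation wpol := (wpol lam).
Local Notation Kreal := (Kreal lam).
Let lam_gt0 := lam_gt0 lam2.

(** The endpoints of the 2^t intervals at level t. They are twice as many as
    the degree of w_t, which leaves room for a factor of degree up to 2^t - 1
    in the interpolation. *)
Definition endpoints t : seq R := fib lam t 1 ++ fib lam t (-1).

Lemma endpoints_w t a : a \in endpoints t -> w t a ^+ 2 = 1.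
Proof.
rewrite mem_cat => /orP[] /(wE_fib lam2) ->; rewrite ?normrN ?normr1//.
  by rewrite expr1n.
by rewrite sqrrN expr1n.
Qed.

Lemma endpoints_Kreal t a : a \in endpoints t -> Kreal a.
Proof.
move=> /endpoints_w h; apply: (w_one_Kreal lam2 (t := t)).
by move/eqP: h; rewrite sqrf_eq1 => /orP[] /eqP ->; rewrite ?normrN normr1.
Qed.

Lemma endpoints_uniq t : uniq (endpoints t).
Proof.
have n1 : `|1 : R| <= 1 by rewrite normr1.
have n2 : `|-1 : R| <= 1 by rewrite normrN normr1.
rewrite cat_uniq !(fib_uniq lam2)// andbT /=; apply/hasPn => a /(wE_fib lam2 _ _ n2) e.
apply/negP => /(wE_fib lam2 _ _ n1); rewrite e; lra.
Qed.

Lemma size_endpoints t : size (endpoints t) = (2 * 2 ^ t)%N.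
Proof. by rewrite size_cat !size_fib addnn -mul2n. Qed.

Lemma endpoints_prod t : wpol t ^+ 2 - 1 =
  (wlead lam t ^+ 2) *: \prod_(a <- endpoints t) ('X - a%:P).
Proof.
have n1 : `|1 : R| <= 1 by rewrite normr1.
have n2 : `|-1 : R| <= 1 by rewrite normrN normr1.
rewrite big_cat /= -[X in _ - X](expr1n _ 2) subr_sqr.
rewrite expr2 -scalerA scalerAl scalerAr -!(wpol_fib lam2)//.
by rewrite polyC1 polyCN polyC1 opprK.
Qed.

Lemma size_wpol t : size (wpol t) = (2 ^ t).+1.
Proof.
have n0 : `|0 : R| <= 1 by rewrite normr0.
have := wpol_fib lam2 t n0; rewrite polyC0 subr0 => ->.
rewrite size_scale ?gt_eqF ?(wlead_gt0 lam2)//.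
by rewrite size_prod_XsubC size_fib.
Qed.

(** The nodal polynomial of the endpoints is w_t^2 - 1 up to a constant, so
    its derivative at an endpoint is 2 w_t w_t'. *)
Lemma endpoint_weight t a x : a \in endpoints t -> x != a ->
  (nodal (endpoints t) a).[x] / (nodal (endpoints t) a).[a] =
  (w t x ^+ 2 - 1) / (2 * w t a * (wpol t)^`().[a] * (x - a)) /\
  (wpol t)^`().[a] != 0.
Proof.
move=> ae xa; have us := endpoints_uniq t.
set n := nodal _ _; have na : n.[a] != 0 := nodal_self _ _.
have l0 : wlead lam t != 0 by rewrite gt_eqF ?(wlead_gt0 lam2).
have e := endpoints_prod t; rewrite (prod_nodal us ae) -/n in e.
have ex : w t x ^+ 2 - 1 = wlead lam t ^+ 2 * ((x - a) * n.[x]).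
  by have := congr1 (fun p : {poly R} => p.[x]) e; rewrite !hornerE -/(w t x).
have ed : 2 * w t a * (wpol t)^`().[a] = wlead lam t ^+ 2 * n.[a].
  have := congr1 (fun p : {poly R} => p^`().[a]) e.
  rewrite derivB derivC subr0 expr2 derivM derivZ derivM derivB derivX derivC subr0 mul1r.
  by rewrite !hornerE subrr mul0r addr0 -/(w t a) => <-; ring.
have wa : w t a != 0.
  by apply/negP => /eqP h; have := endpoints_w ae; rewrite h expr0n /= => /eqP; rewrite eq_sym oner_eq0.
have da : (wpol t)^`().[a] != 0.
  apply/negP => /eqP h; move: ed; rewrite h mulr0 => /esym/eqP.
  by rewrite mulf_eq0 (negbTE na) orbF expf_eq0 (negbTE l0) andbF.
split=> //; rewrite ex ed; field.
by rewrite na l0 subr_eq0 xa.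
Qed.

End Endpoints.

Section EndpointBounds.
Context {R : realType} (lam : nat -> R).
Hypothesis lam2 : forall s, 2 <= lam s.
Local Notation w := (w lam).
Local Notation wpol := (wpol lam).
Local Notation Kreal := (Kreal lam).
Let lam_gt0 := lam_gt0 lam2.

Lemma size_deriv_wpol t : (size (wpol t)^`() <= 2 ^ t)%N.
Proof.
have h : wpol t != 0 by rewrite -size_poly_gt0 (size_wpol lam2).
by have := lt_size_deriv h; rewrite (size_wpol lam2).
Qed.

(** Lagrange interpolation of Q S at the endpoints, where S is a divisor of
    w_t': the values of S cancel against the derivative in the weights, so
    only the values of Q on the limit set remain. *)
Lemma endpoint_formula t (Q S q : {poly R}) x : (size Q <= (2 ^ t).+1)%N ->
  (wpol t)^`() = S * q -> `|w t x| != 1 ->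
  Q.[x] * S.[x] = \sum_(a <- endpoints lam t)
    Q.[a] * ((w t x ^+ 2 - 1) / (2 * w t a * q.[a] * (x - a))).
Proof.
move=> sQ eS wx.
have xe a : a \in endpoints lam t -> x != a.
  move=> ae; apply/negP => /eqP xa; move/eqP: wx; apply.
  have := endpoints_w lam2 ae; rewrite -xa => /eqP.
  by rewrite sqrf_eq1 => /orP[] /eqP ->; rewrite ?normrN normr1.
have q0 : q != 0.
  have ea : nth 0 (endpoints lam t) 0 \in endpoints lam t.
    by apply: mem_nth; rewrite size_endpoints muln_gt0 expn_gt0.
  apply/negP => /eqP q0; have [_] := endpoint_weight lam2 ea (xe _ ea).
  by rewrite eS q0 mulr0 horner0 eqxx.
have sS : (size S <= 2 ^ t)%N.
  have [->|S0] := eqVneq S 0; first by rewrite size_poly0.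
  apply: leq_trans (size_deriv_wpol t); rewrite eS size_mul//.
  by rewrite -(prednK (_ : 0 < size q)%N) ?size_poly_gt0// addnS leq_addr.
rewrite -hornerM (interpolation_at x (endpoints_uniq lam2 t)); last first.
  apply: (leq_trans (size_polyMleq _ _)); rewrite size_endpoints.
  apply: (@leq_trans ((2 ^ t).+1 + 2 ^ t).-1); last by rewrite addSn /= mul2n -addnn.
  by rewrite -!subn1 leq_sub2r// leq_add.
rewrite big_seq [RHS]big_seq; apply: eq_bigr => a ae.
have [-> da] := endpoint_weight lam2 ae (xe _ ae).
move: da; rewrite eS !hornerM mulf_eq0 negb_or => /andP[Sa qa].
have wa : w t a != 0.
  by apply/negP => /eqP h; have := endpoints_w lam2 ae; rewrite h expr0n /= => /eqP; rewrite eq_sym oner_eq0.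
by field; rewrite Sa qa wa subr_eq0 xe.
Qed.

Lemma endpoint_abs t a : a \in endpoints lam t -> `|w t a| = 1.
Proof.
move=> /(endpoints_w lam2)/eqP; rewrite sqrf_eq1 => /orP[] /eqP ->; by rewrite ?normrN normr1.
Qed.

(** With S = w_t' the weights have the signs of w_t at the nodes when x is
    outside [0, 1]. So for Q = w_t all terms have the same sign and the
    largest possible size, and this case gives the sharp constant. *)
Lemma outer_bound t (Q : {poly R}) x M : (size Q <= (2 ^ t).+1)%N -> x < 0 \/ 1 < x ->
  (forall a, Kreal a -> `|Q.[a]| <= M) -> `|Q.[x]| <= M * `|w t x|.
Proof.
move=> sQ hx hM.
have w0x : 1 < `|w 0 x|.
  rewrite w0; case: hx => hx; first by rewrite ler0_norm; lra.
  by rewrite ger0_norm; lra.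
have wx : 1 < `|w t x| by apply: lt_le_trans (w_outside_le lam2 w0x (leq0n t)).
have wx1 : `|w t x| != 1 by rewrite gt_eqF.
have W2 : 0 < w t x ^+ 2 - 1.
  by rewrite subr_gt0 -[w t x ^+ 2]real_normK ?num_real// expr_gt1.
have e1 : (wpol t)^`() = (wpol t)^`() * 1 by rewrite mulr1.
have fQ := endpoint_formula sQ e1 wx1.
have sW : (size (wpol t) <= (2 ^ t).+1)%N by rewrite (size_wpol lam2).
have fW := endpoint_formula sW e1 wx1.
have a01 a : a \in endpoints lam t -> 0 <= a <= 1.
  by move=> /(endpoints_Kreal lam2) /Kreal01.
have [s s1 hs] : exists2 s : R, `|s| = 1 & forall a, a \in endpoints lam t -> 0 < s * (x - a).
  case: hx => hx; [exists (-1)|exists 1]; rewrite ?normrN ?normr1// => a /a01/andP[? ?]; lra.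
pose T := \sum_(a <- endpoints lam t) (w t x ^+ 2 - 1) / (2 * (s * (x - a))).
have fW' : (wpol t).[x] * (wpol t)^`().[x] = s * T.
  rewrite fW /T big_distrr /=; rewrite big_seq [RHS]big_seq; apply: eq_bigr => a ae.
  have wa : w t a != 0 by rewrite -normr_gt0 endpoint_abs.
  have xa : x - a != 0 by apply/negP => /eqP h; have := hs a ae; rewrite h mulr0 ltxx.
  have s0 : s != 0 by rewrite -normr_gt0 s1.
  rewrite hornerC -/(w t a); field; by rewrite wa xa s0.
have T0 : 0 < T.
  rewrite /T big_seq; apply: (@lt_le_trans _ _ ((w t x ^+ 2 - 1) / (2 * (s * (x - nth 0 (endpoints lam t) 0))))).
    have ea : nth 0 (endpoints lam t) 0 \in endpoints lam t.
      by apply: mem_nth; rewrite size_endpoints muln_gt0 expn_gt0.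
    by rewrite divr_gt0// mulr_gt0// hs.
  have ea : nth 0 (endpoints lam t) 0 \in endpoints lam t.
    by apply: mem_nth; rewrite size_endpoints muln_gt0 expn_gt0.
  rewrite -big_seq (bigD1_seq _ ea (endpoints_uniq lam2 t))/= lerDl big_seq_cond.
  by apply: sumr_ge0 => a /andP[ae _]; rewrite divr_ge0 ?(ltW W2)// mulr_ge0// ltW// hs.
have d0 : 0 < `|(wpol t)^`().[x]|.
  rewrite normr_gt0; apply/negP => /eqP h; move: fW'; rewrite h mulr0 => /esym/eqP.
  by rewrite mulf_eq0 -normr_eq0 s1 oner_eq0/= gt_eqF.
rewrite -(ler_pM2r d0) -normrM fQ -mulrA -normrM fW' normrM s1 mul1r (gtr0_norm T0).
apply: (le_trans (ler_norm_sum _ _ _)); rewrite /T big_distrr /=.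
rewrite big_seq [leRHS]big_seq; apply: ler_sum => a ae.
rewrite normrM; apply: ler_pM => //; first by apply: hM; exact: endpoints_Kreal ae.
rewrite hornerC mulr1 normrM normfV normrM normrM normr_nat (endpoint_abs ae) mulr1.
rewrite (gtr0_norm W2) (_ : `|x - a| = s * (x - a))//.
by rewrite -(gtr0_norm (hs a ae)) normrM s1 mul1r.
Qed.

Lemma deriv_wpolS t : (wpol t.+1)^`() = (4 * lam t) *: (wpol t * (wpol t)^`()).
Proof.
rewrite /= derivD derivC add0r derivZ derivB derivC subr0 expr2 derivM.
rewrite [(wpol t)^`() * wpol t]mulrC (_ : 4 * lam t = 2 * lam t + 2 * lam t); last by ring.
by rewrite scalerDl scalerDr.
Qed.

(** The quotient of the derivative of w_(s+k+1) by w_s. *)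
Fixpoint cofactor_at (s k : nat) : {poly R} :=
  if k is j.+1 then (4 * lam (s + j.+1)%N) *: (wpol (s + j.+1) * cofactor_at s j)
  else (4 * lam s) *: (wpol s)^`().

Lemma cofactorE s k : (wpol (s + k.+1))^`() = cofactor_at s k * wpol s.
Proof.
elim: k => [|k IH]; first by rewrite addn1 deriv_wpolS -scalerAl [X in _ *: X = _]mulrC.
by rewrite addnS deriv_wpolS IH mulrA -!scalerAl.
Qed.

Lemma deriv_wpol_neq0 s x : `|w s x| <= 1 -> (wpol s)^`().[x] != 0.
Proof.
elim: s => [|s IH] h.
  by rewrite /= derivB derivZ derivX derivC subr0 !hornerE.
have l4 : 4 * lam s != 0 by rewrite mulf_neq0// ?pnatr_eq0// gt_eqF.
rewrite deriv_wpolS hornerZ hornerM -/(w s x); apply: mulf_neq0 => //; apply: mulf_neq0.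
  have := w_square_inside lam2 h => /andP[h1 _].
  by apply/negP => /eqP h0; move: h1; rewrite h0 expr0n /=; lra.
exact: IH (w_inside_pred lam2 h).
Qed.

(** Let x be removed at level s + 1. The root of w_t' in the gap of x is a
    root of w_s; dividing it out leaves a cofactor S that does not vanish at
    x, and w_s is bounded below at the nodes. The constant depends on x,
    through its distance to the set and the size of S at x, but not on t. *)
Lemma inner_bound x : ~ Kreal x -> `|w 0 x| <= 1 -> exists C : R, exists s : nat,
  [/\ 0 < C, 1 < `|w s.+1 x| & forall t (Q : {poly R}) (M : R), (s < t)%N -> (size Q <= (2 ^ t).+1)%N ->
    (forall a, Kreal a -> `|Q.[a]| <= M) -> `|Q.[x]| <= C * M * `|w t x|].
Proof.
move=> nKx w0x.
have [s ws ws1] : exists2 s, `|w s x| <= 1 & 1 < `|w s.+1 x|.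
  apply: contrapT => h; apply: nKx; elim=> [//|s IH].
  by rewrite leNgt; apply/negP => h1; apply: h; exists s.
have [e e0 he] : exists2 e : R, 0 < e & forall a, Kreal a -> e <= `|x - a|.
  have := @closed_Kreal R lam; rewrite -openC => oK.
  have : nbhs x (~` Kreal) by apply: open_nbhs_nbhs.
  move=> [e /= e0 he]; exists e => // a Ka; rewrite leNgt; apply/negP => h.
  exact: (he a h).
pose S k := cofactor_at s k.
have S0 k : 0 < `|(S k).[x]|.
  have l4 u : 4 * lam u != 0 by rewrite mulf_neq0// ?pnatr_eq0// gt_eqF.
  rewrite normr_gt0; elim: k => [|k IH]; rewrite /S /= !hornerZ; apply: mulf_neq0 => //.
    exact: deriv_wpol_neq0.
  rewrite hornerM; apply: mulf_neq0 => //.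
  rewrite -normr_gt0 -/(w _ x); apply: lt_trans (_ : 1 < _) => //.
  by apply: lt_le_trans ws1 (w_outside_le lam2 ws1 _); rewrite addnS ltnS leq_addr.
pose C0 : R := (2 ^ s.+1)%:R * `|w s.+1 x| / `|(S 0%N).[x]|.
have hC0 k : (2 ^ (s + k.+1))%:R * `|w (s + k.+1) x| / `|(S k).[x]| <= C0.
  elim: k => [|k IH]; first by rewrite addn1.
  apply: le_trans IH; rewrite /S /= -/(S k) hornerZ hornerM !normrM normr_nat (gtr0_norm (lam_gt0 _)).
  set u := (s + k.+1)%N; rewrite -/(w u x) addnS -/u.
  have wu : 1 < `|w u x|.
    by apply: lt_le_trans ws1 (w_outside_le lam2 ws1 _); rewrite /u addnS ltnS leq_addr.
  have wu0 : 0 < `|w u x| by apply: lt_trans wu.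
  have lu := lam2 u; have lu0 := lam_gt0 u.
  have hw : `|w u.+1 x| <= 2 * lam u * `|w u x| ^+ 2.
    rewrite ger0_norm; last first.
      by apply: le_trans (w_outside_grow lam2 wu); exact: ltW.
    by rewrite wS -[w u x ^+ 2]real_normK ?num_real//; nra.
  have Sk := S0 k.
  rewrite ler_pdivrMr; last by rewrite !mulr_gt0.

  apply: (@le_trans _ _ ((2 ^ u.+1)%:R * (2 * lam u * `|w u x| ^+ 2))); first by rewrite ler_wpM2l.
  rewrite expnS natrM le_eqVlt; apply/orP; left; apply/eqP; field; by rewrite gt_eqF.
have C00 : 0 <= C0 by rewrite /C0 !mulr_ge0// invr_ge0.
exists ((C0 + 1) * (2 / e)), s; split=> //.
  by rewrite mulr_gt0 ?divr_gt0//; lra.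
move=> t Q M st sQ hM.
have M0 : 0 <= M by apply: le_trans (hM _ (Kreal0 lam2)).
have [k tk] : exists k, t = (s + k.+1)%N.
  by exists (t - s.+1)%N; rewrite addnS -addSn subnKC.
have wt : 1 < `|w t x| by apply: lt_le_trans ws1 (w_outside_le lam2 ws1 st).
have wt1 : `|w t x| != 1 by rewrite gt_eqF.
have ed : (wpol t)^`() = S k * wpol s by rewrite tk cofactorE.
have W2 : 0 < w t x ^+ 2 - 1.
  by rewrite subr_gt0 -[w t x ^+ 2]real_normK ?num_real// expr_gt1.
have fQ := endpoint_formula sQ ed wt1.
have key : `|Q.[x]| * `|(S k).[x]| <= (2 * 2 ^ t)%:R * (M * (`|w t x| ^+ 2 / e)).
  rewrite -normrM fQ; apply: (le_trans (ler_norm_sum _ _ _)).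
  apply: (@le_trans _ _ (\sum_(a <- endpoints lam t) M * (`|w t x| ^+ 2 / e))).
    rewrite big_seq [leRHS]big_seq; apply: ler_sum => a ae.
    have Ka := endpoints_Kreal lam2 ae.
    rewrite normrM; apply: ler_pM => //; first exact: hM.
    rewrite normrM normfV !normrM normr_nat (endpoint_abs ae) mulr1 -/(w s a).
    rewrite (gtr0_norm W2) -[w t x ^+ 2]real_normK ?num_real//.
    have wa := Kreal_abs_ge lam2 s Ka; have ea := he a Ka.
    have d1 : e <= 2 * `|w s a| * `|x - a| by nra.
    apply: (@le_trans _ _ ((`|w t x| ^+ 2 - 1) / e)).
      rewrite ler_wpM2l//; last by rewrite lef_pV2 ?posrE//; lra.
      by rewrite real_normK ?num_real// ltW.
    by rewrite ler_wpM2r ?invr_ge0 ?(ltW e0)//; lra.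
  rewrite big_const_seq count_predT size_endpoints iter_addr_0.
  by rewrite [leRHS]mulr_natl lexx.
have := hC0 k; rewrite -tk; set N := (2 ^ t)%:R => hk.
have Sk := S0 k; have N0 : 0 <= N by rewrite /N ler0n.
have h1 : N * `|w t x| <= C0 * `|(S k).[x]| by rewrite -ler_pdivrMr.
rewrite -(ler_pM2r Sk); apply: (le_trans key).
rewrite natrM -/N.
have -> : 2 * N * (M * (`|w t x| ^+ 2 / e)) = (N * `|w t x|) * (M * `|w t x| * (2 / e)) by ring.
have -> : (C0 + 1) * (2 / e) * M * `|w t x| * `|(S k).[x]| =
  ((C0 + 1) * `|(S k).[x]|) * (M * `|w t x| * (2 / e)) by ring.
apply: ler_wpM2r; first by rewrite !mulr_ge0// invr_ge0 ltW.
by apply: (le_trans h1); rewrite ler_wpM2r//; lra.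
Qed.

End EndpointBounds.

(** * Existence of residual polynomials *)

Section Residual.
Local Open Scope complex_scope.
Context {R : realType} (lam : nat -> R).
Hypothesis lam2 : forall s, 2 <= lam s.
Local Notation Kreal := (Kreal lam).
Local Notation K := (Kset (gamma_of lam)).
Local Notation normc := ComplexField.Normc.normc.

Lemma normc_real (a : R) : normc a%:C = `|a|.
Proof. by rewrite /normc /= expr0n /= addr0 sqrtr_sqr. Qed.

Lemma normc_ge0 (z : R[i]) : 0 <= normc z.
Proof. by case: z => a b; rewrite /= sqrtr_ge0. Qed.

Lemma normcX (z : R[i]) n : normc (z ^+ n) = normc z ^+ n.
Proof.
elim: n => [|n IH]; first by rewrite !expr0 ComplexField.Normc.normc1.
by rewrite !exprS ComplexField.Normc.normcM IH.
Qed.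

Lemma normc_sum (I : Type) (r : seq I) (F : I -> R[i]) :
  normc (\sum_(i <- r) F i) <= \sum_(i <- r) normc (F i).
Proof.
elim/big_rec2: _ => [|i y z _ h]; first by rewrite ComplexField.Normc.normc0.
by apply: (le_trans (le_normcD _ _)); rewrite lerD2l.
Qed.

Lemma Kset_image (P : {poly R[i]}) :
  [set normc P.[cplx z] | z in K] = [set normc P.[a%:C] | a in Kreal].
Proof.
rewrite (KsetE lam2); apply/seteqP; split=> y /=.
  by move=> [[a b] /= [Ka ->] <-]; exists a.
by move=> [a Ka <-]; exists (a, 0).
Qed.

Lemma sup_norm_ge (P : {poly R[i]}) a : Kreal a -> normc P.[a%:C] <= sup_norm K P.
Proof.
move=> Ka; rewrite /sup_norm Kset_image; apply: sup_upper_bound; last by exists a.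
split; first by exists (normc P.[a%:C]), a.
exists (\sum_(i < size P) normc P`_i) => _ [b Kb <-].
rewrite horner_coef; apply: (le_trans (normc_sum _ _)); apply: ler_sum => i _.
rewrite ComplexField.Normc.normcM normcX normc_real.
have /andP[b0 b1] := Kreal01 Kb.
by rewrite ler_piMr ?normc_ge0// (ger0_norm b0) exprn_ile1.
Qed.

Lemma sup_norm_le (P : {poly R[i]}) M :
  (forall a, Kreal a -> normc P.[a%:C] <= M) -> sup_norm K P <= M.
Proof.
move=> h; rewrite /sup_norm Kset_image; apply: ge_sup.
  by exists (normc P.[0%:C]), 0 => //; exact: Kreal0.
by move=> _ [a Ka <-]; exact: h.
Qed.

Definition complexify (Q : {poly R}) : {poly R[i]} := map_poly (real_complex R) Q.

Lemma complexifyE Q (a : R) : normc (complexify Q).[a%:C] = `|Q.[a]|.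
Proof. by rewrite horner_map normc_real. Qed.

(** Taking real parts of coefficients does not increase absolute values on the
    real line, so that minimisation can be restricted to real polynomials. *)
Definition real_part (P : {poly R[i]}) : {poly R} := \poly_(i < size P) complex.Re P`_i.

Lemma real_partE P (a : R) : (real_part P).[a] = complex.Re P.[a%:C].
Proof.
rewrite horner_poly horner_coef.
apply: (big_ind2 (fun (u : R) (v : R[i]) => u = complex.Re v)) => //.
  by move=> x [u v] y [u' v'] -> ->.
move=> i _; rewrite -rmorphXn /=; case: (P`_i) => u v /=; ring.
Qed.

Lemma normc_ge_real (z : R[i]) : `|complex.Re z| <= normc z.
Proof. by case: z => a b /=; rewrite -sqrtr_sqr ler_wsqrtr// lerDl sqr_ge0. Qed.

Section Existence.
Variables (x0 : R) (n : nat).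

(** Distinct points of the limit set at which the values of a polynomial of
    degree n determine it. *)
Lemma nodes_exist : exists xs : seq R, [/\ uniq xs, size xs = n.+1 & forall a, a \in xs -> Kreal a].
Proof.
have n1 : `|1 : R| <= 1 by rewrite normr1.
exists (take n.+1 (fib lam n.+1 1)); split; first by rewrite take_uniq// (fib_uniq lam2).
  by rewrite size_takel// size_fib ltnW// ltn_expl.
move=> a /mem_take /(wE_fib lam2 _ _ n1) e; apply: (w_one_Kreal lam2 (t := n.+1)).
by rewrite e normr1.
Qed.

Section Minimise.
Variable L : 'I_n.+1 -> {poly R}.
Let comb (v : 'rV[R]_n.+1) := \sum_i v ord0 i *: L i.
Let Phi v := sup_norm K (complexify (comb v)).

Let combE v a : (comb v).[a] = \sum_i v ord0 i * (L i).[a].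
Proof. by rewrite /comb horner_sum; apply: eq_bigr => i _; rewrite hornerZ. Qed.

Let total_norm := \sum_i sup_norm K (complexify (L i)).

Let L_le i a : Kreal a -> `|(L i).[a]| <= sup_norm K (complexify (L i)).
Proof. by move=> Ka; rewrite -complexifyE; exact: sup_norm_ge. Qed.

Lemma sup_norm_lipschitz (v u : 'rV[R]_n.+1) (e : R) : (forall i, `|v ord0 i - u ord0 i| <= e) ->
  Phi v <= Phi u + e * total_norm.
Proof.
move=> h; apply: sup_norm_le => a Ka; rewrite complexifyE.
have -> : (comb v).[a] = (comb u).[a] + \sum_i (v ord0 i - u ord0 i) * (L i).[a].
  by rewrite !combE -big_split; apply: eq_bigr => i _ /=; ring.
apply: (le_trans (ler_normD _ _)); apply: lerD.
  by rewrite -complexifyE; exact: sup_norm_ge.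
apply: (le_trans (ler_norm_sum _ _ _)); rewrite /total_norm mulr_sumr; apply: ler_sum => i _.
by rewrite normrM; apply: ler_pM => //; exact: L_le.
Qed.

Lemma sup_norm_continuous : continuous Phi.
Proof.
move=> v; apply/(@cvgrPdist_lt _ _ _ (nbhs v) (nbhs_filter v)) => e e0.
have C0 : 0 <= total_norm.
  apply: sumr_ge0 => i _; apply: le_trans (sup_norm_ge _ (Kreal0 lam2)); exact: normc_ge0.
have d0 : 0 < e / (total_norm + 1) by rewrite divr_gt0//; lra.
have hd : e / (total_norm + 1) * total_norm < e.
  rewrite -mulrA -[ltRHS]mulr1 ltr_pM2l// mulrC ltr_pdivrMr; lra.
have nb : nbhs v (ball v (e / (total_norm + 1))) by exact: nbhsx_ballx.
apply: filterS nb => u bu.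
have h i : `|v ord0 i - u ord0 i| <= e / (total_norm + 1).
  by apply: ltW; case: bu => _; apply.
have h1 := sup_norm_lipschitz h.
have h2 : Phi u <= Phi v + e / (total_norm + 1) * total_norm.
  by apply: sup_norm_lipschitz => i; rewrite distrC.
rewrite ltr_norml; apply/andP; split; lra.
Qed.

(** The supremum norm is a continuous function of the coordinates, and the
    cube is compact. For the Lagrange basis L of some nodes, the coordinates
    are the values at the nodes, which lie in the cube for competitors of norm
    at most 1. *)
Lemma minimiser_exists : (exists v : 'rV[R]_n.+1, (forall i, `|v ord0 i| <= 1) /\ (comb v).[x0] = 1) ->
  exists v, (comb v).[x0] = 1 /\ forall u : 'rV[R]_n.+1, (forall i, `|u ord0 i| <= 1) -> (comb u).[x0] = 1 ->
    Phi v <= Phi u.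
Proof.
move=> [v0 hv0].
pose A : set 'rV[R]_n.+1 := [set v : 'rV[R]_n.+1 | forall i, `[-1, 1]%classic (v ord0 i)] `&`
  [set v : 'rV[R]_n.+1 | (comb v).[x0] = 1].
have cont (r : seq 'I_n.+1) : continuous (fun v : 'rV[R]_n.+1 => \sum_(i <- r) v ord0 i * (L i).[x0]).
  elim: r => [|i r IH] v.
    rewrite (_ : (fun _ => _) = cst 0); last by apply/funext => u; rewrite big_nil.
    exact: cst_continuous.
  rewrite (_ : (fun _ => _) = (fun u : 'rV[R]_n.+1 => u ord0 i * (L i).[x0]) +
     (fun u => \sum_(j <- r) u ord0 j * (L j).[x0])); last first.
    by apply/funext => u; rewrite big_cons.
  apply: (@cvgD _ _ _ _ (nbhs_filter v)); last exact: IH.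
  by apply: (@cvgMr_tmp R _ (nbhs v) (nbhs_filter v)); exact: coord_continuous.
have cA : compact A.
  apply: compact_closedI.
    by apply: (@rV_compact R n.+1 (fun=> `[-1, 1]%classic)) => i; exact: segment_compact.
  have -> : [set v : 'rV[R]_n.+1 | (comb v).[x0] = 1] =
      (fun v : 'rV[R]_n.+1 => \sum_i v ord0 i * (L i).[x0]) @^-1` [set 1].
    by apply/seteqP; split=> v /=; rewrite combE.
  apply: closed_comp; last exact: closed_eq.
  move=> v _; exact: (cont (index_enum _) v).
have inA (v : 'rV[R]_n.+1) : (forall i, `|v ord0 i| <= 1) -> (comb v).[x0] = 1 -> v \in A.
  move=> h1 h2; rewrite inE; split=> // i /=.
  by rewrite in_itv /= -ler_norml.
have [|v vA hv] := @compact_EVT_min _ R Phi A _ cA (continuous_subspaceT sup_norm_continuous).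
  by exists v0; move: (inA _ hv0.1 hv0.2); rewrite inE.
exists v; move: vA; rewrite inE => -[_ h]; split=> // u h1 h2; apply: hv; exact: inA.
Qed.
End Minimise.

(** The constant 1 is a competitor of norm 1, so competitors of larger norm
    can be ignored. *)
Lemma residual_exists : exists P, is_residual K x0 n P.
Proof.
have [xs [us sxs Kxs]] := nodes_exist.
pose L (i : 'I_n.+1) := (nodal xs xs`_i).[xs`_i]^-1 *: nodal xs xs`_i.
pose comb (v : 'rV[R]_n.+1) := \sum_i v ord0 i *: L i.
pose vals (Q : {poly R}) : 'rV[R]_n.+1 := \row_i Q.[xs`_i].
have combV (Q : {poly R}) : (size Q <= n.+1)%N -> comb (vals Q) = Q.
  move=> sQ; rewrite {2}(interpolation us (Q := Q)) ?sxs//.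
  rewrite (big_nth 0) sxs big_mkord; apply: eq_bigr => i _.
  by rewrite mxE /L scalerA.
have valsK (Q : {poly R}) : (forall a, Kreal a -> `|Q.[a]| <= 1) -> forall i, `|vals Q ord0 i| <= 1.
  by move=> h i; rewrite mxE; apply/h/Kxs/mem_nth; rewrite sxs.
have one1 (a : R) : Kreal a -> `|(1 : {poly R}).[a]| <= 1 by rewrite hornerC normr1.
have s1 : (size (1%R : {poly R}) <= n.+1)%N by rewrite size_poly1.
have [|v [v1 hv]] := minimiser_exists (L := L).
  exists (vals 1); split; first exact: valsK.
  by rewrite -/(comb _) combV// hornerC.
exists (complexify (comb v)); split.
  split; last by rewrite horner_map v1.
  rewrite size_map_poly; apply: (leq_trans (size_sum _ _ _)); apply/bigmax_leqP => i _.
  do 2 apply: (leq_trans (size_scale_leq _ _)).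
  by rewrite size_nodal ?sxs//; apply: mem_nth; rewrite sxs.
move=> P [sP P1].
have Q1 : (real_part P).[x0] = 1 by rewrite real_partE P1.
have sQ : (size (real_part P) <= n.+1)%N by apply: leq_trans sP; exact: size_poly.
have QP a : Kreal a -> `|(real_part P).[a]| <= sup_norm K P.
  by move=> Ka; rewrite real_partE; apply: (le_trans (normc_ge_real _)); exact: sup_norm_ge.
have [P1'|P1'] := lerP (sup_norm K P) 1.
  have := hv (vals (real_part P)); rewrite -/(comb _) -/(comb _) combV// => h.
  apply: le_trans (h _ Q1) _.
    by apply: valsK => a Ka; apply: le_trans (QP _ Ka) P1'.
  by apply: sup_norm_le => a Ka; rewrite complexifyE QP.
have := hv (vals 1); rewrite -/(comb _) -/(comb _) combV// => h.
apply: le_trans (h _ _) _; first exact: valsK.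
  by rewrite hornerC.
apply: le_trans (ltW P1'); apply: sup_norm_le => a Ka; rewrite complexifyE; exact: one1.
Qed.

(** The form in which extremality is used: lower bounds for the norm of the
    residual polynomial follow from bounds for real polynomials that are small
    on the set. *)
Lemma residual_real : exists Q : {poly R}, [/\ (size Q <= n.+1)%N, Q.[x0] = 1 &
  forall a, Kreal a -> `|Q.[a]| <= sup_norm K (residual_poly K x0 n)].
Proof.
have [P hP] := residual_exists.
have [[sP P1] _] : is_residual K x0 n (residual_poly K x0 n) := xgetPex 0 (ex_intro _ P hP).
exists (real_part (residual_poly K x0 n)); split.
- by apply: leq_trans sP; exact: size_poly.
- by rewrite real_partE P1.
- move=> a Ka; rewrite real_partE; apply: (le_trans (normc_ge_real _)); exact: sup_norm_ge.
Qed.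

End Existence.
End Residual.

(** * Holomorphic functions in real coordinates *)

Section Gradient.
Context {R : realType}.
Local Notation plane := (R * R)%type.
Implicit Types (f g : plane -> R) (z : plane).

(** Total differentiability with given partial derivatives. Total rather than
    partial differentiability is used because it is stable under composition
    and implies continuity. *)
Definition grad f z (p q : R) := is_diff z f (fun h : plane => p * h.1 + q * h.2).

Lemma grad_eq f z p q p' q' : grad f z p q -> p = p' -> q = q' -> grad f z p' q'.
Proof. by move=> h <- <-. Qed.

Lemma grad_cst c z : grad (fun=> c) z 0 0.
Proof. by apply: (is_diff_eq (is_diff_cst c z)); apply/funext => h /=; rewrite !mul0r addr0. Qed.

Lemma grad_fst z : grad fst z 1 0.
Proof.
have c : continuous (fst : plane -> R) by move=> x; exact: cvg_fst.
have h : is_diff z (fst : plane -> R) fst.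
  by apply: DiffDef; [exact: linear_differentiable|rewrite diff_lin].
by apply: (is_diff_eq h); apply/funext => x /=; rewrite mul0r addr0 mul1r.
Qed.

Lemma grad_snd z : grad snd z 0 1.
Proof.
have c : continuous (snd : plane -> R) by move=> x; exact: cvg_snd.
have h : is_diff z (snd : plane -> R) snd.
  by apply: DiffDef; [exact: linear_differentiable|rewrite diff_lin].
by apply: (is_diff_eq h); apply/funext => x /=; rewrite mul0r add0r mul1r.
Qed.

Lemma gradD f g z p q p' q' : grad f z p q -> grad g z p' q' ->
  grad (fun x => f x + g x) z (p + p') (q + q').
Proof.
move=> hf hg; rewrite /grad; have := is_diffD hf hg => h.
apply: (is_diff_eq h); apply/funext => -[a b].
change (p * a + q * b + (p' * a + q' * b) = (p + p') * a + (q + q') * b); ring.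
Qed.

Lemma gradM f g z p q p' q' : grad f z p q -> grad g z p' q' ->
  grad (fun x => f x * g x) z (f z * p' + g z * p) (f z * q' + g z * q).
Proof.
move=> hf hg; rewrite /grad; have := is_diffM hf hg => h.
apply: (is_diff_eq h); apply/funext => -[a b].
change (f z * (p' * a + q' * b) + g z * (p * a + q * b) =
  (f z * p' + g z * p) * a + (f z * q' + g z * q) * b); ring.
Qed.

Lemma grad_comp (k : R -> R) dk f z p q : is_derive (f z) 1 k dk -> grad f z p q ->
  grad (fun x => k (f x)) z (dk * p) (dk * q).
Proof.
move=> hk hf; have h : is_diff (f z) k ( *:%R^~ dk).
  apply: DiffDef; first by apply/derivable1_diffP; exact: ex_derive.
  by rewrite deriv1E ?derive1E ?derive_val//; exact: ex_derive.
have := is_diff_comp hf h => h2.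
apply: (is_diff_eq h2); apply/funext => -[a b].
change ((p * a + q * b) * dk = dk * p * a + dk * q * b); ring.
Qed.

Lemma gradV f z p q : f z != 0 -> grad f z p q ->
  grad (fun x => (f x)^-1) z (- (f z) ^- 2 * p) (- (f z) ^- 2 * q).
Proof.
move=> fz; apply: (grad_comp (k := GRing.inv)); apply: DeriveDef.
  by apply/derivable1_diffP; exact: differentiable_Rinv.
by rewrite deriveE; [rewrite diff_Rinv// /GRing.scale /= mulr1|exact: differentiable_Rinv].
Qed.

Lemma grad_sqrt f z p q : 0 < f z -> grad f z p q ->
  grad (fun x => Num.sqrt (f x)) z ((2 * Num.sqrt (f z))^-1 * p) ((2 * Num.sqrt (f z))^-1 * q).
Proof. by move=> fz; apply: grad_comp; exact: is_derive1_sqrt. Qed.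

Lemma grad_continuous f z p q : grad f z p q -> {for z, continuous f}.
Proof. by case=> h _; exact: differentiable_continuous. Qed.

Lemma grad_derivable f z p q v : grad f z p q -> derivable f z v.
Proof. by case=> h _; exact: diff_derivable. Qed.

Lemma grad_derive f z p q v : grad f z p q -> 'D_v f z = p * v.1 + q * v.2.
Proof. by case=> h e; rewrite deriveE// e. Qed.

End Gradient.

Section Holomorphic.
Context {R : realType}.
Local Notation plane := (R * R)%type.
Implicit Types (F G : plane -> plane) (z : plane) (U : set plane).

(** Complex differentiability of F with derivative F', as the Cauchy-Riemann
    equations. *)
Definition hol F F' z :=
  grad (fun x => (F x).1) z (F' z).1 (- (F' z).2) /\
  grad (fun x => (F x).2) z (F' z).2 (F' z).1.

Definition cadd F G : plane -> plane := fun z => ((F z).1 + (G z).1, (F z).2 + (G z).2).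
Definition cmul F G : plane -> plane := fun z =>
  ((F z).1 * (G z).1 - (F z).2 * (G z).2, (F z).1 * (G z).2 + (F z).2 * (G z).1).
Definition nsq (z : plane) : R := z.1 ^+ 2 + z.2 ^+ 2.
Definition cinv F : plane -> plane := fun z => ((F z).1 / nsq (F z), - (F z).2 / nsq (F z)).
(** The real part of the principal square root. *)
Definition resqrt (z : plane) : R := Num.sqrt ((Num.sqrt (nsq z) + z.1) / 2).
Definition csqrt F : plane -> plane := fun z => (resqrt (F z), (F z).2 / (2 * resqrt (F z))).
(** The complement of the closed negative half-line. *)
Definition slit (z : plane) := z.2 = 0 -> 0 < z.1.

Lemma nsq_gt0 z : z != 0 -> 0 < nsq z.
Proof.
case: z => x y h; rewrite /nsq /= lt0r addr_ge0 ?sqr_ge0// andbT.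
rewrite paddr_eq0 ?sqr_ge0// !sqrf_eq0; apply/negP => /andP[/eqP x0 /eqP y0].
by move/eqP: h; apply; rewrite x0 y0.
Qed.

Lemma slit_neq0 z : slit z -> z != 0.
Proof. by move=> h; apply/eqP => e; move: h; rewrite e /slit /= ltxx => /(_ erefl). Qed.

Lemma slit_arg z : slit z -> 0 < Num.sqrt (nsq z) + z.1.
Proof.
move=> h; have [z1|z1] := ltrP 0 z.1; first by rewrite ltr_wpDl// sqrtr_ge0.
have z2 : z.2 != 0 by apply/eqP => /h; rewrite ltNge z1.
have : `|z.1| < Num.sqrt (nsq z).
  rewrite -sqrtr_sqr ltr_sqrt; last by apply: nsq_gt0; exact: slit_neq0.
  by rewrite /nsq ltrDl lt0r sqr_ge0 sqrf_eq0 z2.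
by rewrite ler0_norm//; lra.
Qed.

Lemma resqrt_gt0 z : slit z -> 0 < resqrt z.
Proof. by move=> h; rewrite sqrtr_gt0 divr_gt0// slit_arg. Qed.

Lemma csqrt_sqr z : slit z -> let u := resqrt z in let v := z.2 / (2 * u) in
  [/\ 0 < u, z.1 = u ^+ 2 - v ^+ 2, z.2 = 2 * u * v & Num.sqrt (nsq z) = u ^+ 2 + v ^+ 2].
Proof.
move=> h u v; have u0 : 0 < u := resqrt_gt0 h.
have n0 : 0 < nsq z by apply: nsq_gt0; exact: slit_neq0.
set rho := Num.sqrt (nsq z).
have r0 : 0 < rho by rewrite sqrtr_gt0.
have r2 : rho ^+ 2 = z.1 ^+ 2 + z.2 ^+ 2 by rewrite sqr_sqrtr// ltW.
have u2 : u ^+ 2 = (rho + z.1) / 2.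
  by rewrite /u /resqrt sqr_sqrtr// divr_ge0// ltW// slit_arg.
have e2 : z.2 = 2 * u * v by rewrite /v; field; rewrite gt_eqF.
have v2 : v ^+ 2 = (rho - z.1) / 2.
  have u20 : u ^+ 2 != 0 by rewrite expf_neq0// gt_eqF.
  apply: (mulfI u20).
  have -> : u ^+ 2 * v ^+ 2 = z.2 ^+ 2 / 4 by rewrite e2; field.
  by rewrite u2 -(addKr (z.1 ^+ 2) (z.2 ^+ 2)) -r2; field.
by split=> //; rewrite u2 v2; field.
Qed.

Lemma hol_cst c z : hol (fun=> c) (fun=> (0, 0)) z.
Proof. by split; rewrite /= ?oppr0; exact: grad_cst. Qed.

Lemma hol_id z : hol id (fun=> (1, 0)) z.
Proof. by split; rewrite /= ?oppr0; [exact: grad_fst|exact: grad_snd]. Qed.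

Lemma hol_add F G F' G' z : hol F F' z -> hol G G' z -> hol (cadd F G) (cadd F' G') z.
Proof.
move=> [f1 f2] [g1 g2]; split => /=; first by rewrite opprD; exact: gradD.
exact: gradD.
Qed.

Lemma hol_mul F G F' G' z : hol F F' z -> hol G G' z ->
  hol (cmul F G) (cadd (cmul F' G) (cmul F G')) z.
Proof.
move=> [f1 f2] [g1 g2]; have N : grad (fun=> -1) z 0 0 := grad_cst (-1 : R) z.
have gradB (a b : plane -> R) p q p' q' : grad a z p q -> grad b z p' q' ->
    grad (fun x => a x - b x) z (p - p') (q - q').
  move=> ha hb; rewrite (_ : (fun _ => _) = (fun x => a x + -1 * b x)); last first.
    by apply/funext => x; rewrite mulN1r.
  by apply: grad_eq; [exact: gradD ha (gradM N hb)|rewrite /=; ring|rewrite /=; ring].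
split=> /=.
  by apply: grad_eq; [exact: gradB (gradM f1 g1) (gradM f2 g2)|rewrite /=; ring|rewrite /=; ring].
by apply: grad_eq; [exact: gradD (gradM f1 g2) (gradM f2 g1)|rewrite /=; ring|rewrite /=; ring].
Qed.

Lemma hol_inv F F' z : F z != 0 -> hol F F' z ->
  hol (cinv F) (cmul (fun=> (-1, 0)) (cmul F' (cmul (cinv F) (cinv F)))) z.
Proof.
move=> Fz [f1 f2]; have n0 := nsq_gt0 Fz.
have N : grad (fun=> -1) z 0 0 := grad_cst (-1 : R) z.
have gn := gradD (gradM f1 f1) (gradM f2 f2).
have nE : (F z).1 * (F z).1 + (F z).2 * (F z).2 = nsq (F z) by rewrite /nsq !expr2.
have gi := gradV _ gn; rewrite nE gt_eqF// in gi; have := gi isT => {}gi.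
have e1 : (fun x => (cinv F x).1) =
    (fun x => (F x).1 * ((F x).1 * (F x).1 + (F x).2 * (F x).2)^-1).
  by apply/funext => x; rewrite /cinv /nsq /= !expr2.
have e2 : (fun x => (cinv F x).2) =
    (fun x => -1 * ((F x).2 * ((F x).1 * (F x).1 + (F x).2 * (F x).2)^-1)).
  by apply/funext => x; rewrite /cinv /nsq /= !expr2 mulN1r mulNr.
move: n0; rewrite /nsq => n0.
have n1 : (F z).1 ^+ 2 + (F z).2 ^+ 2 != 0 by rewrite gt_eqF.
split; rewrite ?e1 ?e2.
  apply: grad_eq; [exact: gradM f1 gi|..]; rewrite /= /nsq; field; by rewrite -?expr2.
apply: grad_eq; [exact: gradM N (gradM f2 gi)|..]; rewrite /= /nsq; field; by rewrite -?expr2.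
Qed.

Lemma hol_sqrt F F' z : slit (F z) -> hol F F' z ->
  hol (csqrt F) (cmul F' (cinv (cmul (fun=> (2, 0)) (csqrt F)))) z.
Proof.
move=> sF [f1 f2]; have n0 := nsq_gt0 (slit_neq0 sF).
have gn := gradD (gradM f1 f1) (gradM f2 f2).
have nE : (F z).1 * (F z).1 + (F z).2 * (F z).2 = nsq (F z) by rewrite /nsq !expr2.
have gr := grad_sqrt _ gn; rewrite nE in gr; have {}gr := gr n0.
have ga := gradM (gradD gr f1) (grad_cst (2^-1 : R) z).
have gu := grad_sqrt _ ga; rewrite nE in gu.
have a0 : 0 < (Num.sqrt (nsq (F z)) + (F z).1) / 2 by rewrite divr_gt0// slit_arg.
have {}gu := gu a0.
have := csqrt_sqr sF.
have eu : Num.sqrt ((Num.sqrt (nsq (F z)) + (F z).1) / 2) = resqrt (F z) by [].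
rewrite eu in gu; set u := resqrt (F z) => -[u0 eA eB er].
set v := (F z).2 / (2 * u) in eA eB er.
have u1 : u != 0 by rewrite gt_eqF.
have gv := gradM f2 (gradV _ (gradM (grad_cst (2 : R) z) gu)).
rewrite eu -/u mulf_neq0 ?pnatr_eq0// in gv; have {}gv := gv isT.
have e1 : (fun x => (csqrt F x).1) =
    (fun x => Num.sqrt ((Num.sqrt ((F x).1 * (F x).1 + (F x).2 * (F x).2) + (F x).1) * 2^-1)).
  by apply/funext => x; rewrite /csqrt /resqrt /nsq /= !expr2.
have e2 : (fun x => (csqrt F x).2) =
    (fun x => (F x).2 * (2 * Num.sqrt ((Num.sqrt ((F x).1 * (F x).1 + (F x).2 * (F x).2) + (F x).1) * 2^-1))^-1).
  by apply/funext => x; rewrite /csqrt /resqrt /nsq /= !expr2.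
have r0 : u ^+ 2 + v ^+ 2 != 0 by rewrite gt_eqF// ltr_wpDr ?sqr_ge0// exprn_gt0.
have D : (2 * u - 0 * v) ^+ 2 + (2 * v + 0 * u) ^+ 2 = 4 * (u ^+ 2 + v ^+ 2) by ring.
split; rewrite ?e1 ?e2.
  apply: grad_eq; [exact: gu|..]; rewrite er /= /nsq /= -/u -/v D eA eB; field; by rewrite r0 u1.
apply: grad_eq; [exact: gv|..]; rewrite er /= /nsq /= -/u -/v D eA eB; field; by rewrite r0 u1.
Qed.

(** The derivative is existentially quantified, so that closure under products
    and inverses needs no formulas for higher derivatives. *)
Fixpoint smooth (n : nat) U F : Prop := if n is m.+1 then
    exists2 F', forall z, U z -> hol F F' z & smooth m U F'
  else forall z, U z -> {for z, continuous (fun x => (F x).1)} /\ {for z, continuous (fun x => (F x).2)}.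

Lemma hol_continuous F F' z : hol F F' z ->
  {for z, continuous (fun x => (F x).1)} /\ {for z, continuous (fun x => (F x).2)}.
Proof. by case=> /grad_continuous ? /grad_continuous ?. Qed.

Lemma smoothW n U F : smooth n.+1 U F -> smooth n U F.
Proof.
elim: n F => [|n IH] F [F' h s]; first by move=> z /h/hol_continuous.
by exists F' => //; exact: IH.
Qed.

Lemma smooth_cst n U c : smooth n U (fun=> c).
Proof.
elim: n c => [|n IH] c; first by move=> z _; split; exact: cvg_cst.
by exists (fun=> (0, 0)) => // z _; exact: hol_cst.
Qed.

Lemma smooth_id n U : smooth n U id.
Proof.
case: n => [|n]; first by move=> z _; split; [exact: cvg_fst|exact: cvg_snd].
by exists (fun=> (1, 0)); [move=> z _; exact: hol_id|exact: smooth_cst].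
Qed.

Lemma smooth_add n U F G : smooth n U F -> smooth n U G -> smooth n U (cadd F G).
Proof.
elim: n F G => [|n IH] F G.
  move=> hF hG z Uz; have [f1 f2] := hF z Uz; have [g1 g2] := hG z Uz.
  by split; [exact: cvgD f1 g1|exact: cvgD f2 g2].
move=> [F' hF sF] [G' hG sG]; exists (cadd F' G'); last exact: IH.
by move=> z Uz; apply: hol_add; [exact: hF|exact: hG].
Qed.

Lemma smooth_mul n U F G : smooth n U F -> smooth n U G -> smooth n U (cmul F G).
Proof.
elim: n F G => [|n IH] F G.
  move=> hF hG z Uz; have [f1 f2] := hF z Uz; have [g1 g2] := hG z Uz.
  split; first by apply: cvgB; [exact: cvgM f1 g1|exact: cvgM f2 g2].
  by apply: cvgD; [exact: cvgM f1 g2|exact: cvgM f2 g1].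
move=> hF hG; have sF := smoothW hF; have sG := smoothW hG.
case: hF hG => [F' hF sF'] [G' hG sG'].
exists (cadd (cmul F' G) (cmul F G')); last by apply: smooth_add; exact: IH.
by move=> z Uz; apply: hol_mul; [exact: hF|exact: hG].
Qed.

Lemma smooth_inv n U F : (forall z, U z -> F z != 0) -> smooth n.+1 U F -> smooth n.+1 U (cinv F).
Proof.
move=> F0; elim: n F F0 => [|n IH] F F0 hF.
  case: (hF) => [F' h s]; exists (cmul (fun=> (-1, 0)) (cmul F' (cmul (cinv F) (cinv F)))).
    by move=> z Uz; apply: hol_inv; [exact: F0|exact: h].
  have c : smooth 0 U (cinv F) by move=> z Uz; apply: hol_continuous (hol_inv (F0 z Uz) (h z Uz)).
  by do !apply: smooth_mul => //; exact: smooth_cst.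
have c := IH F F0 (smoothW hF).
case: hF => [F' h s]; exists (cmul (fun=> (-1, 0)) (cmul F' (cmul (cinv F) (cinv F)))).
  by move=> z Uz; apply: hol_inv; [exact: F0|exact: h].
by do !apply: smooth_mul => //; exact: smooth_cst.
Qed.

Lemma smooth_sqrt2 U F : (forall z, U z -> slit (F z)) -> smooth 2 U F -> smooth 2 U (csqrt F).
Proof.
move=> F0 hF; have hF1 := smoothW hF; have hF0 := smoothW hF1.
case: hF => F' h s.
have h1 z : U z -> hol (csqrt F) (cmul F' (cinv (cmul (fun=> (2, 0)) (csqrt F)))) z.
  by move=> Uz; apply: hol_sqrt; [exact: F0|exact: h].
have n0 z : U z -> cmul (fun=> (2, 0)) (csqrt F) z != 0.
  move=> Uz; apply/eqP => e; have := resqrt_gt0 (F0 z Uz).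
  have : (cmul (fun=> (2, 0)) (csqrt F) z).1 = 0 by rewrite e.
  rewrite /= mul0r subr0 => /eqP; rewrite mulf_eq0 pnatr_eq0 /= => /eqP ->; by rewrite ltxx.
have s0 : smooth 0 U (csqrt F) by move=> z /h1/hol_continuous.
have i0 : smooth 0 U (cinv (cmul (fun=> (2, 0)) (csqrt F))).
  move=> z Uz; apply: hol_continuous (hol_inv (n0 z Uz) (hol_mul (hol_cst (2, 0) z) (h1 z Uz))).
have s1 : smooth 1 U (csqrt F).
  eexists; first exact: h1.
  by apply: smooth_mul => //; exact: smoothW.
eexists; first exact: h1.
apply: smooth_mul => //; apply: smooth_inv => //.
by apply: smooth_mul => //; exact: smooth_cst.
Qed.

Lemma C1_of_grad U (f k p q : plane -> R) z : open U -> U z ->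
  (forall y, U y -> f y = k y) -> (forall y, U y -> grad f y (p y) (q y)) ->
  {for z, continuous p} -> {for z, continuous q} ->
  C1_at k z /\ (forall y, U y -> 'D_(1, 0) k y = p y /\ 'D_(0, 1) k y = q y).
Proof.
move=> oU Uz fk g cp cq.
have nU y (P : plane -> Prop) : U y -> (forall x, U x -> P x) -> \near y, P y.
  by move=> Uy h; apply: filterS h _; exact: open_nbhs_nbhs.
have near_fk y : U y -> {near y, f =1 k} by move=> /nU; apply.
have d y v : U y -> 'D_v k y = p y * v.1 + q y * v.2.
  by move=> Uy; rewrite -(near_eq_derive _ (near_fk y Uy)) (grad_derive _ (g y Uy)).
have d1 y : U y -> 'D_(1, 0) k y = p y by move=> Uy; rewrite d//= mulr1 mulr0 addr0.
have d2 y : U y -> 'D_(0, 1) k y = q y by move=> Uy; rewrite d//= mulr1 mulr0 add0r.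
have dk v : derivable k z v.
  by apply: near_eq_derivable (near_fk z Uz) _; exact: grad_derivable (g z Uz).
have cont (a b : plane -> R) : (forall y, U y -> b y = a y) -> {for z, continuous a} -> {for z, continuous b}.
  move=> ab ca; rewrite /prop_for /continuous_at ab//.
  by apply: cvg_trans ca; apply: near_eq_cvg; apply: (nU _ _ Uz) => y /ab.
split; last by move=> y Uy; split; [exact: d1|exact: d2].
by split=> //; [exact: cont cp|exact: cont cq].
Qed.

(** The real part u of F has gradient (Re F', - Im F'), and the Cauchy-Riemann
    equations for F' make the two second derivatives opposite. *)
Lemma smooth_harmonic U F z : open U -> smooth 2 U F -> U z ->
  harmonic_at (fun x => (F x).1) z.
Proof.
move=> oU [F1 h1 [F2 h2 c2]] Uz.
have gN (f : plane -> R) x p q : grad f x p q -> grad (fun x => - f x) x (- p) (- q).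
  move=> h; rewrite (_ : (fun x => - f x) = (fun x => -1 * f x)).
    by apply: grad_eq (gradM (grad_cst (-1 : R) x) h) _ _; rewrite /=; ring.
  by apply/funext => y; rewrite mulN1r.
have cN (f : plane -> R) x : {for x, continuous f} -> {for x, continuous (fun x => - f x)} by move=> ?; exact: cvgN.
have c1 x : U x -> _ := fun Ux => hol_continuous (h2 x Ux).
have A x : U x -> _ := fun Ux => C1_of_grad (k := fun x => (F x).1) oU Ux (fun _ _ => erefl) (fun y Uy => (h1 y Uy).1)
  (c1 x Ux).1 (cN _ _ (c1 x Ux).2).
have D1 x : U x -> (F1 x).1 = 'D_(1, 0) (fun x => (F x).1) x by move=> Ux; case: (A x Ux) => _ /(_ x Ux)[].
have D2 x : U x -> - (F1 x).2 = 'D_(0, 1) (fun x => (F x).1) x by move=> Ux; case: (A x Ux) => _ /(_ x Ux)[].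
have B x : U x -> _ := fun Ux => C1_of_grad oU Ux D1 (fun y Uy => (h2 y Uy).1) (c2 x Ux).1 (cN _ _ (c2 x Ux).2).
have C x : U x -> _ := fun Ux => C1_of_grad oU Ux D2 (fun y Uy => gN _ _ _ _ (h2 y Uy).2)
  (cN _ _ (c2 x Ux).2) (cN _ _ (c2 x Ux).1).
rewrite /harmonic_at; have nU : nbhs z U by exact: open_nbhs_nbhs.
apply: filterS nU => x Ux; split.
  by split; [exact: (A x Ux).1|exact: (B x Ux).1|exact: (C x Ux).1].
rewrite /laplacian; have [_ /(_ x Ux)[-> _]] := B x Ux; have [_ /(_ x Ux)[_ ->]] := C x Ux.
by rewrite subrr.
Qed.

End Holomorphic.

(** * Upper bounds for the Harnack exponent *)

Section Harnack.
Context {R : realType}.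
Local Notation plane := (R * R)%type.

(** The map 1 + sigma / (z - p). For (p, sigma) = (0, -1) or (1, 1) it takes
    the complement of [0, 1] to the complement of the closed negative half-
    line, so that the real part of its square root is positive and harmonic
    there; it tends to 0 at every point of (0, 1). *)
Definition moebius (p sigma : R) : plane -> plane :=
  cadd (fun=> (1, 0)) (cmul (fun=> (sigma, 0)) (cinv (cadd id (fun=> (- p, 0))))).
(** The same map in the coordinate 1 / z, written so that it agrees with the
    composition at the points where the totalised inverse is 0 as well. *)
Definition moebius_chart (p sigma : R) : plane -> plane :=
  cadd (fun=> (1, 0)) (cmul (fun=> (sigma, 0)) (cmul id (cinv (cadd (fun=> (1, 0)) (cmul (fun=> (- p, 0)) id))))).

Definition test_function (p sigma : R) (z : sphere R) : R :=
  if z is Some z then resqrt (moebius p sigma z) else 1.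

Lemma test_function_Some p sigma :
  (fun z : plane => test_function p sigma (Some z)) = (fun z => (csqrt (moebius p sigma) z).1).
Proof. by []. Qed.

Lemma resqrt1 : resqrt ((1, 0) : plane) = 1.
Proof. by rewrite /resqrt /nsq /= expr1n expr0n /= addr0 sqrtr1 (_ : (1 + 1) / 2 = 1 :> R) ?sqrtr1//; field. Qed.

Lemma test_function_chart p sigma :
  (fun w : plane => test_function p sigma (inv_chart w)) = (fun w => (csqrt (moebius_chart p sigma) w).1).
Proof.
apply/funext => -[x y]; rewrite /inv_chart.
have [->|n0] := eqVneq (x, y) 0.
  rewrite /= -resqrt1; congr resqrt; rewrite /moebius_chart /cadd /cmul /cinv /nsq /=.
  by congr pair; ring.
rewrite /test_function /=; congr resqrt.
have := nsq_gt0 n0; rewrite /nsq /= => D0.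
have D1 : x ^+ 2 + y ^+ 2 != 0 by rewrite gt_eqF.
rewrite /moebius /moebius_chart /cadd /cmul /cinv /cplx /= /nsq /=.
set E := (1 + (- p * x - 0 * y)) ^+ 2 + (0 + (- p * y + 0 * x)) ^+ 2.
have -> : (x / (x ^+ 2 + y ^+ 2) - p) ^+ 2 + (- (y / (x ^+ 2 + y ^+ 2)) + 0) ^+ 2 =
    E / (x ^+ 2 + y ^+ 2) by rewrite /E; field.
by rewrite invf_div; congr pair; set e := E^-1; field.
Qed.

Definition endpoint_parameters (p sigma : R) := (p = 0 /\ sigma = -1) \/ (p = 1 /\ sigma = 1).

Lemma closed_unit_segment : closed (@unit_segment R).
Proof.
have -> : @unit_segment R = fst @^-1` `[0, 1]%classic `&` snd @^-1` [set 0].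
  apply/seteqP; split=> -[x y] /=; rewrite in_itv /= => -[/andP[? ?] ?]; split=> //; exact/andP.
apply: closedI; apply: closed_comp; last first.
- exact: closed_eq.
- by move=> z _; exact: cvg_snd.
- exact: itv_closed.
- by move=> z _; exact: cvg_fst.
Qed.

Lemma moebius_slit p sigma z : endpoint_parameters p sigma -> ~ unit_segment z -> slit (moebius p sigma z).
Proof.
case: z => x y hp nz; rewrite /slit /moebius /cadd /cmul /cinv /nsq /=.
set D := (x - p) ^+ 2 + (y + 0) ^+ 2.
have D0 : 0 < D.
  apply: (@nsq_gt0 R (x - p, y + 0)); apply/eqP => -[e1 e2]; apply: nz; rewrite /unit_segment /=.
  by split; [apply/andP; case: hp => -[pe _]; split; move: e1; rewrite pe; lra|move: e2; lra].
have s0 : sigma != 0 by case: hp => -[_ ->]; rewrite ?oppr_eq0 oner_neq0.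
rewrite !mul0r subr0 addr0 add0r => /eqP.
rewrite mulf_eq0 (negbTE s0) /= mulf_eq0 invr_eq0 (gt_eqF D0) orbF oppr_eq0 addr0 => /eqP y0.
have -> : 1 + sigma * ((x - p) / D) = (D + sigma * (x - p)) / D by field; rewrite gt_eqF.
rewrite divr_gt0//; move: D0; rewrite /D y0 addr0 expr0n addr0 /= => D0.
have nx : ~ (0 <= x <= 1) by move=> h; apply: nz; rewrite /unit_segment /= y0.
case: hp => -[pe se]; rewrite pe se; move: D0; rewrite pe.
  move=> _; rewrite subr0; have [x0|x0] := ltrP x 0; first nra.
  have [x1|x1] := ltrP 1 x; first nra.
  by case: nx; apply/andP.
move=> _; have [x0|x0] := ltrP x 0; first nra.
have [x1|x1] := ltrP 1 x; first nra.
by case: nx; apply/andP.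
Qed.

Lemma moebius_chart_slit p sigma z : endpoint_parameters p sigma -> z.1 < 1 / 2 ->
  slit (moebius_chart p sigma z) /\ cadd (fun=> (1, 0)) (cmul (fun=> (- p, 0)) id) z != 0.
Proof.
case: z => x y hp /= hx; set d := cadd _ _ _.
have d1 : 0 < d.1 by rewrite /d /=; case: hp => -[-> _]; lra.
have d0 : d != 0 by apply/eqP => e; move: d1; rewrite e ltxx.
split=> //; have D0 := nsq_gt0 d0; move=> _.
rewrite /moebius_chart -/d.
rewrite [X in 0 < X](_ : _ = 1 + sigma * ((x * d.1 + y * d.2) / nsq d)); last first.
  by rewrite /cadd /cmul /cinv /= -/d; ring.
have -> : 1 + sigma * ((x * d.1 + y * d.2) / nsq d) =
  (nsq d + sigma * (x * d.1 + y * d.2)) / nsq d by field; rewrite gt_eqF.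
rewrite divr_gt0//; move: d1 D0; rewrite /nsq /d /=.
case: hp => -[-> ->]; rewrite ?oppr0 ?mul0r ?addr0 ?subr0; nra.
Qed.

Lemma smooth_moebius p sigma : endpoint_parameters p sigma ->
  smooth 2 (~` @unit_segment R) (moebius p sigma).
Proof.
move=> hp; have s c : smooth 2 (~` @unit_segment R) (fun=> c) := smooth_cst _ _ _.
apply: smooth_add => //; apply: smooth_mul => //; apply: smooth_inv.
  move=> [x y] nz; apply/eqP => -[e1 e2]; apply: nz; rewrite /unit_segment /=.
  by split; [apply/andP; case: hp => -[pe _]; split; move: e1; rewrite pe /=; lra|move: e2; rewrite /=; lra].
by apply: smooth_add => //; exact: smooth_id.
Qed.

Lemma smooth_moebius_chart p sigma : endpoint_parameters p sigma ->
  smooth 2 [set z : plane | z.1 < 1 / 2] (moebius_chart p sigma).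
Proof.
move=> hp; have s c : smooth 2 [set z : plane | z.1 < 1 / 2] (fun=> c) := smooth_cst _ _ _.
apply: smooth_add => //; apply: smooth_mul => //; apply: smooth_mul; first exact: smooth_id.
apply: smooth_inv; first by move=> z hz; have [] := moebius_chart_slit hp hz.
by apply: smooth_add => //; apply: smooth_mul => //; exact: smooth_id.
Qed.

Definition off_segment : set (sphere R) := [set z | if z is Some z then ~ unit_segment z else True].

(** Near infinity the half-plane Re w < 1 / 2 of the chart avoids the pole and
    the slit. *)
Lemma test_function_harmonic p sigma : endpoint_parameters p sigma ->
  harmonic_on off_segment (test_function p sigma).
Proof.
move=> hp [z|] hz.
  rewrite test_function_Some; apply: (smooth_harmonic (U := ~` @unit_segment R)) => //.
    by apply: closed_openC; exact: closed_unit_segment.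
  by apply: smooth_sqrt2; [move=> y ny; exact: moebius_slit|exact: smooth_moebius].
rewrite test_function_chart; apply: (smooth_harmonic (U := [set z : plane | z.1 < 1 / 2])).
- have -> : [set z : plane | z.1 < 1 / 2] = fst @^-1` [set x | x < 1 / 2] by [].
  apply: open_comp; last exact: open_lt.
  by move=> y _; exact: cvg_fst.
- by apply: smooth_sqrt2; [move=> y ny; case: (moebius_chart_slit hp ny)|exact: smooth_moebius_chart].
- by rewrite /= divr_gt0.
Qed.

Lemma test_function_gt0 p sigma z : endpoint_parameters p sigma -> off_segment z ->
  0 < test_function p sigma z.
Proof.
by move=> hp; case: z => [z|] hz //=; apply: resqrt_gt0; exact: moebius_slit.
Qed.

Lemma harmonic_cst (Omega : set (sphere R)) : harmonic_on Omega (fun=> 1).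
Proof.
have h (z : plane) : harmonic_at (fun=> 1 : R) z.
  have := @smooth_harmonic R setT (fun=> (1, 0)) z openT (smooth_cst _ _ _) I.
  by [].
by move=> [z|] _; exact: h.
Qed.

Lemma harmonic_sub (O1 O2 : set (sphere R)) h : O1 `<=` O2 -> harmonic_on O2 h -> harmonic_on O1 h.
Proof. by move=> s h2 p /s /h2. Qed.

(** Each admissible constant in the Harnack inequality is at least h
    (infinity) / h (x0), for any one positive harmonic h. If there is no
    admissible constant, the infimum and its inverse are 0 by convention,
    which is harmless for an upper bound. *)
Lemma tau_le_harmonic (K : set plane) x0 h kappa : 0 < kappa -> kappa <= 1 ->
  harmonic_on (Omega_of K x0) h -> (forall p, Omega_of K x0 p -> 0 < h p) ->
  h None = 1 -> h (Some (x0, 0)) = kappa -> tau_exponent K x0 <= kappa.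
Proof.
move=> k0 k1 hh hp hN hx; rewrite /tau_exponent /harnack_distance; set S := mkset _.
have [[tau0 St0]|S0] := pselect (S !=set0); last first.
  have -> : S = set0 by apply/seteqP; split=> // t St; case: S0; exists t.
  by rewrite inf0 invr0 ltW.
have lb t : S t -> kappa^-1 <= t.
  move=> St; have /andP[t1 _] := St _ (@harmonic_cst _) (fun _ _ => ltr01).
  have /andP[_ t2] := St _ (@harmonic_cst _) (fun _ _ => ltr01).
  rewrite mulr1 in t2; have t0 : 0 < t by lra.
  have /andP[] := St _ hh hp; rewrite hN hx !mulr1 => h1 _.
  by rewrite -[t]invrK lef_pV2 ?posrE ?invr_gt0.
have : kappa^-1 <= inf S by apply: lb_le_inf => //; exists tau0.
move=> hi; have i0 : 0 < inf S by apply: lt_le_trans hi; rewrite invr_gt0.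
by rewrite -[leRHS]invrK lef_pV2 ?posrE ?invr_gt0.
Qed.

Lemma tau_le1 (K : set plane) x0 : tau_exponent K x0 <= 1.
Proof. by apply: (tau_le_harmonic (h := fun=> 1)) => //; exact: harmonic_cst. Qed.

(** A gap is an interval that avoids the points 0 and 1 of K. *)
Lemma gap_outer (K : set plane) x0 y : K (0, 0) -> K (1, 0) -> x0 < 0 \/ 1 < x0 ->
  gap_of K x0 y -> y < 0 \/ 1 < y.
Proof.
move=> K0 K1 hx gy.
have nK0 : ~ real_trace K x0 -> gap_of K x0 x0 by move=> h; exact: connected_component_refl.
have nKx : ~ real_trace K x0.
  move=> Kx; move: gy; rewrite /gap_of connected_component_out//; by move=> h; apply: h.
have ci : is_interval (gap_of K x0) by apply/connected_intervalP; exact: component_connected.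
have sub z : gap_of K x0 z -> ~ real_trace K z by move=> /connected_component_sub.
have gx := nK0 nKx.
have [y0|y0] := ltrP y 0; first by left.
have [y1|y1] := ltrP 1 y; first by right.
case: hx => hx; exfalso.
  by apply: (sub 0) => //; apply: (ci _ _ gx gy); rewrite (ltW hx) y0.
by apply: (sub 1) => //; apply: (ci _ _ gy gx); rewrite (ltW hx) y1.
Qed.

(** Close to [0, 1] the exponent is at most the square root of the distance to
    it. This compensates the loss in the bounds for Widom factors at points
    where no w_t is large yet. *)
Lemma tau_outer (K : set plane) x0 : K (0, 0) -> K (1, 0) -> x0 < 0 \/ 1 < x0 ->
  tau_exponent K x0 <= Num.sqrt ((`|2 * x0 - 1| - 1) / 2).
Proof.
move=> K0 K1 hx.
have sub : Omega_of K x0 `<=` off_segment.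
  move=> [[x y]|] //= [//|[y0 g]] [/= /andP[x0' x1'] _].
  by have := gap_outer K0 K1 hx g; lra.
have hO : ~ unit_segment ((x0, 0) : plane) by move=> [/= /andP[? ?] _]; lra.
have key p sigma kappa : endpoint_parameters p sigma -> (moebius p sigma (x0, 0)) = (kappa, 0) ->
    0 < kappa -> kappa <= 1 -> tau_exponent K x0 <= Num.sqrt kappa.
  move=> hp hk k0 k1; apply: (tau_le_harmonic (h := test_function p sigma)).
  - by rewrite sqrtr_gt0.
  - by rewrite -[leRHS]sqrtr1 ler_wsqrtr.
  - by apply: harmonic_sub sub _; exact: test_function_harmonic.
  - by move=> q /sub; exact: test_function_gt0.
  - by [].
  - rewrite /= hk /resqrt /nsq /= expr0n addr0 sqrtr_sqr gtr0_norm//.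
    by congr Num.sqrt; field.
case: hx => hx.
  have n1 : 0 < 1 - x0 by lra.
  have n2 : x0 - 1 != 0 by rewrite lt_eqF; lra.
  rewrite ltr0_norm; last by lra.
  apply: (le_trans (key 1 1 ((- x0) / (1 - x0)) _ _ _ _)).
  - by right.
  - rewrite /moebius /cadd /cmul /cinv /nsq /= !addr0 expr0n /= addr0 oppr0; congr pair; field; rewrite ?n2//=.
    by rewrite gt_eqF.
  - by rewrite divr_gt0//; lra.
  - by rewrite ler_pdivrMr//; lra.
  - by rewrite ler_wsqrtr// ler_pdivrMr//; nra.
have n1 : 0 < x0 by lra.
have n2 : x0 != 0 by rewrite gt_eqF.
rewrite gtr0_norm; last by lra.
apply: (le_trans (key 0 (-1) ((x0 - 1) / x0) _ _ _ _)).
- by left.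
- rewrite /moebius /cadd /cmul /cinv /nsq /= oppr0 !addr0 expr0n /= addr0 oppr0; congr pair; by field.
- by rewrite divr_gt0//; lra.
- by rewrite ler_pdivrMr//; lra.
- by rewrite ler_wsqrtr// ler_pdivrMr//; nra.
Qed.

End Harnack.

(** * Lower bounds for Widom factors *)

Section WidomLower.
Context {R : realType} (lam dl : nat -> R).
Hypothesis lam2 : forall s, 2 <= lam s.
Hypothesis ln_lam : forall s, ln (lam s) = 2 ^+ s.+1 * (dl s - dl s.+1).
Hypothesis dl_cvg0 : dl @ \oo --> (0 : R).
Hypothesis dl_ge0 : forall s, 0 <= dl s.
Local Notation w := (w lam).
Local Notation Kreal := (Kreal lam).
Local Notation K := (Kset (gamma_of lam)).
Let lam_gt0 := lam_gt0 lam2.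
Let g (x : R) : R := green K (x, 0).
Let M (x : R) n : R := sup_norm K (residual_poly K x n).

Lemma green_ge t x : 1 < `|w t x| ->
  2^-1 ^+ t * (ln (w t x ^+ 2 - 1) / 2 + ln 2) + dl t <= g x.
Proof.
move=> wx; have [mu [muK musym]] := symmetric_measure_exists lam2.
exact: (green_lower lam2 ln_lam dl_cvg0 dl_ge0 muK musym wx).
Qed.

Lemma two_gt0 t : 0 < 2 ^+ t :> R. Proof. by rewrite exprn_gt0. Qed.

Lemma halfXE t : 2^-1 ^+ t = (2 ^+ t)^-1 :> R. Proof. by rewrite exprVn. Qed.

Lemma green_scaled t x : 1 < `|w t x| ->
  ln (w t x ^+ 2 - 1) / 2 + ln 2 + 2 ^+ t * dl t <= 2 ^+ t * g x.
Proof.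
move=> /green_ge h; have p := two_gt0 t.
have -> : ln (w t x ^+ 2 - 1) / 2 + ln 2 + 2 ^+ t * dl t =
    2 ^+ t * (2^-1 ^+ t * (ln (w t x ^+ 2 - 1) / 2 + ln 2) + dl t).
  by rewrite halfXE; field; rewrite gt_eqF.
by rewrite ler_pM2l.
Qed.

Lemma w_growth_step s x : 1 < `|w s x| -> 4 * lam s * (`|w s x| - 1) <= `|w s.+1 x| - 1.
Proof.
move=> h; have := w_outside_grow lam2 h => h1.
have w1 : 0 <= w s.+1 x by lra.
rewrite (ger0_norm w1) wS -[w s x ^+ 2]real_normK ?num_real//.
have : 0 <= lam s * (`|w s x| - 1) ^+ 2 by rewrite mulr_ge0 ?sqr_ge0// ltW.
set a := `|w s x|; nra.
Qed.

(** The excess over 1 grows at least by the factor 4, the derivative of the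
    Chebyshev map at 1. *)
Lemma w_growth s k x : 1 < `|w s x| -> 4 ^+ k * (`|w s x| - 1) <= `|w (s + k)%N x| - 1.
Proof.
move=> h; elim: k => [|k IH]; first by rewrite addn0 expr0 mul1r.
have h1 : 1 < `|w (s + k)%N x| by apply: lt_le_trans h (w_outside_le lam2 h (leq_addr _ _)).
rewrite addnS exprS -mulrA; apply: le_trans (w_growth_step h1).
rewrite -[leRHS]mulrA ler_pM2l//; apply: (le_trans IH).
have l2 := lam2 (s + k)%N; rewrite -[leLHS]mul1r ler_wpM2r//; lra.
Qed.

Lemma natr_le_exp2 n : n%:R <= 2 ^+ n :> R.
Proof. by rewrite -natrX ler_nat ltnW// ltn_expl. Qed.

Lemma w_far_eventually s x : 1 < `|w s x| -> exists2 t0, (s <= t0)%N & forall t, (t0 <= t)%N -> 4 / 3 <= w t x ^+ 2.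
Proof.
move=> h; set e : R := `|w s x| - 1; have e0 : 0 < e by rewrite /e; lra.
exists (s + (Num.truncn e^-1).+1)%N; first exact: leq_addr.
move=> t ht; set k := (Num.truncn e^-1).+1 in ht.
have h1 : 1 < `|w (s + k)%N x| by apply: lt_le_trans h (w_outside_le lam2 h (leq_addr _ _)).
have h2 := w_outside_le lam2 h1 ht.
have h3 := w_growth k h; rewrite -/e in h3.
have h4 : e^-1 <= k%:R by rewrite ltW// truncnS_gt.
have h5 : k%:R <= 4 ^+ k :> R.
  by apply: (le_trans (natr_le_exp2 k)); rewrite lerXn2r ?nnegrE ?ler_nat.
have h6 : 1 <= 4 ^+ k * e by rewrite -[leLHS](mulVf (lt0r_neq0 e0)) ler_pM2r//; exact: le_trans h5.
rewrite -[w t x ^+ 2]real_normK ?num_real//; nra.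
Qed.

Lemma green_far t x : 1 < `|w t x| -> 4 / 3 <= w t x ^+ 2 ->
  ln `|w t x| + 2 ^+ t * dl t <= 2 ^+ t * g x.
Proof.
move=> h h2; apply: le_trans (green_scaled h); rewrite lerD2r.
have w0 : 0 < `|w t x| by lra.
have : ln (`|w t x| ^+ 2) <= ln (2 ^+ 2 * (w t x ^+ 2 - 1)).
  rewrite ler_ln ?posrE ?exprn_gt0//; last by rewrite pmulr_rgt0//; lra.
  rewrite real_normK ?num_real//; lra.
rewrite lnM ?posrE ?exprn_gt0//; last by lra.
rewrite !lnXn//; lra.
Qed.

(** When w_t x is close to 1 the single estimate at level t is useless, but at
    level t + j the value of w dominates cosh (2^j ln q); let j tend to
    infinity. *)
Lemma green_near t x q : 1 < q -> (q + q^-1) / 2 <= w t x -> ln q <= 2 ^+ t * g x.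
Proof.
move=> q1 hq; have q0 : 0 < q by lra.
have qj j : 1 < q ^+ (2 ^ j) by rewrite exprn_egt1// -lt0n expn_gt0.
have half1 a : 1 < a -> 1 < (a + a^-1) / 2 :> R.
  move=> a1; have a0 : 0 < a by lra.
  have e : (a + a^-1) / 2 - 1 = (a - 1) ^+ 2 / (2 * a) by field; rewrite gt_eqF.
  by rewrite -subr_gt0 e divr_gt0// ?exprn_gt0//; lra.
have hj j : (q ^+ (2 ^ j) + (q ^+ (2 ^ j))^-1) / 2 <= w (t + j)%N x.
  elim: j => [|j IH]; first by rewrite addn0 expn0 expr1.
  have a1 := half1 _ (qj j); have w1 : 1 < `|w (t + j)%N x|.
    by rewrite ger0_norm; lra.
  rewrite addnS; apply: le_trans (w_outside_step lam2 w1).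
  rewrite expnS mulnC exprM; move: IH a1 (qj j); set a := q ^+ (2 ^ j) => IH a1 aj.
  have a0 : a != 0 by rewrite gt_eqF//; lra.
  have -> : (a ^+ 2 + (a ^+ 2)^-1) / 2 = 2 * ((a + a^-1) / 2) ^+ 2 - 1 by field.
  rewrite lerD2r ler_pM2l// ler_sqr ?nnegrE//; lra.
set L := ln (1 - q ^- 2).
have qq : 0 < 1 - q ^- 2 by rewrite subr_gt0 invf_lt1 ?exprn_gt0// exprn_egt1.
have L0 : L <= 0 by rewrite ln_le0// lerBlDr lerDl invr_ge0 exprn_ge0// ltW.
(* The error L does not depend on j, whereas the other side grows like 2^j.
   *)
have key j : 2 ^+ j * (ln q - 2 ^+ t * g x) <= - L.
  have a1 := half1 _ (qj j); have w1 : 1 < w (t + j)%N x by apply: lt_le_trans a1 (hj j).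
  have w1' : 1 < `|w (t + j)%N x| by rewrite ger0_norm//; lra.
  have := green_scaled w1'; have D0 : 0 <= 2 ^+ (t + j) * dl (t + j)%N by rewrite mulr_ge0// ltW// two_gt0.
  move: (hj j) (qj j) a1; set a := q ^+ (2 ^ j) => ha a2 a1.
  have a0 : 0 < a by lra.
  have s0 : 0 < a - a^-1 by rewrite subr_gt0 (lt_trans _ a2)// invf_lt1.
  have h1 : ln (((a - a^-1) / 2) ^+ 2) <= ln (w (t + j)%N x ^+ 2 - 1).
    rewrite ler_ln ?posrE ?exprn_gt0 ?divr_gt0//; last first.
      by rewrite subr_gt0 expr_gt1//; lra.
    have -> : ((a - a^-1) / 2) ^+ 2 = ((a + a^-1) / 2) ^+ 2 - 1 by field; rewrite gt_eqF.
    by rewrite lerD2r ler_sqr ?nnegrE//; lra.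
  rewrite lnXn ?divr_gt0// ln_div ?posrE// in h1.
  have h2 : ln (a - a^-1) = 2 ^+ j * ln q + ln (1 - a ^- 2).
    have -> : a - a^-1 = a * (1 - a ^- 2) by field; rewrite gt_eqF.
    rewrite lnM ?posrE//; first by congr (_ + _); rewrite /a lnXn// -[LHS]mulr_natl natrX.
    by rewrite subr_gt0 invf_lt1 ?exprn_gt0// exprn_egt1.
  have h3 : L <= ln (1 - a ^- 2).
    rewrite /L ler_ln ?posrE//; last by rewrite subr_gt0 invf_lt1 ?exprn_gt0// exprn_egt1.
    rewrite lerD2l lerN2 lef_pV2 ?posrE ?exprn_gt0// ler_sqr ?nnegrE; [|lra|lra].
    by rewrite /a -[leLHS]expr1 ler_eXn2l// expn_gt0.
  rewrite exprD => h4; move: h1 h2 h3 D0 h4; rewrite -mulr_natl exprD; nra.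
rewrite leNgt; apply/negP => hlt.
set e := ln q - 2 ^+ t * g x in key; have e0 : 0 < e by rewrite /e; lra.
have := key (Num.truncn (- L / e)).+1; rewrite leNgt => /negP; apply.
rewrite -ltr_pdivrMr//; apply: lt_le_trans (natr_le_exp2 _).
exact: truncnS_gt.
Qed.

(** The lower bound for the Green function given by level t exceeds that given
    by level 0 by a bounded amount only, by telescoping. *)
Lemma ln_w_le t x : 1 < `|w 0 x| ->
  ln `|w t x| + 2 ^+ t * dl t <= 2 ^+ t * (ln `|w 0 x| + dl 0%N + ln 2) - ln 2.
Proof.
move=> h; elim: t => [|t IH]; first by rewrite expr0 !mul1r; lra.
have h1 : 1 < `|w t x| by apply: lt_le_trans h (w_outside_le lam2 h (leq0n t)).
have h2 := w_outside_grow lam2 h1.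
have l0 := lam_gt0 t; have w0' : 0 < `|w t x| by lra.
have w1 : 0 < w t.+1 x by lra.
rewrite (gtr0_norm w1); have : ln (w t.+1 x) <= ln (2 * (lam t * `|w t x| ^+ 2)).
  rewrite ler_ln ?posrE ?mulr_gt0 ?exprn_gt0//.
  by rewrite wS real_normK ?num_real//; have := lam2 t; nra.
rewrite lnM ?posrE ?mulr_gt0 ?exprn_gt0// lnM ?posrE ?exprn_gt0// lnXn//.
by rewrite ln_lam exprS; move: IH; set N := 2 ^+ t; nra.
Qed.

(** A polynomial of degree 2^t with value 1 at x is made of the k-th power of
    the residual polynomial and of j linear factors vanishing at the centre of
    [0, 1], which are at most 1 / |w_0 x| on the set. This transfers degree n
    to the dyadic degrees, at which interpolation is sharp. *)
Lemma residual_norm_power x n k j t : x < 0 \/ 1 < x -> (k * n + j <= 2 ^ t)%N ->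
  1 <= M x n ^+ k * (`|w 0 x| ^- j) * `|w t x|.
Proof.
move=> hx hd; have [Q [sQ Q1 hQ]] := residual_real lam2 x n.
have w0x : 1 < `|w 0 x|.
  rewrite w0; case: hx => hx; first by rewrite ler0_norm; lra.
  by rewrite ger0_norm; lra.
have wx0 : w 0 x != 0 by rewrite -normr_gt0; lra.
(* (w 0 x)^-1 *: w_0 is the linear factor with value 1 at x. *)
pose S : {poly R} := Q ^+ k * ((w 0 x)^-1 *: wpol lam 0) ^+ j.
have sw : (size ((w 0 x)^-1 *: wpol lam 0) <= 2)%N.
  by apply: (leq_trans (size_scale_leq _ _)); rewrite (size_wpol lam2).
have sS : (size S <= (2 ^ t).+1)%N.
  apply: (leq_trans (size_polyMleq _ _)).
  have pr (p d : nat) : (p <= d.+1)%N -> (p.-1 <= d)%N by case: p.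
  have h1 : (size (Q ^+ k) <= (k * n).+1)%N.
    by apply: (leq_trans (size_poly_exp_leq _ _)); rewrite ltnS mulnC leq_mul// pr.
  have h2 : (size (((w 0 x)^-1 *: wpol lam 0) ^+ j) <= j.+1)%N.
    by apply: (leq_trans (size_poly_exp_leq _ _)); rewrite ltnS -[leqRHS]mul1n leq_mul// pr.
  apply: pr; apply: (leq_trans (leq_add h1 h2)).
  by rewrite addSn addnS !ltnS.
have S1 : S.[x] = 1.
  by rewrite hornerM !horner_exp hornerZ Q1 -/(w 0 x) mulVf// !expr1n mulr1.
have hS a : Kreal a -> `|S.[a]| <= M x n ^+ k * `|w 0 x| ^- j.
  move=> Ka; rewrite hornerM !horner_exp hornerZ -/(w 0 a) normrM !normrX normrM normfV.
  apply: ler_pM; rewrite ?exprn_ge0//.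
    by rewrite lerXn2r ?nnegrE//; [apply: le_trans (hQ a Ka)|exact: hQ].
  rewrite -exprVn lerXn2r ?nnegrE ?mulr_ge0 ?invr_ge0//.
  by rewrite ler_piMr ?invr_ge0//; exact: (Ka 0%N).
by have := outer_bound lam2 sS hx hS; rewrite S1 normr1.
Qed.

Lemma widom_ge x n (e : R) : 0 < M x n -> e <= ln (M x n) + n%:R * g x ->
  expR e <= widom_factor K x n.
Proof.
move=> M0 h; rewrite /widom_factor -expRN opprK -/(M x n) -/(g x).
by rewrite -{1}(lnK M0) -expRD ler_expR.
Qed.

End WidomLower.

Section WidomRegimes.
Context {R : realType} (lam dl : nat -> R).
Hypothesis lam2 : forall s, 2 <= lam s.
Hypothesis ln_lam : forall s, ln (lam s) = 2 ^+ s.+1 * (dl s - dl s.+1).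
Hypothesis dl_cvg0 : dl @ \oo --> (0 : R).
Hypothesis dl_ge0 : forall s, 0 <= dl s.
Local Notation w := (w lam).
Local Notation Kreal := (Kreal lam).
Local Notation K := (Kset (gamma_of lam)).
Let lam_gt0 := lam_gt0 lam2.
Let g (x : R) : R := green K (x, 0).
Let M (x : R) n : R := sup_norm K (residual_poly K x n).

Lemma w0_outer (x : R) : x < 0 \/ 1 < x -> 1 < `|w 0 x|.
Proof.
rewrite w0; case=> hx; first by rewrite ler0_norm; lra.
by rewrite ger0_norm; lra.
Qed.

Lemma residual_norm_gt0 x n : x < 0 \/ 1 < x -> 0 < M x n.
Proof.
move=> hx; have wn : 1 < `|w n x|.
  exact: lt_le_trans (w0_outer hx) (w_outside_le lam2 (w0_outer hx) (leq0n n)).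
have := @residual_norm_power R lam lam2 x n 1 0 n hx; rewrite mul1n addn0 expr0 invr1 expr1 mulr1.
move=> /(_ (ltnW (ltn_expl n (ltnSn 1)))); rewrite -/(M x n) => h.
have : 0 < M x n * `|w n x| by apply: lt_le_trans h.
by rewrite pmulr_lgt0//; lra.
Qed.

Lemma ln_residual_norm x n k j t : x < 0 \/ 1 < x -> (k * n + j <= 2 ^ t)%N ->
  j%:R * ln `|w 0 x| <= k%:R * ln (M x n) + ln `|w t x|.
Proof.
move=> hx hd; have M0 := residual_norm_gt0 n hx; have h0 := w0_outer hx.
have wt : 1 < `|w t x| by apply: lt_le_trans h0 (w_outside_le lam2 h0 (leq0n t)).
have := residual_norm_power lam2 hx hd; rewrite -/(M x n) => h.
have w00 : 0 < `|w 0 x| by lra.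
have wt0 : 0 < `|w t x| by lra.
have p1 : 0 < M x n ^+ k by rewrite exprn_gt0.
have p2 : 0 < `|w 0 x| ^- j by rewrite invr_gt0 exprn_gt0.
have : 0 <= ln (M x n ^+ k * `|w 0 x| ^- j * `|w t x|) by rewrite ln_ge0.
rewrite lnM ?posrE ?mulr_gt0// lnM ?posrE// lnV ?posrE ?exprn_gt0// !lnXn//.
rewrite -[in X in 0 <= X -> _](mulr_natl (ln (M x n))) -[ln `|w 0 x| *+ j]mulr_natl; lra.
Qed.

Lemma widom_dyadic_of_bound x C s : 0 < C -> 1 < `|w s x| ->
  (forall t, (s <= t)%N -> 1 <= C * M x (2 ^ t) * `|w t x|) ->
  exists C' s0, forall t, (s0 <= t)%N ->
    expR (2 ^+ t * dl t - C') <= widom_factor K x (2 ^ t).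
Proof.
move=> C0 ws h; have [t0 st0 ht0] := w_far_eventually lam2 ws.
exists (ln C), t0 => t tt0; have st := leq_trans st0 tt0.
have wt : 1 < `|w t x| by apply: lt_le_trans ws (w_outside_le lam2 ws st).
have wt0 : 0 < `|w t x| by lra.
have h1 := h t st.
have M0 : 0 < M x (2 ^ t).
  have : 0 < C * M x (2 ^ t) * `|w t x| by apply: lt_le_trans h1.
  by rewrite pmulr_lgt0// pmulr_rgt0.
apply: widom_ge => //; rewrite -/(M x _) -/(g x) natrX.
have h2 := green_far lam2 ln_lam dl_cvg0 dl_ge0 wt (ht0 t tt0); rewrite -/(g x) in h2.
have : 0 <= ln (C * M x (2 ^ t) * `|w t x|) by rewrite ln_ge0.
rewrite lnM ?posrE ?mulr_gt0// lnM ?posrE//; lra.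
Qed.

(** At degree 2^t the interpolation bound and the bound for the Green function
    both contain ln |w_t x|; it cancels and leaves 2^t dl t, up to a constant
    that depends on x. *)
Lemma widom_dyadic x : ~ Kreal x -> exists C s0, forall t, (s0 <= t)%N ->
  expR (2 ^+ t * dl t - C) <= widom_factor K x (2 ^ t).
Proof.
move=> nKx; have [w0x|w0x] := lerP `|w 0 x| 1.
  have [C [s [C0 ws hs]]] := inner_bound lam2 nKx w0x.
  have w2 : 1 < `|w s.+2 x| by apply: lt_le_trans ws (w_outside_le lam2 ws _).
  apply: (@widom_dyadic_of_bound x C s.+2) => // t st.
  have [Q [sQ Q1 hQ]] := residual_real lam2 x (2 ^ t)%N.
  have := hs t Q _ (ltnW st) sQ hQ; by rewrite Q1 normr1.
have hx : x < 0 \/ 1 < x.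
  have [h|h] := ltrP x 0; first by left.
  have [h'|h'] := ltrP 1 x; first by right.
  move: w0x; rewrite w0 ltNge => /negP[]; rewrite ler_norml; apply/andP; split; lra.
apply: (@widom_dyadic_of_bound x 1 0) => // t _.
have := @residual_norm_power R lam lam2 x (2 ^ t)%N 1 0 t hx; rewrite mul1n addn0 expr0 invr1 expr1 mulr1 mul1r.
exact.
Qed.

(** The tangent bound for ln at the inverse of 1 + v. *)
Lemma ln_slope (v : R) : 0 <= v -> v / (1 + v) <= ln (1 + v).
Proof.
move=> v0; have v1 : 0 < 1 + v by lra.
have := @le_ln1Dx R ((1 + v)^-1 - 1) => /(_ _).
have -> : 1 + ((1 + v)^-1 - 1) = (1 + v)^-1 by ring.
have -> : (1 + v)^-1 - 1 = - (v / (1 + v)) by field; rewrite gt_eqF.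
rewrite lnV ?posrE// => h; rewrite -lerN2; apply: h.
by rewrite ltrN2 ltr_pdivrMr//; lra.
Qed.

(** Here w_(t+1) x is still below 2 / sqrt 3, that is, x is very close to [0,
    1] compared with the degree. Let v^2 = 2 (w_(t+1) x - 1). The Green
    function contributes about v / 2, the norm of the residual polynomial only
    loses v^2 / 2, and v is at least of order 2^t sqrt (lam 0) times the bound
    for the Harnack exponent. *)
Lemma widom_near x n t : x < 0 \/ 1 < x -> (2 ^ t <= n <= 2 ^ t.+1)%N -> w t.+1 x ^+ 2 < 4 / 3 ->
  expR (2 ^+ t.+1 * Num.sqrt (lam 0%N) * Num.sqrt ((`|w 0 x| - 1) / 2) / 25) <= widom_factor K x n.
Proof.
move=> hx /andP[tn nt] hw; have h0 := w0_outer hx.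
have ht : 1 < `|w t x| by apply: lt_le_trans h0 (w_outside_le lam2 h0 (leq0n t)).
have w1 : 1 < w t.+1 x by apply: lt_le_trans ht (w_outside_grow lam2 ht).
have wa : `|w t.+1 x| = w t.+1 x by rewrite ger0_norm//; lra.
apply: widom_ge; first exact: residual_norm_gt0.
rewrite -/(M x n) -/(g x).
have hM := @ln_residual_norm x n 1 0 t.+1 hx; rewrite mul1n addn0 mul0r mul1r wa in hM.
have {}hM := hM nt.
set v := Num.sqrt (2 * (w t.+1 x - 1)).
have v0 : 0 < v by rewrite sqrtr_gt0; lra.
have v2 : v ^+ 2 = 2 * (w t.+1 x - 1) by rewrite sqr_sqrtr//; lra.
have v1 : 0 < 1 + v by lra.
(* The numbers are slack in 1.156^2 > 4 / 3 and 0.56^2 > 2 * 0.156; v < 0.56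
   is what the lower bound v / 50 below requires. *)
have hw' : w t.+1 x < 1156 / 1000.
  rewrite -ltr_sqr ?nnegrE; [apply: (lt_trans hw)|..]; lra.
have hv : v < 14 / 25 by rewrite -ltr_sqr ?nnegrE ?(ltW v0)//; lra.
have hq : (1 + v + (1 + v)^-1) / 2 <= w t.+1 x.
  have -> : w t.+1 x = 1 + v ^+ 2 / 2 by rewrite v2; field.
  rewrite -subr_ge0.
  have -> : 1 + v ^+ 2 / 2 - (1 + v + (1 + v)^-1) / 2 = v ^+ 3 / (2 * (1 + v)) by field; rewrite gt_eqF.
  by rewrite divr_ge0 ?exprn_ge0 ?mulr_ge0// ltW.
have q1 : 1 < 1 + v by lra.
have := green_near lam2 ln_lam dl_cvg0 dl_ge0 q1 hq; rewrite -/(g x) => hg.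
have hs := ln_slope (ltW v0).
have hl : ln (w t.+1 x) <= v ^+ 2 / 2.
  have -> : w t.+1 x = 1 + v ^+ 2 / 2 by rewrite v2; field.
  by apply: le_ln1Dx; have := sqr_ge0 v; lra.
have gn : ln (1 + v) / 2 <= n%:R * g x.
  have g0 : 0 <= g x.
    have l0 : 0 <= ln (1 + v) by rewrite ln_ge0//; lra.
    by move: (le_trans l0 hg); rewrite pmulr_rge0// two_gt0.
  have : 2 ^+ t * g x <= n%:R * g x by rewrite ler_wpM2r// -natrX ler_nat.
  by rewrite exprS in hg; lra.
have hd : v / 50 <= v / (1 + v) / 2 - v ^+ 2 / 2.
  rewrite -subr_ge0.
  have -> : v / (1 + v) / 2 - v ^+ 2 / 2 - v / 50 = v * (25 - (1 + v) * (25 * v + 1)) / (50 * (1 + v)).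
    by field; rewrite gt_eqF.
  rewrite divr_ge0// ?mulr_ge0 ?(ltW v0)//; nra.
have hvk : 2 * (2 ^+ t.+1 * Num.sqrt (lam 0%N) * Num.sqrt ((`|w 0 x| - 1) / 2)) <= v.
  have e0 : 0 <= (`|w 0 x| - 1) / 2 by lra.
  rewrite -ler_sqr ?nnegrE ?mulr_ge0 ?sqrtr_ge0 ?exprn_ge0 ?(ltW v0)// v2.
  rewrite !exprMn !sqr_sqrtr// ?(ltW (lam_gt0 _))//.
  have h1 := w_growth_step lam2 h0.
  have w1' : 1 < `|w 1 x| by apply: lt_le_trans h0 (w_outside_le lam2 h0 _).
  have := w_growth lam2 t w1'; rewrite add1n wa => h2.
  have -> : (2 ^+ t.+1) ^+ 2 = 4 * 4 ^+ t :> R.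
    by rewrite -exprM mulnC exprM (_ : 2 ^+ 2 = 4 :> R) ?exprS//; ring.
  have p4 : 0 < 4 ^+ t :> R by rewrite exprn_gt0.
  have : 4 ^+ t * (4 * lam 0%N * (`|w 0 x| - 1)) <= 4 ^+ t * (`|w 1 x| - 1) by rewrite ler_pM2l.
  lra.
lra.
Qed.

(** Here the estimates are carried out at the much higher level T = 2 (t + 1)
    + D. The remainder of the division of 2^T by n costs at most ln 2 + dl 0
    per degree; divided by the quotient, which is at least 2^(t+1+D), the
    total cost is at most 1. *)
Lemma widom_far x n t D : x < 0 \/ 1 < x -> (2 ^ t <= n <= 2 ^ t.+1)%N ->
  4 / 3 <= w t.+1 x ^+ 2 -> ln 2 + dl 0%N <= 2 ^+ D ->
  expR (n%:R * dl (t.+1 + t.+1 + D)%N - 1) <= widom_factor K x n.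
Proof.
move=> hx /andP[tn nt] hw hD; have h0 := w0_outer hx.
have n0 : (0 < n)%N by apply: leq_trans tn; rewrite expn_gt0.
set T := (t.+1 + t.+1 + D)%N; set m := (2 ^ T)%N; set k := (m %/ n)%N; set j := (m %% n)%N.
have mE : m = (k * n + j)%N by rewrite /k /j -divn_eq.
have jn : (j < n)%N by rewrite ltn_mod.
have kge : (2 ^ (t.+1 + D) <= k)%N.
  by rewrite leq_divRL// /m /T -addnA [leqRHS]expnD mulnC leq_mul2r nt orbT.
have wT : 1 < `|w T x| by apply: lt_le_trans h0 (w_outside_le lam2 h0 (leq0n T)).
have wT2 : 4 / 3 <= w T x ^+ 2.
  have wt : 1 < `|w t.+1 x| by apply: lt_le_trans h0 (w_outside_le lam2 h0 (leq0n _)).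
  have := w_outside_le lam2 wt (_ : t.+1 <= T)%N; rewrite /T -addnA leq_addr => /(_ isT) hh.
  apply: (le_trans hw); rewrite -[w t.+1 x ^+ 2]real_normK ?num_real// -[leRHS]real_normK ?num_real//.
  by rewrite ler_sqr ?nnegrE.
apply: widom_ge; first exact: residual_norm_gt0.
rewrite -/(M x n) -/(g x).
have hM := @ln_residual_norm x n k j T hx; rewrite -mE leqnn in hM; have {}hM := hM isT.
have hg := green_far lam2 ln_lam dl_cvg0 dl_ge0 wT wT2; rewrite -/(g x) in hg.
have hs := ln_w_le lam2 ln_lam T h0.
have mR : m%:R = 2 ^+ T :> R by rewrite natrX.
have kR : 2 ^+ t.+1 * 2 ^+ D <= k%:R :> R by rewrite -exprD -natrX ler_nat.
have nR : n%:R <= 2 ^+ t.+1 :> R by rewrite -natrX ler_nat.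
have mER : 2 ^+ T = k%:R * n%:R + j%:R :> R by rewrite -mR mE natrD natrM.
have jR : j%:R <= n%:R :> R by rewrite ler_nat ltnW.
have N0 := two_gt0 (R := R) T.
(* gh is a lower bound for the Green function that, unlike the Green
   function itself, has an explicit upper bound. It is kept in both places
   where its multiples cancel. *)
set gh := (ln `|w T x| + 2 ^+ T * dl T) / 2 ^+ T.
have ghE : 2 ^+ T * gh = ln `|w T x| + 2 ^+ T * dl T by rewrite /gh; field; rewrite gt_eqF.
have gh1 : gh <= g x by rewrite /gh ler_pdivrMr// [leRHS]mulrC.
have l20 : 0 < ln 2 :> R by rewrite ln_gt0 ?ltr1n//.
have gh2 : gh <= ln `|w 0 x| + (ln 2 + dl 0%N).
  rewrite /gh ler_pdivrMr// [leRHS]mulrC; apply: (le_trans hs); lra.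
have G0 : 0 <= ln 2 + dl 0%N by rewrite addr_ge0// ltW.
have kpos : 0 < k%:R :> R.
  by rewrite ltr0n; apply: leq_trans kge; rewrite expn_gt0.
have j0 : 0 <= j%:R :> R by [].
have nR0 : 0 <= n%:R :> R by [].
have d0 := dl_ge0 T.
have a1 : k%:R * n%:R * gh <= k%:R * n%:R * g x by rewrite ler_wpM2l// mulr_ge0.
have a2 : j%:R * gh <= j%:R * (ln `|w 0 x| + (ln 2 + dl 0%N)) by rewrite ler_wpM2l.
have a3 : j%:R * (ln 2 + dl 0%N) <= k%:R.
  apply: le_trans kR; apply: ler_pM => //; exact: le_trans jR nR.
have a4 : 0 <= j%:R * dl T by rewrite mulr_ge0.
rewrite -(ler_pM2l kpos); move: ghE; rewrite mER => ghE; lra.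
Qed.

End WidomRegimes.

(** * Choice of the scales *)

Section ChoiceOfScales.
Context {R : realType} (c : nat -> R).
Hypothesis hc : regular_subexponential c.

(** The hypothesis on c is that this sequence decreases to 0; conversely c n
    >= e makes it at least 1 / n. *)
Definition growth_rate n : R := ln (c n) / n%:R.
Local Notation a := growth_rate.

Lemma c_gt0 n : (0 < n)%N -> 0 < c n.
Proof. by case: hc => h _ _ _ /h; apply: lt_le_trans; exact: expR_gt0. Qed.

Lemma ln_c_ge1 n : (0 < n)%N -> 1 <= ln (c n).
Proof.
by move=> n0; rewrite -[leLHS](@expRK R) ler_ln ?posrE ?expR_gt0 ?c_gt0//; case: hc => h _ _ _; exact: h.
Qed.

Lemma ln_cE n : (0 < n)%N -> ln (c n) = n%:R * a n.
Proof. by move=> n0; rewrite /a mulrCA mulfV ?mulr1// pnatr_eq0 -lt0n. Qed.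

Lemma rate_le m n : (0 < m)%N -> (m <= n)%N -> a n <= a m.
Proof. by case: hc => _ _ h _; exact: h. Qed.

Lemma rate_gt0 n : (0 < n)%N -> 0 < a n.
Proof. by move=> n0; rewrite divr_gt0 ?ltr0n//; apply: lt_le_trans (ln_c_ge1 n0). Qed.

Lemma rate1 : 1 <= a 1%N.
Proof. by rewrite /a divr1; exact: ln_c_ge1. Qed.

Section Shape.
Variable D : nat.
Let B : R := 50 * a 1%N.
(** The degree whose growth rate governs dl u. The delay is such that dl (2 (t
    + 1) + D) still sees the growth rate at degree 2^t. *)
Definition delay u := (2 ^ ((u - D)./2).-1)%N.
(** The geometric mean with the rate at degree 1 dominates the delayed rate
    itself, and by a factor that tends to infinity fast enough to absorb
    constants. The geometric summand forces ln (lam s) >= B, and B is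
    proportional to the rate at degree 1 so that sqrt (lam 0) exceeds 25 times
    that rate. *)
Definition dlseq u : R := 2 * Num.sqrt (a 1%N * a (delay u)) + B * 2^-1 ^+ u.
Definition lamseq s : R := expR (2 ^+ s.+1 * (dlseq s - dlseq s.+1)).

Let a1 : 1 <= a 1%N. Proof. exact: rate1. Qed.
Let B_ge : 50 <= B. Proof. by have h := a1; rewrite /B; lra. Qed.

Lemma delay_gt0 u : (0 < delay u)%N. Proof. by rewrite expn_gt0. Qed.

Lemma delay_le u v : (u <= v)%N -> (delay u <= delay v)%N.
Proof.
move=> uv; rewrite leq_exp2l// -!subn1 leq_sub2r// half_leq// leq_sub2r//.
Qed.

Lemma delay_shift t : delay (t.+1 + t.+1 + D) = (2 ^ t)%N.
Proof. by rewrite /delay addnK addnn doubleK. Qed.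

Lemma delay_small u : (delay u <= 2 ^ u)%N.
Proof.
rewrite leq_exp2l// (leq_trans (leq_pred _))// (leq_trans (half_leq (leq_subr _ _)))//.
by rewrite -{2}[u]odd_double_half -addnn addnA leq_addl.
Qed.

Lemma dlseq_drop s : B / 2 ^+ s.+1 <= dlseq s - dlseq s.+1.
Proof.
have : Num.sqrt (a 1%N * a (delay s.+1)) <= Num.sqrt (a 1%N * a (delay s)).
  rewrite ler_wsqrtr// ler_wpM2l//; first by have h' := a1; lra.
  by apply: rate_le; [exact: delay_gt0|exact: delay_le].
rewrite /dlseq -exprVn exprS; set p := 2^-1 ^+ s; lra.
Qed.

Lemma dlseq_ge0 s : 0 <= dlseq s.
Proof. by have h := B_ge; rewrite addr_ge0// mulr_ge0 ?sqrtr_ge0 ?exprn_ge0 ?invr_ge0//; lra. Qed.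

Lemma dlseq0 : dlseq 0 = 2 * a 1%N + B.
Proof.
by rewrite /dlseq /delay sub0n expn0 -expr2 sqrtr_sqr ger0_norm ?expr0 ?mulr1//; have h := a1; lra.
Qed.

Lemma ln_lamseq s : ln (lamseq s) = 2 ^+ s.+1 * (dlseq s - dlseq s.+1).
Proof. exact: expRK. Qed.

Lemma lamseq_ge s : expR B <= lamseq s.
Proof.
rewrite ler_expR; have := dlseq_drop s; rewrite -/B ler_pdivrMr ?exprn_gt0//.
by rewrite [leRHS]mulrC.
Qed.

Lemma lamseq2 s : 2 <= lamseq s.
Proof. by apply: le_trans (lamseq_ge s); have := @expR_ge1Dx R B; have h := B_ge; lra. Qed.

Lemma sqrt_lamseq : 25 * a 1%N <= Num.sqrt (lamseq 0).
Proof.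
apply: (@le_trans _ _ (Num.sqrt (expR B))); last by rewrite ler_wsqrtr// lamseq_ge.
have -> : B = 25 * a 1%N + 25 * a 1%N by rewrite /B; ring.
rewrite expRD -expr2 sqrtr_sqr gtr0_norm ?expR_gt0//.
by have := @expR_ge1Dx R (25 * a 1%N); lra.
Qed.

Lemma dlseq_cvg0 : dlseq @ \oo --> (0 : R).
Proof.
have h1 : (fun u => a (delay u)) @ \oo --> (0 : R).
  have hd : delay @ \oo --> \oo.
    apply/cvgnyPge => A; exists (A.+1 + A.+1 + D)%N => // n /= hn.
    apply: leq_trans (delay_le hn); rewrite delay_shift; exact/ltnW/ltn_expl.
  by case: hc => _ _ _ h; exact: (cvg_comp _ _ hd h).
have h2 : (fun u => Num.sqrt (a 1%N * a (delay u))) @ \oo --> (0 : R).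
  have h3 : (fun u => a 1%N * a (delay u)) @ \oo --> a 1%N * 0 by exact: cvgMl_tmp.
  rewrite mulr0 in h3; have := cvg_comp _ _ h3 (@sqrt_continuous R 0).
  by rewrite sqrtr0.
have h4 : (fun u => 2^-1 ^+ u : R) @ \oo --> (0 : R).
  by apply: cvg_expr; rewrite ger0_norm ?invr_ge0// invf_lt1// ltr1n.
have := cvgD (cvgMl_tmp (a := 2 : R) h2) (cvgMl_tmp (a := B) h4).
by rewrite !mulr0 addr0; exact.
Qed.

Lemma dlseq_delayed t : 2 * a (2 ^ t)%N <= dlseq (t.+1 + t.+1 + D).
Proof.
rewrite /dlseq delay_shift; have t0 : (0 < 2 ^ t)%N by rewrite expn_gt0.
have h := rate_gt0 t0; have h1 := rate_le (ltn0Sn 0) t0.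
have : a (2 ^ t)%N <= Num.sqrt (a 1%N * a (2 ^ t)%N).
  rewrite -{1}[a (2 ^ t)%N]gtr0_norm// -sqrtr_sqr ler_wsqrtr// expr2 ler_wpM2r// ltW//.
have : 0 <= B * 2^-1 ^+ (t.+1 + t.+1 + D) by have h' := B_ge; rewrite mulr_ge0 ?exprn_ge0 ?invr_ge0//; lra.
lra.
Qed.

(** Put A for the rate at degree 2^s. Then 2^s (2 sqrt (a_1 A) - A) >= 2^s
    sqrt (a_1 A), which is at least sqrt (2^s), because 2^s A >= 1 and a_1 >=
    1. *)
Lemma dlseq_dyadic C : exists s0, forall s, (s0 <= s)%N ->
  ln (c (2 ^ s)%N) + C <= 2 ^+ s * dlseq s.
Proof.
exists (Num.truncn (C ^+ 2)).+1 => s hs.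
have s0 : (0 < 2 ^ s)%N by rewrite expn_gt0.
have h := rate_gt0 s0; have h1 := rate_le (ltn0Sn 0) s0.
have cE := ln_cE s0; have l1 := ln_c_ge1 s0; rewrite natrX in cE.
rewrite cE in l1 *; set A := a _ in h h1 l1 *.
have p := two_gt0 (R := R) s.
have e1 : A <= Num.sqrt (a 1%N * A).
  by rewrite -{1}[A]gtr0_norm// -sqrtr_sqr ler_wsqrtr// expr2 ler_wpM2r// ltW.
have e2 : Num.sqrt (a 1%N * A) <= Num.sqrt (a 1%N * a (delay s)).
  rewrite ler_wsqrtr// ler_wpM2l//; first by have h' := a1; lra.
  by apply: rate_le; [exact: delay_gt0|exact: delay_small].
have e3 : C <= 2 ^+ s * Num.sqrt (a 1%N * A).
  apply: (le_trans (ler_norm C)); rewrite -sqrtr_sqr -[2 ^+ s]gtr0_norm// -sqrtr_sqr.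
  rewrite -sqrtrM ?sqr_ge0// ler_wsqrtr//.
  have q1 : C ^+ 2 <= 2 ^+ s.
    apply: le_trans (natr_le_exp2 s); apply: (@le_trans _ _ (Num.truncn (C ^+ 2)).+1%:R).
      by rewrite ltW// truncnS_gt.
    by rewrite ler_nat.
  apply: (le_trans q1); rewrite -[leLHS]mulr1.
  have -> : (2 ^+ s) ^+ 2 * (a 1%N * A) = 2 ^+ s * (2 ^+ s * A * a 1%N) by ring.
  by rewrite ler_pM2l// mulr_ege1.
have e4 : 2 ^+ s * (2 * Num.sqrt (a 1%N * A)) <= 2 ^+ s * dlseq s.
  rewrite ler_pM2l// /dlseq.
  have : 0 <= B * 2^-1 ^+ s by have h' := B_ge; rewrite mulr_ge0 ?exprn_ge0 ?invr_ge0//; lra.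
  lra.
have e5 : 2 ^+ s * A <= 2 ^+ s * Num.sqrt (a 1%N * A) by rewrite ler_pM2l.
lra.
Qed.

End Shape.
End ChoiceOfScales.

(** * The Cantor set of a regular sequence *)

Section Conclusion.
Context {R : realType} (c : nat -> R).
Hypothesis hc : regular_subexponential c.
(* dl 0 is 52 times the rate at degree 1, whatever D is, so there is no
   circularity in taking D large with respect to dl 0. *)
Let D : nat := (Num.truncn (ln 2 + 52 * growth_rate c 1%N)).+1.
Let lam := lamseq c D.
Let dl := dlseq c D.
Let lam2 : forall s, 2 <= lam s := lamseq2 hc D.
Let ln_lam : forall s, ln (lam s) = 2 ^+ s.+1 * (dl s - dl s.+1) := ln_lamseq c D.
Let dl0 : dl @ \oo --> (0 : R) := dlseq_cvg0 hc D.
Let dl_ge0 : forall s, 0 <= dl s := dlseq_ge0 hc D.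
Let gam := gamma_of lam.

Let D_large : ln 2 + dl 0%N <= 2 ^+ D.
Proof.
apply: le_trans (natr_le_exp2 D); rewrite /dl (dlseq0 hc).
apply: (@le_trans _ _ (ln 2 + 52 * growth_rate c 1%N)); last by rewrite ltW// truncnS_gt.
lra.
Qed.

Lemma Cap_gt0 : 0 < Cap (Kset gam).
Proof.
have [mu [muK musym]] := symmetric_measure_exists lam2.
by rewrite (CapE lam2 ln_lam dl0 dl_ge0 muK musym) expR_gt0.
Qed.

(** As c n >= 1, an upper bound for the exponent is enough. *)
Lemma power_le x n (e : R) : (0 < n)%N -> 0 <= e -> tau_exponent (Kset gam) x <= e ->
  c n `^ tau_exponent (Kset gam) x <= expR (e * ln (c n)).
Proof.
move=> n0 e0 h; rewrite /powR gt_eqF ?(c_gt0 hc)// ler_expR ler_wpM2r//.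
by apply: le_trans (ln_c_ge1 hc n0).
Qed.

(** If w is still small at the level of n, the degenerate Harnack exponent
    absorbs the weakness of the bound; otherwise the exponent is only bounded
    by 1 and the delayed dl dominates. *)
Lemma widom_outer x n : x < 0 \/ 1 < x -> (0 < n)%N ->
  c n `^ tau_exponent (Kset gam) x <= widom_factor (Kset gam) x n.
Proof.
move=> hx n0; pose t := trunc_log 2 n.
have /andP[tn nt] : (2 ^ t <= n < 2 ^ t.+1)%N by exact: trunc_log_bounds.
have tn' : (2 ^ t <= n <= 2 ^ t.+1)%N by rewrite tn ltnW.
have t0 : (0 < 2 ^ t)%N by rewrite expn_gt0.
have lE := ln_cE c n0; have l1 := ln_c_ge1 hc n0.
have nR : n%:R <= 2 ^+ t.+1 :> R by rewrite -natrX ler_nat ltnW.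
have n1 : 0 < n%:R :> R by rewrite ltr0n.
have [hw|hw] := ltrP (w lam t.+1 x ^+ 2) (4 / 3).
  have K0 : Kset gam (0, 0) by rewrite (KsetE lam2); split=> //=; exact: Kreal0.
  have K1 : Kset gam (1, 0) by rewrite (KsetE lam2); split=> //=; exact: Kreal1.
  have := tau_outer K0 K1 hx; rewrite -(w0 lam) => htau.
  apply: (le_trans (power_le n0 (sqrtr_ge0 _) htau)).
  apply: le_trans (widom_near lam2 ln_lam dl0 dl_ge0 hx tn' hw).
  rewrite ler_expR; set k := Num.sqrt (_ / 2); have k0 : 0 <= k by exact: sqrtr_ge0.
  have hl : ln (c n) <= 2 ^+ t.+1 * growth_rate c 1%N.
    rewrite lE; apply: ler_pM => //; first exact: ltW (rate_gt0 hc n0).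
    exact: (rate_le hc (ltn0Sn 0) n0).
  have hs : 2 ^+ t.+1 * (25 * growth_rate c 1%N) <= 2 ^+ t.+1 * Num.sqrt (lam 0%N).
    by rewrite ler_pM2l ?two_gt0//; exact: (sqrt_lamseq hc D).
  have : k * ln (c n) <= k * (2 ^+ t.+1 * Num.sqrt (lam 0%N) / 25) by rewrite ler_wpM2l//; lra.
  lra.
apply: (le_trans (power_le n0 ler01 (tau_le1 _ _))).
apply: le_trans (widom_far lam2 ln_lam dl0 dl_ge0 hx tn' hw D_large).
rewrite ler_expR mul1r lE.
have h1 := dlseq_delayed hc D t; rewrite -/dl in h1.
have h2 := rate_le hc t0 tn.
have h3 : n%:R * (2 * growth_rate c n) <= n%:R * dl (t.+1 + t.+1 + D)%N by rewrite ler_pM2l//; lra.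
rewrite lE in l1; lra.
Qed.

Lemma widom_dyadic_large x C : ~ real_trace (Kset gam) x -> exists s0, forall s, (s0 <= s)%N ->
  expR (ln (c (2 ^ s)%N) + C) <= widom_factor (Kset gam) x (2 ^ s).
Proof.
rewrite (real_trace_Kset lam2) => nKx.
have [C' [s1 h1]] := widom_dyadic lam2 ln_lam dl0 dl_ge0 nKx.
have [s2 h2] := dlseq_dyadic hc D (C + C').
exists (maxn s1 s2) => s; rewrite geq_max => /andP[s1s s2s].
apply: le_trans (h1 s s1s); rewrite ler_expR; have := h2 s s2s; rewrite -/dl; lra.
Qed.

Lemma widom_inner x : ~ real_trace (Kset gam) x -> exists s0, forall s, (s0 <= s)%N ->
  c (2 ^ s)%N `^ tau_exponent (Kset gam) x <= widom_factor (Kset gam) x (2 ^ s)%N.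
Proof.
move=> nKx; have [s0 h] := widom_dyadic_large 0 nKx; exists s0 => s hs.
have p : (0 < 2 ^ s)%N by rewrite expn_gt0.
apply: (le_trans (power_le p ler01 (tau_le1 _ _))).
by apply: le_trans (h s hs); rewrite mul1r addr0.
Qed.

Lemma widom_unbounded x : ~ real_trace (Kset gam) x ->
  ereal_sup [set (widom_factor (Kset gam) x n)%:E | n in [set n | (0 < n)%N]] = +oo%E.
Proof.
move=> nKx; apply/eqyP => A A0; have [s0 /(_ _ (leqnn s0)) h] := widom_dyadic_large A nKx.
have p : (0 < 2 ^ s0)%N by rewrite expn_gt0.
apply: (@le_trans _ _ (widom_factor (Kset gam) x (2 ^ s0)%N)%:E); last first.
  by apply: ereal_sup_ubound; exists (2 ^ s0)%N.
rewrite lee_fin; apply: le_trans h.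
have := ln_c_ge1 hc p; have := @expR_ge1Dx R (ln (c (2 ^ s0)%N) + A); lra.
Qed.

Lemma Cantor_set_exists : exists gam : nat -> R,
  [/\ admissible gam, cantor_set (Kset gam), 0 < Cap (Kset gam) &
    [/\ forall x, x < 0 \/ 1 < x -> forall n, (0 < n)%N ->
         c n `^ tau_exponent (Kset gam) x <= widom_factor (Kset gam) x n,
        forall x, ~ real_trace (Kset gam) x -> exists s0, forall s, (s0 <= s)%N ->
         c (2 ^ s)%N `^ tau_exponent (Kset gam) x <= widom_factor (Kset gam) x (2 ^ s)%N &
        forall x, ~ real_trace (Kset gam) x ->
         ereal_sup [set (widom_factor (Kset gam) x n)%:E | n in [set n | (0 < n)%N]] = +oo%E]].
Proof.
exists gam; split; [exact: gamma_of_admissible|exact: Kset_cantor|exact: Cap_gt0|].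
by split; [move=> x hx n; exact: widom_outer|exact: widom_inner|exact: widom_unbounded].
Qed.

End Conclusion.

Unset Implicit Arguments.
Set Strict Implicit.

Theorem theorem2p3 (R : realType) (c : nat -> R)
    (hc : regular_subexponential c) :
  (exists gam : nat -> R,
    [/\ admissible gam,
        cantor_set (Kset gam),
        0 < Cap (Kset gam),
        (forall x0 : R, x0 < 0 \/ 1 < x0 ->
          forall n : nat, (0 < n)%N ->
            c n `^ tau_exponent (Kset gam) x0
              <= widom_factor (Kset gam) x0 n) &
        (forall x0 : R, 0 < x0 < 1 -> ~ real_trace (Kset gam) x0 ->
          exists s0 : nat, forall s : nat, (s0 <= s)%N ->
            c (2 ^ s)%N `^ tau_exponent (Kset gam) x0
              <= widom_factor (Kset gam) x0 (2 ^ s)%N)]) /\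
  ((forall M : R, exists2 n : nat, (0 < n)%N & M < c n) ->
   exists gam : nat -> R,
    [/\ admissible gam,
        cantor_set (Kset gam),
        0 < Cap (Kset gam) &
        forall x0 : R, ~ real_trace (Kset gam) x0 ->
          ereal_sup [set (widom_factor (Kset gam) x0 n)%:E
                    | n in [set n | (0 < n)%N]] = +oo%E]).
Proof.
have [gam [adm cantor cap [outer inner unbounded]]] := Cantor_set_exists hc.
split; last by move=> _; exists gam; split.
by exists gam; split=> // x _; exact: inner.
Qed.
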